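(* There exists a compact plane set $K$ containing the origin such that $R(K)$ is normal, $R(K)$ is strongly regular at every point of $K$ other than the origin, and $R(K)$ has a nondegenerate bounded point derivation of infinite order at the origin. Moreover, $K$ can be taken to be a Swiss cheese of the form $K=\overline{\mathbb{D}}\setminus\bigcup_{D\in\mathscr{D}}D$ where $\mathscr{D}$ is a collection of open discs which satisfies the Browder condition of order $m$ at the origin for every $m\in\mathbb{N}$.
   Context: $\mathbb{N}=\{1,2,\dots\}$; $\mathbb{D}$ is the open unit disc in $\mathbb{C}$. A compact plane set is a nonempty compact subset of $\mathbb{C}$. For a compact plane set $K$, $R(K)$ is the uniform closure on $K$ of the rational functions with poles off $K$; it is a uniform algebra on $K$ (a closed subalgebra of $C(K)$, sup norm, containing constants and separating points). A Swiss cheese is a compact subset $K$ of $\overline{\mathbb{D}}$ with empty interior such that $R(K)\neq C(K)$. For a uniform algebra $A$ on a compact Hausdorff space $X$ and $x\in X$: $M_x=\{f\in A:f(x)=0\}$, $J_x=\{f\in A: f^{-1}(0)\text{ contains a neighborhood of }x\text{ in }X\}$. $A$ is strongly regular at $x$ if $\overline{J_x}=M_x$. $A$ is natural if its maximal ideal space is $X$ (points identified with point evaluations); $A$ is normal on $X$ if for disjoint closed $K_0,K_1\subset X$ there is $f\in A$ with $f=1$ on $K_1$ and $f=0$ on $K_0$; $A$ is normal if it is natural and normal on $X$. A point derivation of infinite order on $A$ at a complex homomorphism $\phi$ is a sequence $(d^{(k)})_{k=0}^\infty$ of linear functionals on $A$ with $d^{(0)}=\phi$ and $d^{(k)}(fg)=\sum_{j=0}^k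 d^{(j)}(f)\,d^{(k-j)}(g)$ for all $f,g\in A$ and all $1\le k<\infty$. It is bounded if every $d^{(k)}$ is bounded, and nondegenerate if $d^{(1)}\neq0$. A point derivation at a point $a\in K$ is one at the evaluation functional $f\mapsto f(a)$. For an open disc $D$, $r(D)$ is its radius, and for $a\in\mathbb{C}$, $s_a(D)=\inf\{|z-a|:z\in\partial D\}$. For a collection $\mathscr{D}$ of open discs, $m\in\mathbb{N}\cup\{0\}$ and $a\in\overline{\mathbb{D}}\setminus\bigcup_{D\in\mathscr{D}}D$, the $m$th order Browder sum for $\mathscr{D}$ at $a$ is $\sum_{D\in\mathscr{D}\cup\{\mathbb{D}\}} r(D)/s_a(D)^{m+1}$, and $\mathscr{D}$ satisfies the Browder condition of order $m$ at $a$ if this sum is finite. By convention every disc in $\mathscr{D}$ is assumed to intersect $\mathbb{D}$. *)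

(* Defs.v *)
From mathcomp Require Import all_boot all_order all_algebra complex.
From mathcomp Require Import all_classical all_reals all_analysis.

Set Implicit Arguments.
Unset Strict Implicit.
Unset Printing Implicit Defensive.

Import Order.TTheory GRing.Theory Num.Theory numFieldNormedType.Exports.

Local Open Scope classical_set_scope.
Local Open Scope complex_scope.
Local Open Scope ring_scope.

(* The complex plane is [R[i]^o] with [R : realType]; the [^o] gives access to
   the topology of the modulus.  [Num.norm] and radii of [ball] on it live in
   [R[i]] itself; [Normc.normc] is the modulus with values in [R]. *)

(* An algebra of functions on [X] is a set [A] of functions [X -> R[i]^o].  A
   functional on [A] is represented by a function defined on all of
   [X -> R[i]^o], and every definition only looks at its values on [A]. *)
Section UniformAlgebras.
Variables (R : realType) (X : topologicalType).
Local Notation C := R[i]^o.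
Implicit Types (A : set (X -> C)) (phi : (X -> C) -> C) (x : X).

Definition uniform_closure (S : set (X -> C)) : set (X -> C) :=
  closure (S : set {uniform X -> C}).

Definition continuous_functions : set (X -> C) := [set f | continuous f].

(* The supremum is meaningful for bounded functions, in particular for
   continuous functions on a nonempty compact space. *)
Definition sup_norm (f : X -> C) : R :=
  sup [set Normc.normc (f x) | x in [set: X]].

Definition M_ A x : set (X -> C) := [set f | A f /\ f x = 0].

Definition J_ A x : set (X -> C) :=
  [set f | A f /\ nbhs x (f @^-1` [set 0])].

Definition strongly_regular_at A x : Prop := uniform_closure (J_ A x) = M_ A x.

Definition linear_functional A phi : Prop :=
  forall (a : C) (f g : X -> C), A f -> A g ->
    phi (fun x => a * f x + g x) = a * phi f + phi g.

Definition bounded_functional A phi : Prop :=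
  exists B : R, forall f, A f -> Normc.normc (phi f) <= B * sup_norm f.

Definition complex_homomorphism A phi : Prop :=
  [/\ linear_functional A phi,
      forall f g, A f -> A g -> phi (fun x => f x * g x) = phi f * phi g &
      exists2 f, A f & phi f <> 0].

Definition evaluation x : (X -> C) -> C := fun f => f x.

(* [X] is the maximal ideal space of [A].  When [A] is a uniform algebra on a
   compact Hausdorff space, the bijection between points and characters is
   automatically a homeomorphism. *)
Definition natural A : Prop :=
  (forall x, complex_homomorphism A (evaluation x)) /\
  (forall phi, complex_homomorphism A phi ->
     exists! x, forall f, A f -> phi f = evaluation x f).

Definition normal_on A : Prop :=
  forall K0 K1 : set X, closed K0 -> closed K1 -> K0 `&` K1 = set0 ->
    exists2 f, A f &
      (forall x, K1 x -> f x = 1) /\ (forall x, K0 x -> f x = 0).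

Definition normal_algebra A : Prop := natural A /\ normal_on A.

Definition point_derivation_infinite_order A phi (d : nat -> (X -> C) -> C) :
    Prop :=
  [/\ forall k, linear_functional A (d k),
      forall f, A f -> d 0%N f = phi f &
      forall f g, A f -> A g -> forall k, (1 <= k)%N ->
        d k (fun x => f x * g x) =
          \sum_(0 <= j < k.+1) d j f * d (k - j)%N g].

Definition bounded_derivation A (d : nat -> (X -> C) -> C) : Prop :=
  forall k, bounded_functional A (d k).

Definition nondegenerate_derivation A (d : nat -> (X -> C) -> C) : Prop :=
  exists2 f, A f & d 1%N f <> 0.

End UniformAlgebras.

Section PlaneSets.
Variable R : realType.
Local Notation C := R[i]^o.
Implicit Types K : set C.

Definition compact_plane_set K : Prop := K !=set0 /\ compact K.

Definition rational_functions K : set (set_type K -> C) :=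
  [set f | exists p q : {poly R[i]}, forall z : set_type K,
     q.[set_val z] != 0 /\ f z = p.[set_val z] / q.[set_val z]].

Definition rational_algebra K : set (set_type K -> C) :=
  uniform_closure (@rational_functions K).

(* A disc is given by its center and its radius. *)
Definition open_disc : Type := (C * {posnum R})%type.

Definition center (D : open_disc) : C := D.1.
Definition radius (D : open_disc) : R := D.2%:num.
Definition disc_set (D : open_disc) : set C := ball (center D) (radius D)%:C.

Definition unit_disc : open_disc := (0, 1%:pos).

Definition swiss_cheese K : Prop :=
  [/\ compact K, K `<=` closure (disc_set unit_disc), interior K = set0 &
      @rational_algebra K <> @continuous_functions R (set_type K)].

Definition disc_complement (DD : set open_disc) : set C :=
  closure (disc_set unit_disc) `\` \bigcup_(D in DD) disc_set D.

Definition boundary (S : set C) : set C := closure S `\` interior S.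

Definition s_ (a : C) (D : open_disc) : R :=
  inf [set Normc.normc (z - a) | z in boundary (disc_set D)].

(* The quotient is taken in [\bar R], where [r%:E / 0 = +oo] for [0 < r]. *)
Definition browder_sum (DD : set open_disc) (m : nat) (a : C) : \bar R :=
  \esum_(D in DD `|` [set unit_disc])
     ((radius D)%:E / (s_ a D ^+ m.+1)%:E)%E.

Definition browder_condition (DD : set open_disc) (m : nat) (a : C) : Prop :=
  disc_complement DD a /\ (browder_sum DD m a < +oo)%E.

End PlaneSets.

Arguments rational_algebra {R} K.

(* Main.v *)
(** Countably many stages of open discs are deleted from the closed unit disc.
    The discs of stage n keep their centers a at distance at least 2^-n from the
    origin and have total radius at most 2^-((n+1)(n+20)), so the sums of
    r / |a|^j are finite for every j, which gives the Browder conditions, and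
    tiny for j = 1.

    For a rational function f = p / q without poles on K, summing the increments
    of f(z) z^-j over a fine lattice against a Lipschitz cutoff that vanishes on
    the discs is a discrete Cauchy formula: it bounds the Taylor coefficients of
    f at the origin by the supremum of |f| on K.  Hence they extend to R(K) and
    form the point derivation.  If R(K) were C(K), then z would be a limit of
    products of two functions vanishing at the origin, and would be killed by
    the first derivation.

    Each stage consists of two families.  Discs around the poles of functions
    1 / (1 - (w / r)^n) make infinite compositions of such functions converge off
    the discs to exact cutoffs chi, equal to 1 near x and to 0 away from x, with
    |chi(z)| |z - x|^4 small; finitely many of them give normality, and they put
    (z - x)^4 in the closure of J_x.  A fine square lattice of discs carries a
    bounded function with huge derivative at x; dividing by that derivative
    gives G with z - x + (z - x)^2 G(z) small on K, which allows one to descend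
    from (z - x)^4 to z - x and so gives strong regularity at x. *)
Require Import Defs.
From mathcomp Require Import all_boot all_order all_algebra complex.
From mathcomp Require Import all_classical all_reals all_analysis.
From mathcomp Require Import ring lra zify.
Import Order.TTheory GRing.Theory Num.Theory numFieldNormedType.Exports.
Local Open Scope classical_set_scope.
Local Open Scope complex_scope.
Local Open Scope ring_scope.
Set Implicit Arguments.
Unset Strict Implicit.
Unset Printing Implicit Defensive.
Import Normc.

(** * The modulus *)

Section Modulus.
Variable R : realType.
Implicit Types (x y z : R[i]) (r : R).

Lemma normc_ge0 z : 0 <= normc z.
Proof. by case: z => a b; rewrite /normc sqrtr_ge0. Qed.

Lemma normcE z : `|z| = (normc z)%:C.
Proof. by rewrite normc_def; case: z. Qed.

Lemma ler_normcD x y : normc (x + y) <= normc x + normc y.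
Proof. exact: le_normcD. Qed.

Lemma normc_opp z : normc (- z) = normc z.
Proof. exact: normcN. Qed.

Lemma normcB x y : normc (x - y) = normc (y - x).
Proof. by rewrite -normc_opp opprB. Qed.

Lemma ler_normcB x y : normc (x - y) <= normc x + normc y.
Proof. by rewrite (le_trans (ler_normcD _ _)) // normc_opp. Qed.

Lemma ler_normc_dist z x y : normc (x - y) <= normc (x - z) + normc (z - y).
Proof. by rewrite -[x - y](subrKA z) ler_normcD. Qed.

Lemma lerB_normc x y : normc x - normc y <= normc (x - y).
Proof. by rewrite lerBlDr -{1}[x](subrK y) ler_normcD. Qed.

Lemma normc_eq0 z : (normc z == 0) = (z == 0).
Proof. by apply/eqP/eqP => [/eq0_normc|->] //; rewrite normc0. Qed.

Lemma normc_gt0 z : (0 < normc z) = (z != 0).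
Proof. by rewrite lt_def normc_ge0 andbT normc_eq0. Qed.

Lemma normc_real r : normc r%:C = `|r|.
Proof. by rewrite /normc /= expr0n addr0 sqrtr_sqr. Qed.

Lemma normcX z n : normc (z ^+ n) = normc z ^+ n.
Proof. by elim: n => [|n IH]; rewrite ?normc1 // !exprS normcM IH. Qed.

Lemma normc_div x y : normc (x / y) = normc x / normc y.
Proof. by rewrite normcM normcV. Qed.

Lemma normc_i : normc 'i%C = 1 :> R.
Proof. by rewrite /normc /= expr0n expr1n add0r sqrtr1. Qed.

Lemma ler_normc_sum (I : Type) (s : seq I) (P : pred I) (F : I -> R[i]) :
  normc (\sum_(i <- s | P i) F i) <= \sum_(i <- s | P i) normc (F i).
Proof.
elim/big_rec2: _ => [|i y x _ le_xy]; first by rewrite normc0.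
by rewrite (le_trans (ler_normcD _ _)) // lerD2l.
Qed.

Lemma normc_sqr z : normc z ^+ 2 = complex.Re z ^+ 2 + complex.Im z ^+ 2.
Proof. by case: z => a b; rewrite sqr_sqrtr //= addr_ge0 ?sqr_ge0. Qed.

Lemma ler_Re z : `|complex.Re z| <= normc z.
Proof.
case: z => a b; rewrite /normc -sqrtr_sqr ler_sqrt ?lerDl ?sqr_ge0 //.
by rewrite addr_ge0 ?sqr_ge0.
Qed.

Lemma ler_Im z : `|complex.Im z| <= normc z.
Proof.
case: z => a b; rewrite /normc -sqrtr_sqr ler_sqrt ?lerDr ?sqr_ge0 //.
by rewrite addr_ge0 ?sqr_ge0.
Qed.

Lemma ler_normc_ReIm z : normc z <= `|complex.Re z| + `|complex.Im z|.
Proof.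
rewrite {1}[z]complexE (le_trans (ler_normcD _ _)) // normcM normc_i mul1r.
by rewrite !normc_real.
Qed.

End Modulus.

(** * Approximate step functions with poles on a circle *)

Section Circle.
Variable R : realType.
Implicit Types (w c : R[i]) (b g t tau : R) (k n : nat).

(* The solutions of c * w ^ (2 ^ k) = 1. *)
Fixpoint circle_poles k c : seq R[i] :=
  if k is k'.+1 then circle_poles k' (sqrtc c) ++ circle_poles k' (- sqrtc c)
  else [:: c^-1].

Lemma size_circle_poles k c : size (circle_poles k c) = (2 ^ k)%N.
Proof. by elim: k c => // k IH c; rewrite size_cat !IH expnS mul2n addnn. Qed.

Lemma normc_sqrtc c : normc c = 1 -> normc (sqrtc c) = 1.
Proof.
move=> c1; apply/eqP; rewrite -[_ == 1](@eqrXn2 _ 2) ?normc_ge0 //.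
by rewrite -normcX sqr_sqrtc c1 expr1n.
Qed.

Lemma circle_poles_norm k c a : normc c = 1 -> a \in circle_poles k c ->
  normc a = 1.
Proof.
elim: k c => [|k IH] c c1 /=.
  by rewrite inE => /eqP ->; rewrite normcV c1 invr1.
by rewrite mem_cat => /orP[] /IH; apply; rewrite ?normc_opp normc_sqrtc.
Qed.

(* Induction on k: 1/(1 - s^2 X^2) is the average of 1/(1 - s X) and
   1/(1 + s X). *)
Lemma circle_poles_bound k c w tau : normc c = 1 -> 0 < tau ->
  (forall a, a \in circle_poles k c -> tau <= normc (w - a)) ->
  1 - c * w ^+ (2 ^ k) != 0 /\ normc (1 - c * w ^+ (2 ^ k))^-1 <= tau^-1.
Proof.
elim: k c => [|k IH] c c1 tau0 dist.
  have {}dist : tau <= normc (1 - c * w).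
    have := dist c^-1; rewrite inE eqxx => /(_ isT).
    rewrite -[leRHS]mul1r -c1 -normcM mulrBr divff -?normc_eq0 ?c1 ?oner_eq0//.
    by rewrite normcB.
  rewrite expr1 -normc_gt0 (lt_le_trans tau0) // normcV lef_pV2 //.
  by rewrite posrE (lt_le_trans tau0).
have s1 := normc_sqrtc c1; rewrite expnS mulnC exprM.
set s := sqrtc c in s1; set X := w ^+ (2 ^ k).
have sN1 : normc (- s) = 1 by rewrite normc_opp.
have [|p0 pb] := IH s s1 tau0.
  by move=> a ain; apply: dist; rewrite /= mem_cat ain.
have [|m0 mb] := IH (- s) sN1 tau0.
  by move=> a ain; apply: dist; rewrite /= mem_cat ain orbT.
rewrite -/X in p0 pb m0 mb.
have -> : 1 - c * X ^+ 2 = (1 - s * X) * (1 - - s * X).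
  by rewrite -[c]sqr_sqrtc -/s; ring.
rewrite mulf_neq0 //; split => //.
have -> : ((1 - s * X) * (1 - - s * X))^-1 =
    (2^-1 : R)%:C * ((1 - s * X)^-1 + (1 - - s * X)^-1).
  have -> : ((2^-1 : R)%:C = 2^-1 :> R[i])%C by rewrite fmorphV rmorph_nat.
  by field; rewrite p0 m0.
rewrite normcM normc_real ger0_norm ?invr_ge0 //.
have := ler_normcD (1 - s * X)^-1 (1 - - s * X)^-1; lra.
Qed.

Definition step_block (r : R) k w : R[i] := (1 - (w / r%:C) ^+ (2 ^ k))^-1.

Definition step_block_poles (r : R) k := [seq r%:C * a | a <- circle_poles k 1].

Lemma step_block_bound r k w tau : 0 < r -> 0 < tau ->
  (forall a, a \in step_block_poles r k -> tau <= normc (w - a)) ->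
  1 - (w / r%:C) ^+ (2 ^ k) != 0 /\ normc (step_block r k w) <= r / tau.
Proof.
move=> r0 tau0 dist.
have rC : (r%:C != 0 :> R[i])%C by rewrite -normc_gt0 normc_real normr_gt0 gt_eqF.
have := @circle_poles_bound k 1 (w / r%:C) (tau / r) (normc1 _).
rewrite divr_gt0 // mul1r invf_div; apply=> // a ain.
have -> : w / r%:C - a = (w - r%:C * a) / r%:C by field.
rewrite normc_div normc_real gtr0_norm // ler_pM2r ?invr_gt0 // dist //.
exact: map_f.
Qed.

Lemma bernoulli4 g n : 0 <= g -> (4 %| n)%N ->
  (g * n%:R / 4) ^+ 4 + 1 <= (1 + g) ^+ n.
Proof.
move=> g0 /dvdnP[m ->]; rewrite exprM.
have -> : g * (m * 4)%:R / 4 = m%:R * g by rewrite natrM; field.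
have bern : 1 + m%:R * g <= (1 + g) ^+ m.
  elim: m => [|m IH]; first by rewrite mul0r addr0 expr0.
  rewrite exprS; apply: le_trans (ler_wpM2l _ IH); last by lra.
  have : 0 <= m%:R * g * g by rewrite !mulr_ge0.
  rewrite -natr1; lra.
have mg : 0 <= m%:R * g by rewrite mulr_ge0.
have m1 : 0 <= 1 + m%:R * g by lra.
apply: le_trans (lerXn2r 4 _ _ bern); rewrite ?nnegrE ?exprn_ge0 //; last lra.
set x := m%:R * g in mg *.
have -> : (1 + x) ^+ 4 = x ^+ 4 + 1 + (4 * x + 6 * x ^+ 2 + 4 * x ^+ 3) by ring.
by rewrite lerDl !addr_ge0 ?mulr_ge0 ?exprn_ge0.
Qed.

(* A gap of relative size g on either side of the circle makes the block
   (4/(g n))^4-close to 1 inside and to 0 outside. *)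
Lemma step_block_inside r k w g : 0 < r -> 0 < g -> (1 < k)%N ->
  normc w * (1 + g) <= r ->
  normc (1 - step_block r k w) <= (4 / (g * (2 ^ k)%:R)) ^+ 4.
Proof.
move=> r0 g0 k1 wr; rewrite /step_block; set X := (w / r%:C) ^+ _.
set n := (2 ^ k)%N in X *; have n0 : (0 < n)%N by rewrite expn_gt0.
have n0R : 0 < n%:R :> R by rewrite ltr0n.
have n4 : (4 %| n)%N by rewrite /n -(subnK k1) expnD dvdn_mull.
set y := (g * n%:R / 4) ^+ 4.
have y0 : 0 < y by rewrite exprn_gt0 // !divr_gt0 ?mulr_gt0.
have Xy : normc X * (y + 1) <= 1.
  apply: (@le_trans _ _ (normc X * (1 + g) ^+ n)).
    by rewrite ler_wpM2l ?normc_ge0 // bernoulli4 // ltW.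
  rewrite normcX -exprMn exprn_ile1 //.
    by rewrite mulr_ge0 ?normc_ge0 //; lra.
  by rewrite normc_div normc_real gtr0_norm // mulrAC ler_pdivrMr // mul1r.
have -> : (4 / (g * n%:R)) ^+ 4 = y^-1 by rewrite -exprVn invf_div.
have nX : normc X < 1 by have := normc_ge0 X; nra.
have X1 : 1 - X != 0.
  by apply: contraTneq nX => /subr0_eq <-; rewrite normc1 ltxx.
have -> : 1 - (1 - X)^-1 = - (X / (1 - X)) by field.
rewrite normc_opp normc_div ler_pdivrMr ?normc_gt0 // mulrC ler_pdivlMr //.
have := lerB_normc 1 X; rewrite normc1; nra.
Qed.

Lemma step_block_outside r k w g : 0 < r -> 0 < g -> (1 < k)%N ->
  r * (1 + g) <= normc w ->
  normc (step_block r k w) <= (4 / (g * (2 ^ k)%:R)) ^+ 4.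
Proof.
move=> r0 g0 k1 wr; rewrite /step_block; set X := (w / r%:C) ^+ _.
set n := (2 ^ k)%N in X *; have n0 : (0 < n)%N by rewrite expn_gt0.
have n0R : 0 < n%:R :> R by rewrite ltr0n.
have n4 : (4 %| n)%N by rewrite /n -(subnK k1) expnD dvdn_mull.
set y := (g * n%:R / 4) ^+ 4.
have y0 : 0 < y by rewrite exprn_gt0 // !divr_gt0 ?mulr_gt0.
have Xy : y + 1 <= normc X.
  apply: (le_trans (bernoulli4 (ltW g0) n4)).
  rewrite normcX lerXn2r ?nnegrE ?normc_ge0 //; first lra.
  by rewrite normc_div normc_real gtr0_norm // ler_pdivlMr // mulrC.
have -> : (4 / (g * n%:R)) ^+ 4 = y^-1 by rewrite -exprVn invf_div.
have yX : y <= normc (1 - X).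
  by have := lerB_normc X 1; rewrite normc1 normcB; lra.
by rewrite normcV lef_pV2 // posrE (lt_le_trans y0).
Qed.

End Circle.

(** * Families of discs and rational functions with poles in them *)

Section DiscFamilies.
Variable R : realType.
Local Notation disc_center D := (Defs.center D : R[i]).
Local Notation disc_radius D := (Defs.radius D).
Implicit Types (D : open_disc R) (S : set (open_disc R)) (z : R[i]).

Lemma disc_setE D z : disc_set D z = (normc (z - disc_center D) < disc_radius D) :> Prop.
Proof. by rewrite /disc_set -ball_normE /= normcE normcB ltcR. Qed.

Lemma radius_gt0 D : 0 < disc_radius D.
Proof. by rewrite /Defs.radius. Qed.

Definition off_discs S z := forall D, S D -> disc_radius D <= normc (z - disc_center D).

Lemma off_discs_sub S S' z : S `<=` S' -> off_discs S' z -> off_discs S z.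
Proof. by move=> SS' offz D /SS' /offz. Qed.

Definition sum_bounded (w : open_disc R -> R) S (B : R) :=
  forall s : seq (open_disc R), uniq s -> (forall D, D \in s -> S D) ->
    \sum_(D <- s) w D <= B.

Lemma sum_bounded_list w (l : seq (open_disc R)) B : (forall D, 0 <= w D) ->
  \sum_(D <- l) w D <= B -> sum_bounded w [set D | D \in l] B.
Proof.
move=> w0 lB s us sl; apply: le_trans lB.
elim: s l us sl => [|D s IH] l /=; first by rewrite big_nil sumr_ge0.
case/andP=> Ds us sl; have Dl : D \in l by apply: sl; rewrite inE eqxx.
rewrite big_cons (perm_big _ (perm_to_rem Dl)) big_cons lerD2l IH // => D' D's.
have := sl D'; rewrite inE D's orbT => /(_ isT) /= D'l.
rewrite (perm_mem (perm_to_rem Dl)) inE in D'l.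
by case/orP: D'l => // /eqP D'D; rewrite -D'D D's in Ds.
Qed.

Lemma sum_bounded_sub w S S' B : S `<=` S' ->
  sum_bounded w S' B -> sum_bounded w S B.
Proof. by move=> SS' S'B s us sS; apply: S'B => // D /sS /SS'. Qed.

Lemma sum_bounded_le w S B B' : B <= B' ->
  sum_bounded w S B -> sum_bounded w S B'.
Proof. by move=> BB' SB s us sS; apply: le_trans BB'; exact: SB. Qed.

Lemma sum_bounded_scale w w' S B c : 0 <= c ->
  (forall D, S D -> w D <= c * w' D) -> sum_bounded w' S B ->
  sum_bounded w S (c * B).
Proof.
move=> c0 ww' SB s us sS; apply: (@le_trans _ _ (c * \sum_(D <- s) w' D)).
  rewrite mulr_sumr !big_seq ler_sum // => D /sS; exact: ww'.
by rewrite ler_wpM2l // SB.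
Qed.

Lemma sum_boundedU w S S' B B' : sum_bounded w S B -> sum_bounded w S' B' ->
  sum_bounded w (S `|` S') (B + B').
Proof.
move=> SB SB' s us sS; rewrite (bigID (fun D => `[< S D >])) /=.
rewrite -!(big_filter s) lerD //.
  by apply: SB => [|D]; rewrite ?filter_uniq // mem_filter => /andP[/asboolP].
apply: SB' => [|D]; first by rewrite filter_uniq.
by rewrite mem_filter => /andP[/asboolP nSD /sS[]].
Qed.

Lemma sum_bounded_bigcup w (S : nat -> set (open_disc R)) (b : nat -> R) B :
  (forall n, sum_bounded w (S n) (b n)) ->
  (forall n, \sum_(i < n) b i <= B) ->
  sum_bounded w (\bigcup_n S n) B.
Proof.
move=> Sb bB s us sS.
have [N sN] : exists N, forall D, D \in s -> exists2 n, (n < N)%N & S n D.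
  elim: s sS {us} => [|D s IH] sS; first by exists 0%N.
  have [|N sN] := IH; first by move=> D' D's; apply: sS; rewrite inE D's orbT.
  have [|n _ SnD] := sS D; first by rewrite inE eqxx.
  exists (maxn N n.+1) => D'; rewrite inE => /orP[/eqP ->|/sN[m mN SmD']].
    by exists n; rewrite // leq_max ltnSn orbT.
  by exists m; rewrite // leq_max mN.
apply: le_trans (bB N).
elim: N s us sN {sS} => [|N IH] s us sN.
  rewrite big_ord0; case: s us sN => [|D s] _ sN; first by rewrite big_nil.
  by have [|] := sN D; rewrite ?inE ?eqxx.
rewrite big_ord_recr (bigID (fun D => `[< exists2 n, (n < N)%N & S n D >])) /=.
rewrite -!(big_filter s) lerD //.
  by apply: IH => [|D]; rewrite ?filter_uniq // mem_filter => /andP[/asboolP].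
apply: Sb => [|D]; first by rewrite filter_uniq.
rewrite mem_filter => /andP[/asboolP nSD /sN[n]].
rewrite ltnS leq_eqVlt => /orP[/eqP ->//|nN SnD].
by case: nSD; exists n.
Qed.

Definition rational_off S (f : R[i] -> R[i]) :=
  exists p q : {poly R[i]}, forall z, off_discs S z ->
    q.[z] != 0 /\ f z = p.[z] / q.[z].

Lemma rational_off_cst S c : rational_off S (fun=> c).
Proof. by exists c%:P, 1 => z _; rewrite !hornerC oner_neq0 divr1. Qed.

Lemma rational_offD S f g : rational_off S f -> rational_off S g ->
  rational_off S (fun z => f z + g z).
Proof.
move=> [p [q fpq]] [p' [q' gpq]]; exists (p * q' + p' * q), (q * q') => z zS.
have [q0 ->] := fpq z zS; have [q'0 ->] := gpq z zS.
rewrite !hornerE mulf_neq0 //; split => //.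
by field; rewrite q0 q'0.
Qed.

Lemma rational_offM S f g : rational_off S f -> rational_off S g ->
  rational_off S (fun z => f z * g z).
Proof.
move=> [p [q fpq]] [p' [q' gpq]]; exists (p * p'), (q * q') => z zS.
have [q0 ->] := fpq z zS; have [q'0 ->] := gpq z zS.
rewrite !hornerM mulf_neq0 //; split => //.
by field; rewrite q0 q'0.
Qed.

Lemma rational_offN S f : rational_off S f -> rational_off S (fun z => - f z).
Proof.
move=> [p [q fpq]]; exists (- p), q => z zS.
by have [q0 ->] := fpq z zS; rewrite !hornerE mulNr.
Qed.

Lemma rational_offB S f g : rational_off S f -> rational_off S g ->
  rational_off S (fun z => f z - g z).
Proof. by move=> fS gS; apply: rational_offD => //; exact: rational_offN. Qed.

Lemma rational_offV S (q : {poly R[i]}) :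
  (forall z, off_discs S z -> q.[z] != 0) ->
  rational_off S (fun z => (q.[z])^-1).
Proof. by move=> q0; exists 1, q => z /q0; rewrite hornerC mul1r. Qed.

Lemma rational_off_sum S (I : Type) (s : seq I) (F : I -> R[i] -> R[i]) :
  (forall i, rational_off S (F i)) ->
  rational_off S (fun z => \sum_(i <- s) F i z).
Proof.
move=> FS; elim: s => [|i s IH].
  by under eq_fun do rewrite big_nil; exact: rational_off_cst.
by under eq_fun do rewrite big_cons; exact: rational_offD.
Qed.

Lemma rational_off_sub S S' f : S `<=` S' ->
  rational_off S f -> rational_off S' f.
Proof.
by move=> SS' [p [q fpq]]; exists p, q => z /(off_discs_sub SS') /fpq.
Qed.

End DiscFamilies.

(** * Exact cutoffs *)

Section StepRecursion.
Variable R : realType.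
Implicit Types (H K : nat -> R[i]).

(* Multiplying by H kills the function outside, multiplying 1 - f by 1 - K
   makes it tend to 1 inside. *)
Fixpoint step_seq H K f0 n : R[i] :=
  if n is m.+1 then H m * step_seq H K f0 m * (1 - K m) + K m else f0.

Lemma step_seq_bounds H K f0 (x A : R) (b b' M s : nat -> R) :
  (forall m n, b' m <= b n) ->
  (forall n, 0 <= s n <= 1) -> (forall n, s n.+1 <= s n) ->
  (forall n, normc (H n) <= M n) -> (forall n, normc (K n) <= M n) ->
  (forall n, x <= b n -> normc (1 - H n) <= s n.+1) ->
  (forall n, b n.+1 <= x -> normc (H n) <= s n.+1) ->
  (forall n, x <= b' n.+1 -> normc (1 - K n) <= s n.+1) ->
  (forall n, b' n <= x -> normc (K n) <= s n.+1) ->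
  (x <= b' 0%N -> normc (1 - f0) <= s 0%N) ->
  (b 0%N <= x -> normc f0 <= s 0%N) ->
  1 + normc f0 <= A ->
  (forall n, (1 + M n) * (7 * A + 3) * s n <= 2^-1 ^+ n.+1) ->
  forall n, let f := step_seq H K f0 in
    [/\ normc (f n) <= A, normc (f n.+1 - f n) <= 2^-1 ^+ n.+1,
        b n <= x -> normc (f n) <= (2 * A + 1) * s n &
        x <= b' n -> normc (1 - f n) <= (2 * A + 1) * s n].
Proof.
move=> bb s01 sS HM KM H1 H0 K1 K0 f1 f0' fA small n f.
have normM3 (a c d e : R[i]) (u v w y : R) : normc a <= u -> normc c <= v ->
    normc d <= w -> normc e <= y -> normc (a * c * d + e) <= u * v * w + y.
  move=> au cv dw ey; apply: (le_trans (ler_normcD _ _)); rewrite lerD //.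
  by rewrite !normcM !ler_pM ?mulr_ge0 ?normc_ge0.
have norm1B (a : R[i]) u : normc a <= u -> normc (1 - a) <= 1 + u.
  by move=> au; apply: (le_trans (ler_normcB _ _)); rewrite normc1 lerD2l.
have norm1B' (a : R[i]) u : normc (1 - a) <= u -> normc a <= 1 + u.
  by move=> au; rewrite -[a](subKr 1) norm1B.
have A1 : 1 <= A by apply: le_trans fA; rewrite lerDl normc_ge0.
have M0 m : 0 <= M m by apply: le_trans (HM m); exact: normc_ge0.
have outer m : normc (f m) <= A -> b m.+1 <= x ->
    normc (f m.+1) <= (2 * A + 1) * s m.+1.
  move=> fmA bx; have /andP[sm0 sm1] := s01 m.+1.
  have Km := K0 m (le_trans (bb _ _) bx).
  have -> : (2 * A + 1) * s m.+1 = s m.+1 * A * (1 + 1) + s m.+1 by ring.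
  apply: normM3 => //; first exact: H0.
  by apply: norm1B; exact: le_trans Km sm1.
have inner m : normc (f m) <= A -> x <= b' m.+1 ->
    normc (1 - f m.+1) <= (2 * A + 1) * s m.+1.
  move=> fmA bx; have /andP[sm0 sm1] := s01 m.+1.
  have -> : 1 - f m.+1 = (1 - H m * f m) * (1 - K m) by rewrite /f /=; ring.
  rewrite normcM ler_pM ?normc_ge0 ?K1 //.
  rewrite [2 * A + 1]addrC norm1B // normcM ler_pM ?normc_ge0 //.
  have Hm := H1 m (le_trans bx (bb _ _)).
  by have := norm1B' _ _ Hm; lra.
have base : (b 0%N <= x -> normc (f 0%N) <= (2 * A + 1) * s 0%N) /\
    (x <= b' 0%N -> normc (1 - f 0%N) <= (2 * A + 1) * s 0%N).
  have /andP[s0 _] := s01 0%N.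
  by split=> [/f0'|/f1] => /le_trans; apply; rewrite ler_peMl //; lra.
have diff m : normc (f m) <= A ->
    (b m <= x -> normc (f m) <= (2 * A + 1) * s m) ->
    (x <= b' m -> normc (1 - f m) <= (2 * A + 1) * s m) ->
    normc (f m.+1 - f m) <= 2^-1 ^+ m.+1.
  move=> fmA fo fi; apply: le_trans (small m).
  have /andP[sm0 sm1] := s01 m; have /andP[sm0' sm1'] := s01 m.+1.
  have Mm := M0 m; have sSm := sS m.
  have -> : f m.+1 - f m = K m * (1 - f m) - (1 - H m) * (1 - K m) * f m.
    by rewrite /f /=; ring.
  have bound (u v w y t : R) : normc (K m) <= u -> normc (1 - f m) <= v ->
      normc (1 - H m) <= w -> normc (1 - K m) <= y -> normc (f m) <= t ->
      normc (K m * (1 - f m) - (1 - H m) * (1 - K m) * f m)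
        <= u * v + w * y * t.
    move=> ku fv hw ky ft; apply: (le_trans (ler_normcB _ _)).
    by rewrite lerD // !normcM !ler_pM ?mulr_ge0 ?normc_ge0.
  set B := (1 + M m) * (7 * A + 3) * s m.
  have As : 0 <= A * s m by rewrite mulr_ge0 //; lra.
  have MAs : 0 <= M m * A * s m by rewrite !mulr_ge0 //; lra.
  have Ms : 0 <= M m * s m by rewrite mulr_ge0.
  have BE : B = 7 * (A * s m) + 3 * s m + 7 * (M m * A * s m) + 3 * (M m * s m).
    by rewrite /B; ring.
  have Km' : b' m <= x -> normc (K m) <= s m.
    by move=> /K0 /le_trans; apply.
  have Hm' : x <= b m -> normc (1 - H m) <= s m.
    by move=> /H1 /le_trans; apply.
  have [xb|bx] := leP (b m) x.
    have Km := Km' (le_trans (bb _ _) xb).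
    apply: le_trans (bound (s m) (1 + A) (1 + M m) 2 ((2 * A + 1) * s m)
      Km (norm1B _ _ fmA) (norm1B _ _ (HM m)) _ (fo xb)) _.
      by have := norm1B _ _ Km; lra.
    have -> : s m * (1 + A) + (1 + M m) * 2 * ((2 * A + 1) * s m) =
      5 * (A * s m) + 3 * s m + 4 * (M m * A * s m) + 2 * (M m * s m) by ring.
    by rewrite BE; lra.
  have Hm := Hm' (ltW bx).
  have [xb'|b'x] := leP x (b' m).
    apply: le_trans (bound (M m) ((2 * A + 1) * s m) (s m) (1 + M m) A
      (KM m) (fi xb') Hm (norm1B _ _ (KM m)) fmA) _.
    have -> : M m * ((2 * A + 1) * s m) + s m * (1 + M m) * A =
      A * s m + 3 * (M m * A * s m) + M m * s m by ring.
    by rewrite BE; lra.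
  have Km := Km' (ltW b'x).
  apply: le_trans (bound (s m) (1 + A) (s m) 2 A
    Km (norm1B _ _ fmA) Hm _ fmA) _.
    by have := norm1B _ _ Km; lra.
  have -> : s m * (1 + A) + s m * 2 * A = 3 * (A * s m) + s m by ring.
  by rewrite BE; lra.
have all m : [/\ normc (f m) <= A - 2^-1 ^+ m,
    b m <= x -> normc (f m) <= (2 * A + 1) * s m &
    x <= b' m -> normc (1 - f m) <= (2 * A + 1) * s m].
  elim: m => [|m [fmA fo fi]].
    by have [? ?] := base; split=> //; rewrite expr0 /f /=; lra.
  have {}fmA' : normc (f m) <= A.
    by apply: (le_trans fmA); rewrite gerBl exprn_ge0 // invr_ge0.
  split; [|exact: outer|exact: inner].
  have := diff m fmA' fo fi; have := ler_normcD (f m.+1 - f m) (f m).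
  by rewrite subrK !exprS; move: (2^-1 ^+ m) fmA => y; lra.
have [fnA fo fi] := all n.
have {}fnA : normc (f n) <= A.
  by apply: (le_trans fnA); rewrite gerBl exprn_ge0 // invr_ge0.
by split=> //; exact: diff.
Qed.

End StepRecursion.

Section Completeness.
Variable R : realType.

Lemma real_nested_limit (a e : nat -> R) :
  (forall m n, `|a m - a n| <= e m + e n) ->
  exists l, forall n, `|l - a n| <= e n.
Proof.
move=> ae; pose X := [set a n - e n | n in [set: nat]].
have ub n : ubound X (a n + e n).
  by move=> _ [m _ <-]; have := ae m n; rewrite ler_norml => /andP[]; lra.
have supX : has_sup X.
  by split; [exists (a 0%N - e 0%N); exists 0%N|exists (a 0%N + e 0%N)].
exists (sup X) => n; rewrite ler_norml.
have -> /= : sup X - a n <= e n.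
  by rewrite lerBlDl ge_sup //; exists (a 0%N - e 0%N); exists 0%N.
by rewrite andbT lerBrDl sup_upper_bound //; exists n.
Qed.

Lemma complex_nested_limit (u : nat -> R[i]) (e : nat -> R) :
  (forall m n, normc (u m - u n) <= e m + e n) ->
  exists l, forall n, normc (l - u n) <= 2 * e n.
Proof.
move=> ue.
have [|x xP] := @real_nested_limit (fun n => complex.Re (u n)) e.
  move=> m n; apply: le_trans (ue m n).
  by have := ler_Re (u m - u n); case: (u m) => ? ?; case: (u n).
have [|y yP] := @real_nested_limit (fun n => complex.Im (u n)) e.
  move=> m n; apply: le_trans (ue m n).
  by have := ler_Im (u m - u n); case: (u m) => ? ?; case: (u n).
exists (x +i* y)%C => n; apply: (le_trans (ler_normc_ReIm _)).
by rewrite mulr_natl mulr2n lerD //; move: (xP n) (yP n); case: (u n).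
Qed.

Lemma geometric_limit (u : nat -> R[i]) :
  (forall n, normc (u n.+1 - u n) <= 2^-1 ^+ n.+1) ->
  exists l, forall n, normc (l - u n) <= 2 * 2^-1 ^+ n.
Proof.
move=> uS; apply: complex_nested_limit => m n.
have le_diff p k : normc (u (p + k)%N - u p) <= 2^-1 ^+ p - 2^-1 ^+ (p + k).
  elim: k => [|k IH]; first by rewrite addn0 !subrr normc0.
  apply: (le_trans (ler_normc_dist (u (p + k)%N) _ _)).
  rewrite addnS; move: (uS (p + k)%N) IH; rewrite [2^-1 ^+ (p + k).+1]exprS.
  by move: (_ ^+ (p + k)) => y; lra.
have pos p : 0 <= 2^-1 ^+ p :> R by rewrite exprn_ge0 // invr_ge0.
case/orP: (leq_total m n) => [/subnKC <-|/subnKC <-].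
  rewrite normcB; apply: (le_trans (le_diff _ _)).
  by have := pos (m + (n - m))%N; lra.
by apply: (le_trans (le_diff _ _)); have := pos (n + (m - n))%N; lra.
Qed.

End Completeness.

Section Cutoff.
Variable R : realType.
Implicit Types (z w a : R[i]) (e n : nat).

Lemma exprV2_gt0 n : 0 < 2^-1 ^+ n :> R.
Proof. by rewrite exprn_gt0 // invr_gt0. Qed.

Definition half_disc a (d : R) (d0 : 0 < d) n (p : R[i]) : open_disc R :=
  (a + d%:C * p, PosNum (mulr_gt0 d0 (exprV2_gt0 n))).

Definition pole_discs a d (d0 : 0 < d) n (r : R) k : seq (open_disc R) :=
  [seq half_disc a d0 n p | p <- step_block_poles r k].

Lemma sum_pole_discs a d (d0 : 0 < d) n r k :
  \sum_(D <- pole_discs a d0 n r k) Defs.radius D = d * 2^-1 ^+ n * (2 ^ k)%:R.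
Proof.
rewrite big_map (eq_bigr (fun=> d * 2^-1 ^+ n)) // big_const_seq iter_addr_0.
by rewrite count_predT size_map size_circle_poles mulr_natr.
Qed.

Lemma pole_discs_center a d (d0 : 0 < d) n r k D : 0 < r ->
  D \in pole_discs a d0 n r k -> normc ((Defs.center D : R[i]) - a) = d * r.
Proof.
move=> r0 /mapP[_ /mapP[p pc ->] ->]; rewrite /Defs.center /half_disc /=.
rewrite addrAC subrr add0r !normcM !normc_real !gtr0_norm //.
by rewrite (circle_poles_norm (normc1 _) pc) mulr1.
Qed.

Lemma off_pole_discs a d (d0 : 0 < d) n r k z p : 
  off_discs [set D | D \in pole_discs a d0 n r k] z ->
  p \in step_block_poles r k -> 2^-1 ^+ n <= normc ((z - a) / d%:C - p).
Proof.
move=> offz pin; have /offz : half_disc a d0 n p \in pole_discs a d0 n r k.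
  exact: map_f.
rewrite /Defs.radius /Defs.center /=.
have dC : (d%:C != 0 :> R[i])%C by rewrite -normc_gt0 normc_real normr_gt0 gt_eqF.
have -> : z - (a + d%:C * p) = d%:C * ((z - a) / d%:C - p) by field.
by rewrite normcM normc_real gtr0_norm // ler_pM2l.
Qed.

Lemma step_block_rational a d (d0 : 0 < d) n r k (S : set (open_disc R)) :
  0 < r -> [set D | D \in pole_discs a d0 n r k] `<=` S ->
  rational_off S (fun z => step_block r k ((z - a) / d%:C)).
Proof.
move=> r0 subS; pose q : {poly R[i]} :=
  1 - ((d%:C * r%:C)^-1 *: ('X - a%:P)) ^+ (2 ^ k).
have qE z : q.[z] = 1 - ((z - a) / d%:C / r%:C) ^+ (2 ^ k).
  rewrite /q !hornerE; congr (1 - _ ^+ _); rewrite invfM; ring.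
rewrite /step_block; under eq_fun do rewrite -qE.
apply: rational_offV => z /(off_discs_sub subS) offz; rewrite qE.
have [|//] := @step_block_bound _ r k ((z - a) / d%:C) (2^-1 ^+ n) r0 (exprV2_gt0 n).
by move=> p; exact: off_pole_discs.
Qed.

Lemma exprV2_cancel (a b : nat) : 2 ^+ a * 2^-1 ^+ (a + b) = 2^-1 ^+ b :> R.
Proof. by rewrite exprD mulrA -exprMn divff // expr1n mul1r. Qed.

Lemma exprV2_gap (a k m : nat) : k = (a + 2 + m)%N ->
  4 / (2^-1 ^+ a * (2 ^ k)%:R) = 2^-1 ^+ m :> R.
Proof.
move=> ->; have p0 : 2 ^+ m != 0 :> R by rewrite expf_neq0.
have q0 : 2 ^+ a != 0 :> R by rewrite expf_neq0.
by rewrite natrX !exprD !exprVn; field; rewrite p0 q0.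
Qed.

Lemma exprV2_le m n : (m <= n)%N -> 2^-1 ^+ n <= 2^-1 ^+ m :> R.
Proof. by move=> mn; rewrite ler_wiXn2l //; lra. Qed.

Lemma exprV2_small (u : R) : 0 < u -> exists n, 2^-1 ^+ n < u.
Proof.
move=> u0; have := archi_boundP (ltW (_ : 0 < u^-1)); rewrite invr_gt0.
move=> /(_ u0); set n := Num.Def.archi_bound _ => un; exists n.
rewrite exprVn invf_plt ?posrE ?exprn_gt0 // (lt_le_trans un) //.
by rewrite -natrX ler_nat ltnW // ltn_expl.
Qed.

Lemma le0_exprV2 (u c : R) : (forall n, u <= c * 2^-1 ^+ n) -> u <= 0.
Proof.
move=> uc; rewrite leNgt; apply/negP => u0.
have c0 : 0 < c by have := uc 0%N; rewrite expr0; lra.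
have [|n] := @exprV2_small (u / c); first by rewrite divr_gt0.
by rewrite ltr_pdivlMr // mulrC ltNge uc.
Qed.

Lemma cutoff_smallness e n :
  (1 + 2 ^+ (2 * e + 33 + 5 * n)) * (7 * 2 ^+ (2 * e + 34) + 3) *
    (2^-1 ^+ (e + 20 + 3 * n)) ^+ 4 <= 2^-1 ^+ n.+1 :> R.
Proof.
have pge1 m : 1 <= 2 ^+ m :> R by rewrite exprn_ege1 //; lra.
have b1 : 1 + 2 ^+ (2 * e + 33 + 5 * n) <= 2 ^+ (2 * e + 34 + 5 * n) :> R.
  rewrite [(2 * e + 34 + _)%N](_ : _ = (2 * e + 33 + 5 * n).+1)%N; last lia.
  by rewrite exprS; have := pge1 (2 * e + 33 + 5 * n)%N; lra.
have b2 : 7 * 2 ^+ (2 * e + 34) + 3 <= 2 ^+ (2 * e + 38) :> R.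
  rewrite [(2 * e + 38)%N](_ : _ = (2 * e + 34) + 4)%N; last lia.
  rewrite (exprD _ (_ + _) 4); have := pge1 (2 * e + 34)%N.
  by move: (2 ^+ (_ + _)) => y; lra.
apply: (@le_trans _ _ (2 ^+ (2 * e + 34 + 5 * n) * 2 ^+ (2 * e + 38) *
    (2^-1 ^+ (e + 20 + 3 * n)) ^+ 4)).
  apply: ler_wpM2r; first by rewrite !exprn_ge0 // invr_ge0.
  exact: ler_pM.
rewrite -exprM -exprD.
rewrite [((e + _ + _) * 4)%N](_ : _ =
  (2 * e + 34 + 5 * n + (2 * e + 38)) + (8 + 7 * n))%N; last lia.
by rewrite exprV2_cancel exprV2_le //; lia.
Qed.

(* The outer radii increase to 1 and the inner ones decrease to 1/2. *)
Definition outer_radius n : R := 1 - 3 / 4 * 2^-1 ^+ (n + 3).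
Definition inner_radius n : R := 1 / 2 + 3 / 4 * 2^-1 ^+ (n + 3).
Definition block_exponent e n : nat := (e + 30 + 4 * n)%N.
Definition disc_exponent e n : nat := (2 * e + 33 + 5 * n)%N.

Definition cutoff_discs a d (d0 : 0 < d) e : set (open_disc R) :=
  [set D | D \in pole_discs a d0 (disc_exponent e 0) (3 / 4) (block_exponent e 0)]
  `|` \bigcup_n [set D | D \in
    pole_discs a d0 (disc_exponent e n) (outer_radius n) (block_exponent e n) ++
    pole_discs a d0 (disc_exponent e n) (inner_radius n) (block_exponent e n)].

Lemma cutoff_radii_bounds n :
  [/\ 7 / 8 <= outer_radius n <= 1, 1 / 2 <= inner_radius n <= 5 / 8 &
      0 < (2^-1 ^+ (n + 3) : R) <= 1 / 8].
Proof.
rewrite /outer_radius /inner_radius.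
have := exprV2_gt0 (n + 3); have := @exprV2_le 3 (n + 3) (leq_addl _ _).
rewrite [2^-1 ^+ 3](_ : _ = 1 / 8); last by field.
by move: (2^-1 ^+ (n + 3)) => y; split; apply/andP; split; lra.
Qed.

Lemma sum_cutoff_discs a d (d0 : 0 < d) e :
  sum_bounded (@Defs.radius R) (cutoff_discs a d0 e) (d * 2^-1 ^+ e).
Proof.
have r0 (D : open_disc R) : 0 <= Defs.radius D by exact/ltW/radius_gt0.
have de : 0 < d * 2^-1 ^+ e by rewrite mulr_gt0 // exprV2_gt0.
have stage m : d * 2^-1 ^+ disc_exponent e m * (2 ^ block_exponent e m)%:R =
    d * 2^-1 ^+ e * 2^-1 ^+ (m + 3).
  rewrite /disc_exponent [(2 * e + _ + _)%N](_ : _ =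
    block_exponent e m + (e + (m + 3)))%N; last by rewrite /block_exponent; lia.
  by rewrite -!mulrA natrX [_ * 2 ^+ _]mulrC exprV2_cancel exprD.
apply: (@sum_bounded_le _ _ _ (d * 2^-1 ^+ e / 8 + d * 2^-1 ^+ e / 2)).
  by move: (d * _) de => y; lra.
apply: sum_boundedU.
  apply: sum_bounded_list => //; rewrite sum_pole_discs stage add0n.
  by rewrite [2^-1 ^+ 3](_ : _ = 1 / 8); [lra|field].
apply: (@sum_bounded_bigcup _ _ _ (fun n => d * 2^-1 ^+ e * 2^-1 ^+ (n + 2))).
  move=> n; apply: sum_bounded_list => //; rewrite big_cat !sum_pole_discs stage.
  rewrite (addnS n 2) exprS; rewrite le_eqVlt; apply/orP; left; apply/eqP.
  by set x := d * _; set y := 2^-1 ^+ _; change (x * (2^-1 * y) +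
    x * (2^-1 * y) = x * y); field.
move=> n; rewrite -mulr_sumr ler_pM2l //.
suff -> : \sum_(i < n) 2^-1 ^+ (i + 2) = 2^-1 - 2^-1 ^+ n.+1 :> R.
  by have := exprV2_gt0 n.+1; lra.
elim: n => [|n IH]; first by rewrite big_ord0 expr1 subrr.
rewrite big_ord_recr /= IH addn2 !exprS; move: (2^-1 ^+ n) => y; lra.
Qed.

Lemma cutoff_discs_center a d (d0 : 0 < d) e D : cutoff_discs a d0 e D ->
  normc ((Defs.center D : R[i]) - a) <= d.
Proof.
have le_d n r k : 0 < r <= 1 -> D \in pole_discs a d0 n r k ->
    normc ((Defs.center D : R[i]) - a) <= d.
  by case/andP=> r0 r1 /(pole_discs_center r0) ->; rewrite ler_piMr // ltW.
case=> [|[n _]] /=; first by apply: le_d; lra.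
have [/andP[? ?] /andP[? ?] _] := cutoff_radii_bounds n.
by rewrite mem_cat => /orP[]; apply: le_d; lra.
Qed.

Lemma cutoff a d (d0 : 0 < d) e : exists chi : R[i] -> R[i],
  [/\ forall eps : R, 0 < eps -> exists2 f, rational_off (cutoff_discs a d0 e) f &
        forall z, off_discs (cutoff_discs a d0 e) z -> normc (chi z - f z) <= eps,
      forall z, off_discs (cutoff_discs a d0 e) z ->
        normc (z - a) <= d / 2 -> chi z = 1,
      forall z, off_discs (cutoff_discs a d0 e) z ->
        d <= normc (z - a) -> chi z = 0 &
      forall z, off_discs (cutoff_discs a d0 e) z ->
        normc (chi z) <= 2 ^+ (2 * e + 34) + 2].
Proof.
set S := cutoff_discs a d0 e.
pose w z := (z - a) / d%:C.
pose H n z := step_block (outer_radius n) (block_exponent e n) (w z).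
pose K n z := step_block (inner_radius n) (block_exponent e n) (w z).
pose g z := step_block (3 / 4) (block_exponent e 0) (w z).
pose F n z := step_seq (H^~ z) (K^~ z) (g z) n.
pose s n : R := (2^-1 ^+ (e + 20 + 3 * n)) ^+ 4.
pose b n : R := 1 - 2^-1 ^+ (n + 3).
pose b' n : R := 1 / 2 + 2^-1 ^+ (n + 3).
pose A : R := 2 ^+ (2 * e + 34).
have subg : [set D | D \in
    pole_discs a d0 (disc_exponent e 0) (3 / 4) (block_exponent e 0)] `<=` S.
  by move=> D DS; left.
have subH n : [set D | D \in pole_discs a d0 (disc_exponent e n)
    (outer_radius n) (block_exponent e n)] `<=` S.
  by move=> D DS; right; exists n => //=; rewrite mem_cat DS.
have subK n : [set D | D \in pole_discs a d0 (disc_exponent e n)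
    (inner_radius n) (block_exponent e n)] `<=` S.
  by move=> D DS; right; exists n => //=; rewrite mem_cat DS orbT.
have or0 n : 0 < outer_radius n by have [/andP[? ?] _ _] := cutoff_radii_bounds n; lra.
have ir0 n : 0 < inner_radius n by have [_ /andP[? ?] _] := cutoff_radii_bounds n; lra.
have Frat n : rational_off S (F n).
  elim: n => [|n IH]; first by apply: (step_block_rational _ subg); lra.
  have rH := step_block_rational (or0 n) (subH n).
  have rK := step_block_rational (ir0 n) (subK n).
  apply: rational_offD (rK); apply: rational_offM; first exact: rational_offM rH IH.
  exact: rational_offB (rational_off_cst _ _) rK.
have block_le z r n : off_discs [set D | D \in pole_discs a d0
    (disc_exponent e n) r (block_exponent e n)] z -> 0 < r -> r <= 1 ->
    normc (step_block r (block_exponent e n) (w z)) <= 2 ^+ disc_exponent e n.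
  move=> offz r0 r1.
  have [|_] := @step_block_bound _ r (block_exponent e n) (w z) _ r0
    (exprV2_gt0 (disc_exponent e n)).
    by move=> p; exact: off_pole_discs.
  by move/le_trans; apply; rewrite exprVn invrK ler_piMl // exprn_ge0.
have k1 n : (1 < block_exponent e n)%N by rewrite /block_exponent; lia.
have gap n : (4 / (2^-1 ^+ (n + 5) * (2 ^ block_exponent e n)%:R)) ^+ 4 = s n.+1.
  by rewrite (@exprV2_gap _ _ (e + 20 + 3 * n.+1)) // /block_exponent; lia.
have gap0 : (4 / (2^-1 ^+ 8 * (2 ^ block_exponent e 0)%:R)) ^+ 4 = s 0%N.
  by rewrite (@exprV2_gap _ _ (e + 20 + 3 * 0)) // /block_exponent; lia.
have e5 n : 2^-1 ^+ (n + 5) = 2^-1 ^+ (n + 3) / 4 :> R.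
  by rewrite [(n + 5)%N](_ : _ = (n + 3) + 2)%N ?exprD; [field|lia].
have eS n : 2^-1 ^+ (n.+1 + 3) = 2^-1 ^+ (n + 3) / 2 :> R.
  by rewrite addSn exprS mulrC.
have e8 : 2^-1 ^+ 8 <= 1 / 256 :> R by rewrite le_eqVlt; apply/orP; left; apply/eqP; field.
have s0 n : 0 <= s n by rewrite exprn_ge0 // ltW ?exprV2_gt0.
have bounds z : off_discs S z -> forall n,
    [/\ normc (F n z) <= A, normc (F n.+1 z - F n z) <= 2^-1 ^+ n.+1,
        b n <= normc (w z) -> normc (F n z) <= (2 * A + 1) * s n &
        normc (w z) <= b' n -> normc (1 - F n z) <= (2 * A + 1) * s n].
  move=> offz.
  apply: (@step_seq_bounds _ _ _ _ (normc (w z)) _ b b'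
      (fun n => 2 ^+ disc_exponent e n) s).
  - move=> m n; have [_ _ /andP[? ?]] := cutoff_radii_bounds m.
    have [_ _ /andP[? ?]] := cutoff_radii_bounds n.
    by rewrite /b /b'; lra.
  - move=> n; rewrite s0 /s -exprM exprn_ile1 //; lra.
  - by move=> n; rewrite /s -!exprM exprV2_le //; lia.
  - move=> n; apply: block_le => //; first exact: off_discs_sub offz.
    by have [/andP[? ?] _ _] := cutoff_radii_bounds n.
  - move=> n; apply: block_le => //; first exact: off_discs_sub offz.
    by have [_ /andP[? ?] _] := cutoff_radii_bounds n; lra.
  - move=> n zb; rewrite -gap step_block_inside ?exprV2_gt0 //.
    have [_ _ /andP[]] := cutoff_radii_bounds n.
    rewrite e5; move: zb; rewrite /b /outer_radius.
    by have := normc_ge0 (w z); move: (2^-1 ^+ (n + 3)) => y; nra.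
  - move=> n zb; rewrite -gap step_block_outside ?exprV2_gt0 //.
    apply: le_trans zb.
    have [_ _ /andP[]] := cutoff_radii_bounds n.
    by rewrite e5 /b eS /outer_radius; move: (2^-1 ^+ (n + 3)) => y; nra.
  - move=> n zb; rewrite -gap step_block_inside ?exprV2_gt0 //.
    have [_ _ /andP[]] := cutoff_radii_bounds n.
    rewrite e5; move: zb; rewrite /b' eS /inner_radius.
    by have := normc_ge0 (w z); move: (2^-1 ^+ (n + 3)) => y; nra.
  - move=> n zb; rewrite -gap step_block_outside ?exprV2_gt0 //.
    apply: le_trans zb.
    have [_ _ /andP[]] := cutoff_radii_bounds n.
    by rewrite e5 /b' /inner_radius; move: (2^-1 ^+ (n + 3)) => y; nra.
  - move=> zb; rewrite -gap0 step_block_inside ?exprV2_gt0 //.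
    move: zb; rewrite /b' add0n; move: e8; have := normc_ge0 (w z).
    by rewrite [2^-1 ^+ 3](_ : _ = 1 / 8); [nra|field].
  - move=> zb; rewrite -gap0 step_block_outside ?exprV2_gt0 //.
    apply: le_trans zb; rewrite /b add0n; move: e8.
    by rewrite [2^-1 ^+ 3](_ : _ = 1 / 8); [lra|field].
  - have : normc (g z) <= 2 ^+ disc_exponent e 0.
      by apply: block_le (off_discs_sub subg offz) _ _; lra.
    have -> : A = 2 * 2 ^+ disc_exponent e 0.
      by rewrite -exprS /A /disc_exponent; congr (_ ^+ _); lia.
    have : 1 <= 2 ^+ disc_exponent e 0 :> R by rewrite exprn_ege1 //; lra.
    by move: (2 ^+ disc_exponent e 0) => y; lra.
  - by move=> n; exact: cutoff_smallness.
have [chi chiP] : exists chi : R[i] -> R[i], forall z, off_discs S z ->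
    forall n, normc (chi z - F n z) <= 2 * 2^-1 ^+ n.
  suff /choice[chi chiP] : forall z, exists l, off_discs S z ->
      forall n, normc (l - F n z) <= 2 * 2^-1 ^+ n by exists chi.
  move=> z; have [offz|] := pselect (off_discs S z); last by exists 0.
  have [l lP] := @geometric_limit _ (F^~ z) (fun n =>
    let: And4 _ h _ _ := bounds z offz n in h).
  by exists l.
have A1 : 1 <= A by rewrite exprn_ege1 //; lra.
have sle n : s n <= 2^-1 ^+ n by rewrite /s -exprM exprV2_le //; lia.
have dC : (d%:C != 0 :> R[i])%C by rewrite -normc_gt0 normc_real normr_gt0 gt_eqF.
have wE z : normc (w z) = normc (z - a) / d.
  by rewrite /w normc_div normc_real gtr0_norm.
have limE (z c : R[i]) : off_discs S z ->
    (forall n, normc (c - F n z) <= (2 * A + 1) * s n) -> chi z = c.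
  move=> offz cF; apply/eqP; rewrite -subr_eq0 -normc_eq0 eq_le normc_ge0 andbT.
  apply: (@le0_exprV2 _ (2 * A + 3)) => n.
  apply: (le_trans (ler_normc_dist (F n z) _ _)).
  rewrite [normc (F n z - c)]normcB.
  have := chiP z offz n; have := cF n; have := sle n.
  move: (2^-1 ^+ n) (s n) A1 => x y; nra.
have b0 n : 0 < (2^-1 : R) ^+ (n + 3) by exact: exprV2_gt0.
exists chi; split=> [eps eps0|z offz za|z offz za|z offz].
- have [|n nP] := @exprV2_small (eps / 2); first by rewrite divr_gt0.
  exists (F n) => // z offz; apply: (le_trans (chiP z offz n)); lra.
- apply: (limE) => // n; have [_ _ _] := bounds z offz n; apply.
  have := b0 n; rewrite /b' wE ler_pdivrMr //; move: (2^-1 ^+ _) => y; nra.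
- apply: (limE) => // n; rewrite sub0r normc_opp.
  have [_ _ + _] := bounds z offz n; apply.
  have := b0 n; rewrite /b wE ler_pdivlMr //; move: (2^-1 ^+ _) => y; nra.
- have [F0 _ _ _] := bounds z offz 0%N.
  have := chiP z offz 0%N; rewrite expr0.
  have := ler_normcD (chi z - F 0%N z) (F 0%N z); rewrite subrK -/A.
  lra.
Qed.

End Cutoff.

(** * One stage of the construction: cutoffs with small fourth-order size *)

Section CutoffStage.
Variable R : realType.
Implicit Types (x z a : R[i]) (S : set (open_disc R)).

Lemma sum_bounded_bigcup_seq (I : choiceType) (s : seq I) w
    (S : I -> set (open_disc R)) (b : R) :
  0 <= b -> (forall i, i \in s -> sum_bounded w (S i) b) ->
  sum_bounded w (\bigcup_(i in [set` s]) S i) ((size s)%:R * b).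
Proof.
move=> b0; elim: s => [|i s IH] Sb.
  rewrite mul0r => -[|D t] _ tS; first by rewrite big_nil.
  by have [|i] := tS D; rewrite ?mem_head.
apply: (@sum_bounded_sub _ _ _ (S i `|` \bigcup_(i in [set` s]) S i)).
  move=> D [j /=]; rewrite inE => /orP[/eqP ->|js] SD; [by left|right].
  by exists j.
rewrite /= -natr1 mulrDl mul1r addrC; apply: sum_boundedU.
  by apply: Sb; rewrite mem_head.
by apply: IH => j js; apply: Sb; rewrite inE js orbT.
Qed.

Definition lattice_point (h : R) (m j k : nat) : R[i] :=
  (h * (j%:R - m%:R) +i* (h * (k%:R - m%:R)))%C.

Lemma nat_floor (t : R) (n : nat) : 0 <= t <= n%:R ->
  exists2 j : nat, (j <= n)%N & j%:R <= t < j%:R + 1.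
Proof.
move=> /andP[t0 tn]; have /andP[jt tj] := Num.Theory.truncn_itv t0.
exists (Num.truncn t); last by rewrite jt -natr1 in tj *.
by rewrite -(ler_nat R) (le_trans jt).
Qed.

Lemma lattice_floor (h : R) m x : 0 < h -> h * m%:R = 1 -> normc x <= 1 ->
  exists j k : nat, [/\ (j <= 2 * m)%N, (k <= 2 * m)%N,
    0 <= complex.Re (x - lattice_point h m j k) < h &
    0 <= complex.Im (x - lattice_point h m j k) < h].
Proof.
move=> h0 hm x1.
have floor (t : R) : `|t| <= normc x -> exists2 j : nat, (j <= 2 * m)%N &
    0 <= t - h * (j%:R - m%:R) < h.
  move=> /le_trans/(_ x1); rewrite ler_norml => /andP[t1 t2].
  have mE : m%:R = h^-1 :> R by rewrite -[LHS](mulKf (lt0r_neq0 h0)) hm mulr1.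
  have [|j j2m /andP[jt tj]] := @nat_floor (t / h + m%:R) (2 * m).
    rewrite natrM mE -[X in _ + X]mul1r -mulrDl divr_ge0 ?(ltW h0) //=; last lra.
    by rewrite ler_pM2r ?invr_gt0 //; lra.
  exists j => //; rewrite mulrBr hm.
  move: jt tj; rewrite mE => jt tj.
  have : h * j%:R <= h * (t / h + h^-1) by rewrite ler_pM2l.
  have : h * (t / h + h^-1) < h * (j%:R + 1) by rewrite ltr_pM2l.
  rewrite (_ : h * (t / h + h^-1) = t + 1); last by field; rewrite gt_eqF.
  by rewrite mulrDr mulr1 => ? ?; apply/andP; split; lra.
have [j ? jP] := floor _ (ler_Re x); have [k ? kP] := floor _ (ler_Im x).
by exists j, k; split=> //; move: jP kP; case: x {x1 floor}.
Qed.

Definition limit_rational_off S (f : R[i] -> R[i]) :=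
  forall eps : R, 0 < eps -> exists2 g, rational_off S g &
    forall z, off_discs S z -> normc (f z - g z) <= eps.

Lemma limit_rational_off_sub S S' f : S `<=` S' ->
  limit_rational_off S f -> limit_rational_off S' f.
Proof.
move=> SS' fS eps /fS[g gS fg]; exists g; first exact: rational_off_sub gS.
by move=> z /(off_discs_sub SS') /fg.
Qed.

Lemma exprD2_le m n : (0 < n)%N -> m = n.+1 -> 2 ^+ n + 2 <= 2 ^+ m :> R.
Proof.
case: n => // n _ ->; have : 1 <= 2 ^+ n :> R by rewrite exprn_ege1 //; lra.
by rewrite !exprS; move: (2 ^+ n) => y; lra.
Qed.

Lemma cutoff_stage (c eta eps : R) : 0 < c -> 0 < eta -> 0 < eps ->
  exists S, [/\ sum_bounded (@Defs.radius R) S c,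
    forall D, S D -> 2 * eta <= normc (Defs.center D : R[i]) &
    forall x, normc x <= 1 -> 4 * eta <= normc x -> exists chi,
      [/\ limit_rational_off S chi,
          exists2 d : R, 0 < d & forall z, off_discs S z ->
            normc (z - x) <= d -> chi z = 1,
          forall z, off_discs S z -> eps <= normc (z - x) -> chi z = 0 &
          forall z, off_discs S z -> normc (chi z) * normc (z - x) ^+ 4 <= eps]].
Proof.
move=> c0 eta0 eps0.
have [|g] := @exprV2_small R (Num.min c (Num.min eta eps)).
  by rewrite !lt_min c0 eta0.
rewrite !lt_min => /andP[gc /andP[geta geps]].
pose d : R := 2^-1 ^+ (2 * g + 27); have d0 : 0 < d by exact: exprV2_gt0.
pose e := (3 * g + 34)%N; pose m := (2 ^ (2 * g + 29))%N.
have m0 : (1 < m)%N by rewrite /m addnS expnS; have := expn_gt0 2 (2 * g + 28); lia.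
have hm : d / 4 * m%:R = 1.
  have : 2 ^+ (2 * g + 27) != 0 :> R by rewrite expf_neq0.
  rewrite /m natrX (_ : 2 * g + 29 = (2 * g + 27) + 2)%N; last lia.
  rewrite (exprD _ (2 * g + 27)%N 2) /d exprVn; move: (_ ^+ (_ + _)) => y y0.
  by field.
pose a (jk : nat * nat) := lattice_point (d / 4) m jk.1 jk.2.
pose I := [seq jk <- [seq (j, k) | j <- iota 0 (2 * m).+1, k <- iota 0 (2 * m).+1]
  | 2 * eta + d <= normc (a jk)].
pose T jk := cutoff_discs (a jk) d0 e.
have dg : d <= 2^-1 ^+ g / 2.
  by rewrite mulrC -exprS exprV2_le //; lia.
exists (\bigcup_(jk in [set` I]) T jk); split.
- apply: (@sum_bounded_le _ _ _ ((size I)%:R * (d * 2^-1 ^+ e))); last first.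
    apply: sum_bounded_bigcup_seq => [|jk _]; last exact: sum_cutoff_discs.
    by rewrite mulr_ge0 ?ltW // exprV2_gt0.
  apply: le_trans (ltW gc).
  apply: (@le_trans _ _ (2 ^+ (4 * g + 61) * (d * 2^-1 ^+ e))).
    apply: ler_wpM2r; first by rewrite mulr_ge0 ?ltW ?exprV2_gt0.
    rewrite -natrX ler_nat.
    rewrite size_filter (leq_trans (count_size _ _)) // size_allpairs !size_iota.
    have -> : (2 ^ (4 * g + 61) = m * m * 2 ^ 3)%N.
      by rewrite /m -!expnD; congr (2 ^ _)%N; lia.
    by move: m0; clear; nia.
  rewrite -exprD [(_ + e)%N](_ : _ = (4 * g + 61) + g)%N; last by rewrite /e; lia.
  by rewrite exprV2_cancel.
- move=> D [jk /=]; rewrite mem_filter => /andP[ajk _] /cutoff_discs_center Da.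
  have := lerB_normc (a jk) (Defs.center D : R[i]).
  have := ler_normc_dist (Defs.center D : R[i]) (a jk) 0.
  by move: Da; rewrite normcB !subr0; lra.
move=> x x1 x4.
have [|j [k [j2m k2m /andP[re0 re1] /andP[im0 im1]]]] := @lattice_floor _ m x _ hm x1.
  by rewrite divr_gt0.
have xa : normc (x - a (j, k)) < d / 2.
  apply: (le_lt_trans (ler_normc_ReIm _)).
  by rewrite !ger0_norm // /a /=; lra.
have jkI : (j, k) \in I.
  rewrite mem_filter allpairs_f ?mem_iota ?add0n // andbT.
  by have := ler_normc_dist (a (j, k)) x 0; rewrite !subr0; lra.
have [chi [chil chi1 chi0 chiA]] := @cutoff _ (a (j, k)) d d0 e.
have TS : T (j, k) `<=` \bigcup_(jk in [set` I]) T jk.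
  by move=> D TD; exists (j, k).
exists chi; split.
- exact: limit_rational_off_sub chil.
- exists (d / 2 - normc (x - a (j, k))); first by rewrite subr_gt0.
  move=> z /(off_discs_sub TS) offz zx; apply: chi1 => //.
  by have := ler_normc_dist x z (a (j, k)); lra.
- move=> z /(off_discs_sub TS) offz zx; apply: chi0 => //.
  by have := ler_normc_dist (a (j, k)) z x; rewrite (normcB (a (j, k)) x); lra.
- move=> z /(off_discs_sub TS) offz.
  have [za|za] := leP d (normc (z - a (j, k))).
    by rewrite chi0 // normc0 mul0r ltW.
  apply: le_trans (ltW geps).
  apply: (@le_trans _ _ ((2 ^+ (2 * e + 34) + 2) * (2 * d) ^+ 4)).
    rewrite ler_pM ?normc_ge0 ?exprn_ge0 ?normc_ge0 ?chiA //.
    rewrite lerXn2r ?nnegrE ?normc_ge0 ?mulr_ge0 ?ltW //.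
    by have := ler_normc_dist (a (j, k)) z x; rewrite (normcB (a (j, k)) x); lra.
  apply: (@le_trans _ _ (2 ^+ (2 * e + 35) * (2 * d) ^+ 4)).
    apply: ler_wpM2r; first by rewrite exprn_ge0 // mulr_ge0 // ltW.
    by apply: exprD2_le; [rewrite addnS|rewrite -addnS].
  rewrite exprMn mulrA -exprD /d -exprM.
  have -> : ((2 * g + 27) * 4 = (2 * e + 35 + 4) + (2 * g + 1))%N.
    by rewrite /e; clear; lia.
  by rewrite exprV2_cancel exprV2_le //; clear; lia.
Qed.

End CutoffStage.

(** * One stage of the construction: bounded functions with large derivative *)

Section LatticeSums.
Variable R : realType.

Lemma sum_ord_mono (f : nat -> R) m n : (forall i, 0 <= f i) -> (m <= n)%N ->
  \sum_(i < m) f i <= \sum_(i < n) f i.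
Proof.
move=> f0 /subnKC <-; elim: (n - m)%N => [|k IH]; first by rewrite addn0.
by rewrite addnS big_ord_recr /= (le_trans IH) // lerDl.
Qed.

Lemma sum_ord_shift (f : nat -> R) s m n : (forall i, 0 <= f i) ->
  (s + m <= n)%N -> \sum_(i < m) f (s + i)%N <= \sum_(i < n) f i.
Proof.
move=> f0 /(sum_ord_mono f0); apply: le_trans.
elim: m => [|m IH]; first by rewrite big_ord0 sumr_ge0.
by rewrite addnS !big_ord_recr lerD2r.
Qed.

Definition natdist (i j : nat) : nat := (i - j) + (j - i).

Lemma sum_natdist (g : nat -> R) t n : (forall i, 0 <= g i) -> (t < n)%N ->
  \sum_(i < n) g (natdist i t) <= 2 * \sum_(i < n) g i.
Proof.
move=> g0 tn; rewrite mulr_natl mulr2n.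
have left_part s : \sum_(i < s) g (natdist i s) = \sum_(i < s) g i.+1.
  elim: s => [|s IH]; first by rewrite !big_ord0.
  rewrite big_ord_recl [RHS]big_ord_recr addrC -IH /=; congr (_ + _).
have right_part k : \sum_(i < t + k) g (natdist i t) =
    \sum_(i < t) g (natdist i t) + \sum_(i < k) g i.
  elim: k => [|k IH]; first by rewrite addn0 big_ord0 addr0.
  rewrite addnS !big_ord_recr /= IH addrA; congr (_ + g _).
  by rewrite /natdist; lia.
rewrite -(subnKC (ltnW tn)) right_part left_part (subnKC (ltnW tn)).
rewrite lerD //; last by rewrite sum_ord_mono // leq_subr.
apply: le_trans (sum_ord_mono g0 tn).
by rewrite big_ord_recl lerDr.
Qed.

(* Passing from n to n + 1 adds 2n + 1 terms equal to 1 / (n + 1). *)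
Lemma sum_inv_max n :
  \sum_(i < n) \sum_(j < n) (maxn i j).+1%:R^-1 <= 2 * n%:R :> R.
Proof.
elim: n => [|n IH]; first by rewrite big_ord0 mulr0.
have row : \sum_(j < n) (maxn n j).+1%:R^-1 = n%:R * n.+1%:R^-1 :> R.
  under eq_bigr => j _ do rewrite (maxn_idPl (ltnW (ltn_ord j))).
  by rewrite sumr_const card_ord mulr_natl.
have -> : \sum_(i < n.+1) \sum_(j < n.+1) (maxn i j).+1%:R^-1 =
    \sum_(i < n) \sum_(j < n) (maxn i j).+1%:R^-1 +
    n%:R * n.+1%:R^-1 + (n%:R * n.+1%:R^-1 + n.+1%:R^-1) :> R.
  rewrite big_ord_recr /= big_ord_recr /= maxnn row; congr (_ + _).
  under eq_bigr => i _ do rewrite big_ord_recr /=.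
  rewrite big_split /=; congr (_ + _); rewrite -row.
  by apply: eq_bigr => i _; rewrite maxnC.
have n1 : n.+1%:R != 0 :> R by rewrite pnatr_eq0.
have : n.+1%:R^-1 + n%:R * n.+1%:R^-1 = 1 :> R.
  by rewrite -[X in X + _]mul1r -mulrDl -natr1 addrC divff // natr1.
have : 0 < n.+1%:R^-1 :> R by rewrite invr_gt0 ltr0n.
rewrite -[X in _ <= 2 * X]natr1; move: IH.
by move: (\sum_(i < n) _) (n.+1%:R^-1) => x y; lra.
Qed.

Lemma harmonic_ge p : p%:R / 2 <= \sum_(i < 2 ^ p) i.+1%:R^-1 :> R.
Proof.
elim: p => [|p IH]; first by rewrite mul0r sumr_ge0.
rewrite expnS mul2n -addnn big_split_ord /= -natr1 mulrDl lerD //.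
have pp : 0 < (2 ^ p)%:R :> R by rewrite ltr0n expn_gt0.
apply: (@le_trans _ _ (\sum_(i < 2 ^ p) (2 * (2 ^ p)%:R)^-1 : R)).
  rewrite le_eqVlt sumr_const card_ord -[X in _ == X]mulr_natr.
  by apply/orP; left; apply/eqP; field; rewrite gt_eqF.
apply: ler_sum => i _; rewrite lef_pV2 ?posrE ?mulr_gt0 ?ltr0n ?expn_gt0 //.
by rewrite -natrM ler_nat; have := ltn_ord i; lia.
Qed.

Lemma lattice_dist (h : R) m (z : R[i]) j1 k1 j k : 0 < h ->
  0 <= complex.Re (z - lattice_point h m j1 k1) < h ->
  0 <= complex.Im (z - lattice_point h m j1 k1) < h ->
  ((maxn (natdist j j1) (natdist k k1))%:R - 1) * h <=
    normc (z - lattice_point h m j k).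
Proof.
move=> h0; set w := _ - lattice_point _ _ _ _ => /andP[re0 re1] /andP[im0 im1].
have zE : z - lattice_point h m j k = w + (h * (j1%:R - j%:R) +i* (h * (k1%:R - k%:R)))%C.
  rewrite /w; case: z {w re0 re1 im0 im1} => a b; rewrite /lattice_point.
  by apply/eqP; rewrite eq_complex /=; apply/andP; split; apply/eqP; ring.
have dist (s : R) (i i1 : nat) : 0 <= s < h ->
    ((natdist i i1)%:R - 1) * h <= `|s + h * (i1%:R - i%:R)|.
  move=> /andP[s0 sh]; rewrite /natdist; case: (leqP i i1) => ii.
    rewrite (_ : (i - i1)%N = 0)%N; last lia.
    by rewrite add0n (natrB _ ii) ler_normr; apply/orP; left; lra.
  rewrite (_ : (i1 - i)%N = 0)%N; last lia.
  by rewrite addn0 (natrB _ (ltnW ii)) ler_normr; apply/orP; right; lra.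
have ImD (u v : R[i]) : complex.Im (u + v) = complex.Im u + complex.Im v.
  by case: u; case: v.
have ReD (u v : R[i]) : complex.Re (u + v) = complex.Re u + complex.Re v.
  by case: u; case: v.
rewrite zE; case: (leqP (natdist j j1) (natdist k k1)) => _.
  apply: le_trans (ler_Im _); rewrite ImD /=; apply: dist.
  by rewrite im0.
apply: le_trans (ler_Re _); rewrite ReD /=; apply: dist.
by rewrite re0.
Qed.

Lemma lattice_sum_bound (h rho : R) m (z : R[i]) (N : nat) (Q : nat -> nat -> bool) :
  0 < h -> h * m%:R = 1 -> normc z <= 1 -> (2 * m < N)%N -> 0 < rho ->
  rho * N%:R <= h / 4 ->
  (forall j k, Q j k -> rho <= normc (z - lattice_point h m j k)) ->
  \sum_(j < N) \sum_(k < N | Q j k) rho / normc (z - lattice_point h m j k) <= 22.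
Proof.
move=> h0 hm z1 mN rho0 rhoN Qrho.
have [j1 [k1 [j1m k1m re im]]] := lattice_floor h0 hm z1.
pose phi (i j : nat) : R := 3 * rho / h * (maxn i j).+1%:R^-1 +
  ((i <= 1)%N && (j <= 1)%N)%:R.
have phi0 i j : 0 <= phi i j.
  by rewrite addr_ge0 // mulr_ge0 ?invr_ge0 // divr_ge0 ?mulr_ge0 // ltW.
have term j k : Q j k -> rho / normc (z - lattice_point h m j k) <=
    phi (natdist j j1) (natdist k k1).
  move=> Qjk; have rz := Qrho _ _ Qjk.
  have z0 := lt_le_trans rho0 rz.
  have := lattice_dist j k h0 re im.
  rewrite /phi -geq_max; set d := maxn _ _ => dz.
  case: leqP => d1.
    apply: (@le_trans _ _ 1); first by rewrite ler_pdivrMr // mul1r.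
    by rewrite lerDr mulr_ge0 ?invr_ge0 // divr_ge0 ?mulr_ge0 // ltW.
  have d2 : 2 <= d%:R :> R by rewrite ler_nat.
  rewrite addr0 -[d.+1%:R]natr1 ler_pdivrMr //.
  move: d%:R (normc _) d2 dz z0 => x y x2 xy y0.
  have x1 : 0 < x + 1 by lra.
  have -> : 3 * rho / h / (x + 1) * y = rho * (3 * y / ((x + 1) * h)).
    by field; rewrite !gt_eqF.
  by rewrite ler_peMr ?ler_pdivlMr ?mulr_gt0 ?(ltW rho0) //; nra.
have le_phi : \sum_(j < N) \sum_(k < N | Q j k)
      rho / normc (z - lattice_point h m j k) <=
    \sum_(j < N) \sum_(k < N) phi (natdist j j1) (natdist k k1).
  apply: ler_sum => j _; rewrite big_mkcond; apply: ler_sum => k _.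
  by case: ifP => [/term|_].
apply: (le_trans le_phi).
have j1N : (j1 < N)%N by apply: leq_ltn_trans mN.
have k1N : (k1 < N)%N by apply: leq_ltn_trans mN.
apply: (@le_trans _ _ (\sum_(j < N) 2 * \sum_(k < N) phi (natdist j j1) k)).
  by apply: ler_sum => j _; apply: sum_natdist.
rewrite -mulr_sumr.
apply: (@le_trans _ _ (2 * (2 * \sum_(j < N) \sum_(k < N) phi j k))).
  rewrite ler_pM2l //.
  by apply: (@sum_natdist (fun i => \sum_(k < N) phi i k)) => // i; rewrite sumr_ge0.
have small : \sum_(j < N) \sum_(k < N) ((j <= 1)%N && (k <= 1)%N)%:R <= 4 :> R.
  have le2 : \sum_(k < N) (k <= 1)%N%:R <= 2 :> R.
    clear; case: N => [|[|N]]; rewrite ?big_ord0 // !big_ord_recl ?big_ord0 /=; try lra.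
    by rewrite big1 // ?addr0; lra.
  apply: (@le_trans _ _ ((\sum_(j < N) (j <= 1)%N%:R) * \sum_(k < N) (k <= 1)%N%:R)).
    rewrite mulr_suml; apply: ler_sum => j _; rewrite mulr_sumr; apply: ler_sum => k _.
    by rewrite -mulnb natrM.
  rewrite (_ : 4 = 2 * 2 :> R); last ring.
  by rewrite ler_pM // sumr_ge0.
have large : \sum_(j < N) \sum_(k < N) 3 * rho / h * (maxn j k).+1%:R^-1 <= 3 / 2 :> R.
  under eq_bigr => j _ do rewrite -mulr_sumr.
  rewrite -mulr_sumr; apply: le_trans (ler_wpM2l _ (sum_inv_max N)) _.
    by rewrite divr_ge0 ?mulr_ge0 ?ltW.
  rewrite mulrAC ler_pdivrMr //; lra.
have -> : \sum_(j < N) \sum_(k < N) phi j k =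
    \sum_(j < N) \sum_(k < N) 3 * rho / h * (maxn j k).+1%:R^-1 +
    \sum_(j < N) \sum_(k < N) ((j <= 1)%N && (k <= 1)%N)%:R.
  by rewrite -big_split; apply: eq_bigr => j _; rewrite -big_split.
lra.
Qed.

End LatticeSums.

Section LatticeStage.
Variable R : realType.
Implicit Types (x z a : R[i]) (S : set (open_disc R)).

Definition lattice_index (L j0 k0 j k : nat) : bool :=
  [&& (j0 < j <= j0 + L)%N, (k0 < k)%N & (k <= k0 + (j - j0))%N].

Lemma lattice_index_dist (h : R) m x L j0 k0 j k : 0 < h ->
  0 <= complex.Re (x - lattice_point h m j0 k0) < h ->
  0 <= complex.Im (x - lattice_point h m j0 k0) < h ->
  lattice_index L j0 k0 j k ->
  normc (x - lattice_point h m j k) <= 2 * (j - j0)%:R * h.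
Proof.
move=> h0 /andP[re0 re1] /andP[im0 im1] /and3P[/andP[j0j _] k0k kj].
apply: (le_trans (ler_normc_ReIm _)).
have j1 : 1 <= (j - j0)%:R :> R by rewrite ler1n subn_gt0.
have k1 : 1 <= (k - k0)%:R :> R by rewrite ler1n subn_gt0.
have kj' : (k - k0)%:R <= (j - j0)%:R :> R by rewrite ler_nat; lia.
have jE : j%:R = j0%:R + (j - j0)%:R :> R by rewrite -natrD subnKC // ltnW.
have kE : k%:R = k0%:R + (k - k0)%:R :> R by rewrite -natrD subnKC // ltnW.
have h1 : h <= (j - j0)%:R * h by rewrite ler_peMl // ltW.
have h2 : h <= (k - k0)%:R * h by rewrite ler_peMl // ltW.
have h3 : (k - k0)%:R * h <= (j - j0)%:R * h by rewrite ler_wpM2r // ltW.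
have -> : 2 * (j - j0)%:R * h = (j - j0)%:R * h + (j - j0)%:R * h by ring.
case: x re0 re1 im0 im1 => s t /= re0 re1 im0 im1.
by apply: lerD; rewrite ler_norml ?jE ?kE; apply/andP; split; lra.
Qed.

Lemma lattice_stage (c eta eps : R) : 0 < c -> 0 < eta -> 0 < eps ->
  exists S, [/\ sum_bounded (@Defs.radius R) S c,
    forall D, S D -> 2 * eta <= normc (Defs.center D : R[i]),
    forall x, normc x <= 1 -> 4 * eta <= normc x ->
      exists2 D, S D & normc ((Defs.center D : R[i]) - x) <= eps &
    forall x, normc x <= 1 -> 4 * eta <= normc x -> off_discs S x ->
      exists2 G, rational_off S G & forall z, normc z <= 1 -> off_discs S z ->
        normc (z - x + (z - x) ^+ 2 * G z) <= eps].
Proof.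
move=> c0 eta0 eps0.
have [|g] := @exprV2_small R (Num.min c (Num.min eta eps)).
  by rewrite !lt_min c0 eta0.
rewrite !lt_min => /andP[gc /andP[geta geps]].
have g0 := exprV2_gt0 R g.
pose p := (2 ^ (2 * g + 13))%N; pose l := (p + g + 1)%N.
pose m := (2 ^ l)%N; pose h : R := 2^-1 ^+ l; pose L := (2 ^ p)%N.
pose rho : R := 2^-1 ^+ (2 * l + 4 + g); pose N := (3 * m).+1.
have h0 : 0 < h by exact: exprV2_gt0.
have rho0 : 0 < rho by exact: exprV2_gt0.
have m0 : (0 < m)%N by rewrite expn_gt0.
have hm : h * m%:R = 1.
  by rewrite /h /m natrX -exprMn mulVf // expr1n.
have Lm : (L <= m)%N by rewrite leq_exp2l // /l; clear; lia.
have N4 : (N <= 4 * m)%N by rewrite /N; move: m0; clear; lia.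
have Lh : 2 * L%:R * h = 2^-1 ^+ g.
  rewrite /L /h natrX -exprS /l (_ : p + g + 1 = p.+1 + g)%N ?exprV2_cancel //.
  by rewrite addn1 addSn.
have rhoN : rho * N%:R <= h / 4.
  apply: (@le_trans _ _ (rho * (4 * m)%:R)); first by rewrite ler_pM2l // ler_nat.
  rewrite natrM mulrCA mulrA.
  have -> : rho = h * (h * 2^-1 ^+ (4 + g)).
    by rewrite /rho /h -!exprD; congr (_ ^+ _); clear; lia.
  have -> : 4 * (h * (h * 2^-1 ^+ (4 + g))) * m%:R =
    4 * h * (h * m%:R) * 2^-1 ^+ (4 + g) by ring.
  rewrite hm mulr1; have : 2^-1 ^+ (4 + g) <= 2^-1 ^+ 4 :> R.
    by rewrite exprV2_le // leq_addr.
  rewrite [2^-1 ^+ 4](_ : _ = 1 / 16); last by field.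
  by move: (2^-1 ^+ _) h0 => y; clear; nra.
pose a j k := lattice_point h m j k.
pose disc (jk : nat * nat) : open_disc R :=
  (a jk.1 jk.2, PosNum (exprV2_gt0 R (2 * l + 4 + g))).
pose I := [seq jk <- [seq (j, k) | j <- iota 0 N, k <- iota 0 N]
  | 2 * eta <= normc (a jk.1 jk.2)].
pose S := [set D | D \in [seq disc jk | jk <- I]].
have inS j k : (j < N)%N -> (k < N)%N -> 2 * eta <= normc (a j k) -> S (disc (j, k)).
  move=> jN kN ajk; apply/map_f; rewrite mem_filter ajk.
  by rewrite allpairs_f ?mem_iota.
have offS z j k : off_discs S z -> (j < N)%N -> (k < N)%N ->
    2 * eta <= normc (a j k) -> rho <= normc (z - a j k).
  by move=> offz jN kN /(inS _ _ jN kN) /offz.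
exists S; split.
- apply: sum_bounded_list => [D|]; first exact/ltW/radius_gt0.
  rewrite big_map (eq_bigr (fun=> rho)) // big_const_seq iter_addr_0 count_predT.
  apply: le_trans (ltW gc); rewrite -[X in X <= _]mulr_natl.
  apply: (@le_trans _ _ ((m * m * 2 ^ 4)%:R * rho)).
    rewrite ler_pM2r // ler_nat size_filter (leq_trans (count_size _ _)) //.
    rewrite size_allpairs !size_iota; move: N4; clear; nia.
  rewrite /m -!expnD natrX /rho [(2 * l + 4)%N](_ : _ = l + l + 4)%N.
    by rewrite exprV2_cancel.
  by clear; lia.
- by move=> D /mapP[jk]; rewrite mem_filter => /andP[ajk _] ->.
- move=> x x1 x4.
  have [j0 [k0 [j0m k0m /andP[re0 re1] /andP[im0 im1]]]] := lattice_floor h0 hm x1.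
  have xa : normc (x - a j0 k0) <= 2 * h.
    by apply: (le_trans (ler_normc_ReIm _)); rewrite !ger0_norm // /a; lra.
  have hg : 2 * h <= 2^-1 ^+ g.
    rewrite -Lh mulrAC ler_peMr //; first by rewrite mulr_ge0 // ltW.
    by rewrite ler1n expn_gt0.
  exists (disc (j0, k0)); last by rewrite normcB; apply: le_trans xa _; lra.
  apply: inS; [move: j0m; rewrite /N; clear; lia|move: k0m; rewrite /N; clear; lia|].
  by have := ler_normc_dist (a j0 k0) x 0; rewrite !subr0; lra.
move=> x x1 x4 offx.
have [j0 [k0 [j0m k0m re im]]] := lattice_floor h0 hm x1.
pose Q := lattice_index L j0 k0.
have Qdist j k : Q j k -> normc (x - a j k) <= 2 * (j - j0)%:R * h.
  exact: lattice_index_dist.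
have Qa j k : Q j k -> [/\ (j < N)%N, (k < N)%N & 2 * eta <= normc (a j k)].
  move=> Qjk; have := Qdist _ _ Qjk; case/and3P: Qjk => /andP[j0j jL] k0k kj xa.
  split; [move: jL j0m Lm; rewrite /N; clear; lia| |].
    by move: jL k0m Lm kj; rewrite /N; clear; lia.
  have : 2 * (j - j0)%:R * h <= 2 * L%:R * h.
    by rewrite ler_wpM2r ?(ltW h0) // ler_pM2l // ler_nat leq_subLR.
  by rewrite Lh; have := ler_normc_dist (a j k) x 0; rewrite !subr0; lra.
have Qrho z j k : off_discs S z -> Q j k -> rho <= normc (z - a j k).
  by move=> offz /Qa[jN kN ajk]; exact: offS.
have Qx0 j k : Q j k -> 0 < normc (x - a j k).
  by move=> Qjk; apply: lt_le_trans (Qrho _ _ _ offx Qjk).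
pose w j k : R := rho / normc (x - a j k) ^+ 2.
have w0 j k : 0 <= w j k by rewrite divr_ge0 ?exprn_ge0 ?normc_ge0 ?ltW.
pose T := \sum_(j < N) \sum_(k < N | Q j k) w j k.
have T64 : 64 <= T * 2^-1 ^+ g.
  have TL : \sum_(u < L) rho / (4 * h ^+ 2) * u.+1%:R^-1 <= T.
    pose f j := \sum_(k < N | Q j k) w j k.
    have f0 j : 0 <= f j by rewrite sumr_ge0.
    have jL : (j0.+1 + L <= N)%N by move: j0m Lm; rewrite /N; clear; lia.
    apply: le_trans (sum_ord_shift f0 jL); apply: ler_sum => u _.
    rewrite /f big_mkcond.
    pose r k := if Q (j0.+1 + u)%N k then w (j0.+1 + u)%N k else 0.
    have r0 k : 0 <= r k by rewrite /r; case: ifP.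
    have kL : (k0.+1 + u.+1 <= N)%N.
      by move: k0m Lm (ltn_ord u); rewrite /N; clear; lia.
    apply: le_trans (sum_ord_shift r0 kL).
    apply: (@le_trans _ _ (\sum_(v < u.+1) rho / (2 * u.+1%:R * h) ^+ 2)).
      rewrite sumr_const card_ord -[X in _ <= X]mulr_natr le_eqVlt.
      apply/orP; left; apply/eqP; have u1 : u.+1%:R != 0 :> R by rewrite pnatr_eq0.
      have hn0 := lt0r_neq0 h0.
      by move: u.+1%:R u1 => y y0; field; rewrite hn0 y0.
    apply: ler_sum => v _; rewrite /r.
    have Qv : Q (j0.+1 + u)%N (k0.+1 + v)%N.
      rewrite /Q /lattice_index; move: (ltn_ord u) (ltn_ord v); clear.
      by move=> uL vu; apply/and3P; split; [apply/andP; split| |]; lia.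
    rewrite Qv /w ler_pM2l // lef_pV2 ?posrE ?exprn_gt0 ?mulr_gt0 ?Qx0 ?ltr0n //.
    rewrite lerXn2r ?nnegrE ?normc_ge0 ?mulr_ge0 ?(ltW h0) //.
    apply: (le_trans (Qdist _ _ Qv)); rewrite (_ : (j0.+1 + u - j0)%N = u.+1) //.
    by clear; lia.
  have : 2^-1 ^+ (g + 6) * (p%:R / 2) <= T.
    apply: le_trans TL; rewrite -mulr_sumr.
    have -> : rho / (4 * h ^+ 2) = 2^-1 ^+ (g + 6).
      have -> : rho = h ^+ 2 * 2^-1 ^+ (4 + g).
        by rewrite /rho /h -exprM -exprD; congr (_ ^+ _); clear; lia.
      rewrite (_ : (g + 6)%N = (4 + g) + 2)%N; last by clear; lia.
      rewrite (exprD _ (4 + g)%N); have := lt0r_neq0 h0.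
      by move: (2^-1 ^+ (4 + g)) => y hn0; field.
    by rewrite ler_pM2l ?exprV2_gt0 // harmonic_ge.
  rewrite /p natrX (_ : (2 * g + 13)%N = (g + 6) + g + 7)%N; last by clear; lia.
  rewrite (exprD 2 (g + 6 + g)%N) (exprD 2 (g + 6)%N g).
  have e6 : 2^-1 ^+ (g + 6) * 2 ^+ (g + 6) = 1 :> R.
    by rewrite -exprMn mulVf // expr1n.
  have eg : 2 ^+ g * 2^-1 ^+ g = 1 :> R by rewrite -exprMn divff // expr1n.
  move: (2^-1 ^+ (g + 6)) (2 ^+ (g + 6)) e6 => u v uv.
  have -> : u * (v * 2 ^+ g * 2 ^+ 7 / 2) = (u * v) * 2 ^+ g * 64 by field.
  rewrite uv mul1r => /(ler_wpM2r (ltW g0)); apply: le_trans.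
  by rewrite mulrAC eg mul1r.
have T0 : 0 < T by rewrite -(pmulr_lgt0 _ g0); apply: lt_le_trans T64.
have TC : T%:C != 0 :> R[i] by rewrite -normc_gt0 normc_real normr_gt0 gt_eqF.
pose G z := - (T^-1)%:C *
  \sum_(j < N) \sum_(k < N | Q j k) (w j k)%:C * (z - a j k)^-1.
exists G.
  apply: rational_offM; first exact: rational_off_cst.
  apply: rational_off_sum => j; under eq_fun do rewrite big_mkcond /=.
  apply: rational_off_sum => k.
  case Qjk: (Q j k); last exact: rational_off_cst.
  apply: rational_offM; first exact: rational_off_cst.
  have aE : (fun z => (z - a j k)^-1) = (fun z => (('X - (a j k)%:P).[z])^-1).
    by apply/funext => z; rewrite !hornerE.
  rewrite aE; apply: rational_offV => z /Qrho /(_ Qjk) az.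
  by rewrite !hornerE -normc_gt0 (lt_le_trans rho0).
move=> z z1 offz.
have z0 j k : Q j k -> 0 < normc (z - a j k).
  by move=> Qjk; apply: lt_le_trans (Qrho _ _ _ offz Qjk).
pose E j k := (w j k)%:C * (z - x - (z - x) ^+ 2 * (z - a j k)^-1).
have -> : z - x + (z - x) ^+ 2 * G z =
    (T^-1)%:C * \sum_(j < N) \sum_(k < N | Q j k) E j k.
  have -> : \sum_(j < N) \sum_(k < N | Q j k) E j k = T%:C * (z - x) -
      (z - x) ^+ 2 * \sum_(j < N) \sum_(k < N | Q j k)
        (w j k)%:C * (z - a j k)^-1.
    rewrite /T rmorph_sum mulr_suml mulr_sumr -sumrB; apply: eq_bigr => j _.
    rewrite rmorph_sum mulr_suml mulr_sumr -sumrB; apply: eq_bigr => k _.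
    by rewrite /E; ring.
  by rewrite /G fmorphV; field.
have En j k : Q j k -> normc (E j k) <=
    rho / normc (x - a j k) + rho / normc (z - a j k).
  move=> Qjk; have xn := Qx0 _ _ Qjk; have zn := z0 _ _ Qjk.
  have za : z - a j k != 0 by rewrite -normc_gt0.
  have -> : E j k = (w j k)%:C * ((z - x) * (x - a j k) / (z - a j k)).
    by rewrite /E; congr (_ * _); field.
  rewrite normcM normc_real ger0_norm // normc_div normcM /w.
  have : normc (z - x) <= normc (z - a j k) + normc (x - a j k).
    by rewrite [normc (x - _)]normcB; exact: ler_normc_dist.
  move: (normc (z - x)) (normc (x - _)) (normc (z - _)) xn zn => s t u t0 u0 stu.
  have -> : rho / t ^+ 2 * (s * t / u) = rho * s / (t * u).
    by field; rewrite !gt_eqF.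
  have -> : rho / t + rho / u = rho * (u + t) / (t * u).
    by field; rewrite !gt_eqF.
  by rewrite ler_pM2r ?invr_gt0 ?mulr_gt0 // ler_pM2l.
rewrite normcM normc_real gtr0_norm ?invr_gt0 // mulrC ler_pdivrMr //.
have mN : (2 * m < N)%N by rewrite /N; clear; lia.
have bx := lattice_sum_bound h0 hm x1 mN rho0 rhoN (fun j k => @Qrho x j k offx).
have bz := lattice_sum_bound h0 hm z1 mN rho0 rhoN (fun j k => @Qrho z j k offz).
apply: (@le_trans _ _ (22 + 22)); last first.
  apply: (@le_trans _ _ (2^-1 ^+ g * T)); first by rewrite mulrC; lra.
  by rewrite ler_pM2r // ltW.
apply: le_trans (lerD bx bz); rewrite -big_split.
apply: (le_trans (ler_normc_sum _ _ _)); apply: ler_sum => j _.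
rewrite -big_split; apply: (le_trans (ler_normc_sum _ _ _)).
by apply: ler_sum => k; exact: En.
Qed.

End LatticeStage.

(** * A discrete Cauchy estimate *)

Section Clamp.
Variable R : realType.
Implicit Types (t u : R) (z w : R[i]) (D : open_disc R) (s : seq (open_disc R)).

Definition clamp t : R := Num.min 1 (Num.max 0 t).

Lemma clamp_le0 t : t <= 0 -> clamp t = 0.
Proof. by rewrite /clamp => t0; rewrite max_l // min_r. Qed.

Lemma clamp_ge1 t : 1 <= t -> clamp t = 1.
Proof. by rewrite /clamp => t1; rewrite max_r ?min_l //; lra. Qed.

Lemma clamp_id t : 0 <= t -> t <= 1 -> clamp t = t.
Proof. by rewrite /clamp => t0 t1; rewrite max_r // min_r. Qed.

Variant clamp_spec t : R -> Prop :=
  | ClampLe0 of t <= 0 : clamp_spec t 0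
  | ClampId of 0 <= t & t <= 1 : clamp_spec t t
  | ClampGe1 of 1 <= t : clamp_spec t 1.

Lemma clampP t : clamp_spec t (clamp t).
Proof.
have [t0|/ltW t0] := leP t 0; first by rewrite clamp_le0 //; constructor.
have [t1|/ltW t1] := leP t 1; first by rewrite clamp_id //; constructor.
by rewrite clamp_ge1 //; constructor.
Qed.

Lemma clamp01 t : 0 <= clamp t <= 1.
Proof. by case: clampP => ? *; apply/andP; split; lra. Qed.

Lemma clamp_mono t u : t <= u -> clamp t <= clamp u.
Proof. by case: (clampP t) => ?; case: (clampP u) => * //; lra. Qed.

Lemma clamp_lip t u : `|clamp t - clamp u| <= `|t - u|.
Proof.
wlog tu : t u / u <= t.
  move=> H; case: (leP u t) => [/H//|/ltW /H].
  by rewrite distrC (distrC u).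
have := clamp_mono tu; rewrite -subr_ge0 => /ger0_norm ->.
move: (tu); rewrite -subr_ge0 => /ger0_norm ->.
by case: (clampP t) => ?; case: (clampP u) => *; lra.
Qed.

Definition coord_max z : R := Num.max `|complex.Re z| `|complex.Im z|.

Lemma coord_max_dist z w : `|coord_max z - coord_max w| <= normc (z - w).
Proof.
have le_dist (u v : R[i]) : coord_max u <= coord_max v + normc (u - v).
  have := ler_Re (u - v); have := ler_Im (u - v); move: (normc (u - v)) => d.
  case: u v => a b [a' b'] /=; rewrite /coord_max /= ge_max => im re.
  have := le_max `|a'| `|a'| `|b'|; have := le_max `|b'| `|a'| `|b'|.
  rewrite !lexx orbT /= => b'm a'm; move: (Num.max _ _) b'm a'm => M b'm a'm.
  have := ler_normD (a - a') a'; have := ler_normD (b - b') b'.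
  by rewrite !subrK => ? ?; apply/andP; split; lra.
rewrite ler_norml; apply/andP; split.
  by have := le_dist w z; rewrite normcB; lra.
by have := le_dist z w; lra.
Qed.

Lemma coord_max_le z : coord_max z <= normc z.
Proof. by rewrite /coord_max ge_max ler_Re ler_Im. Qed.

Definition box z : R := clamp (2 - 4 * coord_max z).

Lemma box_lip z w : `|box z - box w| <= 4 * normc (z - w).
Proof.
apply: (le_trans (clamp_lip _ _)).
rewrite opprD addrACA subrr add0r opprK -mulrN -mulrDr normrM ger0_norm //.
by rewrite ler_pM2l // -(normrN (- _ + _)) opprD opprK coord_max_dist.
Qed.

Definition disc_cut D z : R := clamp (normc (z - (Defs.center D : R[i])) / Defs.radius D - 2).

Lemma disc_cut_lip D z w :
  `|disc_cut D z - disc_cut D w| <= normc (z - w) / Defs.radius D.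
Proof.
have r0 := radius_gt0 D; apply: (le_trans (clamp_lip _ _)).
set a := Defs.center D : R[i]; set r := Defs.radius D.
have -> : normc (z - a) / r - 2 - (normc (w - a) / r - 2) =
  (normc (z - a) - normc (w - a)) / r by ring.
rewrite normrM [`|r^-1|]gtr0_norm ?invr_gt0 // ler_pM2r ?invr_gt0 //.
have := lerB_normc (z - a) (w - a); have := lerB_normc (w - a) (z - a).
rewrite ler_norml; have e (u v : R[i]) : u - a - (v - a) = u - v by ring.
by rewrite !e [normc (w - z)]normcB => ? ?; apply/andP; split; lra.
Qed.

Lemma disc_cut0 D z : normc (z - (Defs.center D : R[i])) <= 2 * Defs.radius D ->
  disc_cut D z = 0.
Proof.
by move=> zD; rewrite /disc_cut clamp_le0 // subr_le0 ler_pdivrMr ?radius_gt0.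
Qed.

Lemma disc_cut1 D z : 3 * Defs.radius D <= normc (z - (Defs.center D : R[i])) ->
  disc_cut D z = 1.
Proof.
move=> zD; rewrite /disc_cut clamp_ge1 // lerBrDr (_ : 1 + 2 = 3); last ring.
by rewrite ler_pdivlMr ?radius_gt0.
Qed.

Definition discs_cut s z : R := \prod_(D <- s) disc_cut D z.

Lemma prod01 (I : Type) (s : seq I) (a : I -> R) :
  (forall i, 0 <= a i <= 1) -> 0 <= \prod_(i <- s) a i <= 1.
Proof.
move=> a01; elim/big_rec: _ => [|i x _ /andP[x0 x1]]; first by rewrite ler01 lexx.
by have /andP[a0 a1] := a01 i; rewrite mulr_ge0 //= mulr_ile1.
Qed.

Lemma prod_diff (I : Type) (s : seq I) (a b : I -> R) :
  (forall i, 0 <= a i <= 1) -> (forall i, 0 <= b i <= 1) ->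
  `|\prod_(i <- s) a i - \prod_(i <- s) b i| <= \sum_(i <- s) `|a i - b i|.
Proof.
move=> a01 b01; elim: s => [|i s IH]; first by rewrite !big_nil subrr normr0.
rewrite !big_cons; set x := \prod_(_ <- _) _; set y := \prod_(_ <- _) _.
have -> : a i * x - b i * y = (a i - b i) * x + b i * (x - y) by ring.
have /andP[x0 x1] : 0 <= x <= 1 by exact: prod01.
have /andP[b0 b1] := b01 i.
apply: (le_trans (ler_normD _ _)); rewrite lerD //.
  by rewrite normrM (ger0_norm x0) ler_piMr.
by rewrite normrM (ger0_norm b0) (le_trans _ IH) // ler_piMl.
Qed.

Lemma discs_cut01 s z : 0 <= discs_cut s z <= 1.
Proof. by apply: prod01 => D; exact: clamp01. Qed.

Lemma box01 z : 0 <= box z <= 1. Proof. exact: clamp01. Qed.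

(* The indicator of the disc of four times the radius of D, with the weight of
   a boundary layer of width comparable to the radius. *)
Definition disc_weight (h : R) (j : nat) D z : R :=
  if normc (z - (Defs.center D : R[i])) <= 4 * Defs.radius D
  then h / Defs.radius D * (2 / normc (Defs.center D : R[i])) ^+ j else 0.

Lemma disc_weight_ge0 h j D z : 0 <= h -> 0 <= disc_weight h j D z.
Proof.
rewrite /disc_weight => h0; case: ifP => // _.
by rewrite mulr_ge0 ?exprn_ge0 ?divr_ge0 ?normc_ge0 ?(ltW (radius_gt0 D)).
Qed.

Definition far_disc D := 8 * Defs.radius D <= normc (Defs.center D : R[i]).

Lemma inv_norm_near_disc D z j : far_disc D ->
  normc (z - (Defs.center D : R[i])) <= 4 * Defs.radius D ->
  (normc z)^-1 ^+ j <= (2 / normc (Defs.center D : R[i])) ^+ j.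
Proof.
rewrite /far_disc => Dfar zD; have r0 := radius_gt0 D.
have a0 : 0 < normc (Defs.center D : R[i]) by lra.
have za : normc (Defs.center D : R[i]) / 2 <= normc z.
  by have := ler_normc_dist z (Defs.center D : R[i]) 0; rewrite !subr0 normcB; lra.
rewrite lerXn2r ?nnegrE ?invr_ge0 ?divr_ge0 ?normc_ge0 //.
rewrite -[2 / _]invf_div lef_pV2 ?posrE ?divr_gt0 //.
by apply: lt_le_trans za; rewrite divr_gt0.
Qed.

Lemma disc_cut_diff (h : R) j D z w : 0 < h -> h <= Defs.radius D -> far_disc D ->
  normc (z - w) <= h ->
  `|disc_cut D z - disc_cut D w| * (normc z)^-1 ^+ j <= disc_weight h j D z.
Proof.
move=> h0 hr Dfar zw; have r0 := radius_gt0 D; rewrite /disc_weight.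
case: (leP (normc (z - _)) (4 * _)) => [zD|zD].
  rewrite ler_pM ?normr_ge0 ?exprn_ge0 ?invr_ge0 ?normc_ge0 //.
    apply: (le_trans (disc_cut_lip _ _ _)).
    by rewrite ler_pM2r ?invr_gt0.
  exact: inv_norm_near_disc.
rewrite !disc_cut1 ?subrr ?normr0 ?mul0r //; last by lra.
by have := ler_normc_dist w z (Defs.center D : R[i]); lra.
Qed.

Lemma discs_cut_diff (h : R) j s z w : 0 < h ->
  (forall D, D \in s -> h <= Defs.radius D /\ far_disc D) ->
  normc (z - w) <= h ->
  `|discs_cut s z - discs_cut s w| * (normc z)^-1 ^+ j <=
    \sum_(D <- s) disc_weight h j D z.
Proof.
move=> h0 sP zw; rewrite /discs_cut.
apply: (@le_trans _ _ ((\sum_(D <- s) `|disc_cut D z - disc_cut D w|) *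
    (normc z)^-1 ^+ j)).
  rewrite ler_wpM2r ?exprn_ge0 ?invr_ge0 ?normc_ge0 //.
  by apply: prod_diff => D; exact: clamp01.
rewrite mulr_suml !big_seq; apply: ler_sum => D /sP[hr Dfar].
exact: disc_cut_diff.
Qed.

Lemma box_diff (h : R) j z w : 0 < h -> h <= 1 / 8 -> normc (z - w) <= h ->
  `|box z - box w| * (normc z)^-1 ^+ j <= 4 * h * 8 ^+ j.
Proof.
move=> h0 h8 zw.
have [z8|z8] := leP (1 / 8) (normc z).
  rewrite ler_pM ?normr_ge0 ?exprn_ge0 ?invr_ge0 ?normc_ge0 //.
    by apply: (le_trans (box_lip _ _)); rewrite ler_pM2l.
  rewrite lerXn2r ?nnegrE ?invr_ge0 ?normc_ge0 //.
  by rewrite invf_ple ?posrE //; lra.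
have box1 (u : R[i]) : coord_max u <= 1 / 4 -> box u = 1.
  by move=> u4; rewrite /box clamp_ge1 //; lra.
rewrite !box1 ?subrr ?normr0 ?mul0r ?mulr_ge0 ?exprn_ge0 ?(ltW h0) //.
  have := coord_max_dist z w; rewrite ler_norml => /andP[].
  by have := coord_max_le z; lra.
by have := coord_max_le z; lra.
Qed.

Lemma cutoff_diff (h : R) j s z w : 0 < h -> h <= 1 / 8 ->
  (forall D, D \in s -> h <= Defs.radius D /\ far_disc D) ->
  normc (z - w) <= h ->
  `|box z * discs_cut s z - box w * discs_cut s w| * (normc z)^-1 ^+ j <=
    4 * h * 8 ^+ j + \sum_(D <- s) disc_weight h j D z.
Proof.
move=> h0 h8 sP zw.
have -> : box z * discs_cut s z - box w * discs_cut s w =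
  (box z - box w) * discs_cut s z + box w * (discs_cut s z - discs_cut s w) by ring.
apply: le_trans (lerD (box_diff j h0 h8 zw) (discs_cut_diff j h0 sP zw)).
rewrite -mulrDl ler_wpM2r ?exprn_ge0 ?invr_ge0 ?normc_ge0 //.
have /andP[c0 c1] := discs_cut01 s z; have /andP[b0 b1] := box01 w.
apply: (le_trans (ler_normD _ _)); rewrite lerD //.
  by rewrite normrM (ger0_norm c0) ler_piMr.
by rewrite normrM (ger0_norm b0) ler_piMl.
Qed.

Lemma discs_cut_compl (h : R) j s z : 0 < h -> h <= 1 / 8 ->
  (forall D, D \in s -> Defs.radius D <= 1 / 4 /\ far_disc D) ->
  (1 - discs_cut s z) * (4 * h) * (normc z)^-1 ^+ j <=
    \sum_(D <- s) disc_weight h j D z.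
Proof.
move=> h0 h8 sP; have n0 : 0 <= (normc z)^-1 ^+ j.
  by rewrite exprn_ge0 // invr_ge0 normc_ge0.
have le_sum : 1 - discs_cut s z <= \sum_(D <- s) `|1 - disc_cut D z|.
  have := @prod_diff _ s (fun=> 1) (disc_cut^~ z) _ _.
  rewrite big1_eq -/(discs_cut s z) => /(_ _ _)/(le_trans (ler_norm _)); apply.
    by move=> _; rewrite ler01 lexx.
  by move=> D; exact: clamp01.
apply: (@le_trans _ _ ((\sum_(D <- s) `|1 - disc_cut D z|) * (4 * h) *
    (normc z)^-1 ^+ j)).
  by rewrite !ler_wpM2r // mulr_ge0 // ltW.
rewrite !mulr_suml !big_seq; apply: ler_sum => D /sP[r4 Dfar].
rewrite /disc_weight; have r0 := radius_gt0 D; case: (leP (normc (z - _)) (4 * _)) => [zD|zD]; last first.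
  by rewrite disc_cut1 ?subrr ?normr0 ?mul0r //; lra.
rewrite ler_pM ?mulr_ge0 ?normr_ge0 ?(ltW h0) ?inv_norm_near_disc //.
rewrite (_ : h / Defs.radius D = (Defs.radius D)^-1 * h); last by rewrite mulrC.
rewrite mulrA ler_pM2r //.
apply: (@le_trans _ _ 4).
  have /andP[c0 c1] : 0 <= disc_cut D z <= 1 by exact: clamp01.
  by rewrite ler_piMl // ler_norml; apply/andP; split; lra.
by rewrite -[4]invrK lef_pV2 ?posrE //; lra.
Qed.

Lemma cutoff_compl_diff (h : R) j s z w : 0 < h -> h <= 1 / 8 ->
  (forall D, D \in s -> [/\ h <= Defs.radius D, Defs.radius D <= 1 / 4 & far_disc D]) ->
  normc (z - w) <= h ->
  `|box z * (1 - discs_cut s z) - box w * (1 - discs_cut s w)| *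
    (normc z)^-1 ^+ j <= 2 * \sum_(D <- s) disc_weight h j D z.
Proof.
move=> h0 h8 sP zw; have n0 : 0 <= (normc z)^-1 ^+ j.
  by rewrite exprn_ge0 // invr_ge0 normc_ge0.
have -> : box z * (1 - discs_cut s z) - box w * (1 - discs_cut s w) =
  (box z - box w) * (1 - discs_cut s z) - box w * (discs_cut s z - discs_cut s w).
  by ring.
rewrite mulr_natl mulr2n.
apply: le_trans (lerD (@discs_cut_compl h j s z h0 h8 _)
  (@discs_cut_diff h j s z w h0 _ zw)); first last.
- by move=> D /sP[].
- by move=> D /sP[].
rewrite -mulrDl ler_wpM2r //.
have /andP[c0 c1] := discs_cut01 s z; have /andP[b0 b1] := box01 w.
apply: (le_trans (ler_normB _ _)); rewrite lerD //.
  rewrite normrM mulrC [`|1 - _|]ger0_norm ?ler_wpM2l ?subr_ge0 //.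
  by apply: (le_trans (box_lip _ _)); rewrite ler_pM2l.
by rewrite normrM (ger0_norm b0) ler_piMl.
Qed.

End Clamp.

Section DiscreteContour.
Variable R : realType.
Implicit Types (z w : R[i]) (D : open_disc R) (s : seq (open_disc R)).

Lemma count_interval (h x rho : R) m n : 0 < h -> 0 <= rho ->
  \sum_(k < n) (`|h * (k%:R - m%:R) - x| <= rho)%R%:R <= 2 * rho / h + 1.
Proof.
move=> h0 rho0; pose al := (x - rho) / h + m%:R; pose be := (x + rho) / h + m%:R.
have PE k : (`|h * (k%:R - m%:R) - x| <= rho) = (al <= k%:R <= be).
  have -> : (al <= k%:R) = (x - rho <= h * (k%:R - m%:R)).
    by rewrite /al -lerBrDr ler_pdivrMr // mulrC.
  have -> : (k%:R <= be) = (h * (k%:R - m%:R) <= x + rho).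
    by rewrite /be -lerBlDr ler_pdivlMr // mulrC.
  by rewrite ler_norml; congr andb; apply/idP/idP; lra.
pose M k : R := Num.max 0 (Num.min (k%:R - 1) be - al + 1).
have claim : \sum_(k < n) (`|h * (k%:R - m%:R) - x| <= rho)%R%:R <= M n.
  elim: n => [|n IH]; first by rewrite big_ord0 le_max lexx.
  rewrite big_ord_recr /= PE; apply: (le_trans (lerD IH (lexx _))).
  rewrite /M -[n.+1%:R]natr1 addrK.
  case: (boolP (al <= n%:R <= be)) => [/andP[an nb]|_] /=.
    have -> : Num.min n%:R be = n%:R by rewrite min_l.
    have -> : Num.min (n%:R - 1) be = n%:R - 1 by rewrite min_l //; lra.
    by rewrite le_max; apply/orP; right; rewrite -lerBrDr ge_max; apply/andP; split; lra.
  rewrite addr0 ge_max le_max lexx /= le_max; apply/orP; right.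
  rewrite lerD2r lerD2r le_min; apply/andP; split.
    by rewrite ge_min; apply/orP; left; lra.
  by rewrite ge_min lexx orbT.
apply: (le_trans claim); rewrite /M ge_max.
have be_al : be - al = 2 * rho / h by rewrite /be /al; field; rewrite gt_eqF.
rewrite addr_ge0 ?divr_ge0 ?mulr_ge0 ?(ltW h0) //= -be_al !lerD2r.
by rewrite ge_min lexx orbT.
Qed.

Lemma sum_disc_weight (h : R) j m n D (u v : nat) : 0 < h -> h <= Defs.radius D ->
  \sum_(k < n) \sum_(l < n) disc_weight h j D (lattice_point h m (k + u) (l + v))
    <= 81 * (Defs.radius D * (2 / normc (Defs.center D : R[i])) ^+ j) / h.
Proof.
move=> h0 hr; have r0 := radius_gt0 D.
set a := Defs.center D : R[i]; set r := Defs.radius D in hr r0 *.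
set q := (2 / normc a) ^+ j.
have q0 : 0 <= q by rewrite exprn_ge0 // divr_ge0 ?normc_ge0.
pose I (k : nat) (x : R) : R := (`|h * (k%:R - m%:R) - x| <= 4 * r)%R%:R.
have count (x : R) i : \sum_(k < n) I (k + i)%N x <= 9 * r / h.
  apply: (@le_trans _ _ (\sum_(k < i + n) I k x)).
    have I0 k : 0 <= I k x by exact: ler0n.
    apply: le_trans (sum_ord_shift I0 (leqnn (i + n))).
    by under eq_bigr => k _ do rewrite addnC.
  apply: (le_trans (count_interval _ _ _ h0 _)); first by rewrite mulr_ge0 // ltW.
  rewrite ler_pdivlMr // mulrDl divfK ?gt_eqF //; lra.
apply: (@le_trans _ _ (\sum_(k < n) \sum_(l < n) (h / r * q) *
    (I (k + u)%N (complex.Re a) * I (l + v)%N (complex.Im a)))).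
  apply: ler_sum => k _; apply: ler_sum => l _.
  have hq : 0 <= h / r * q by rewrite mulr_ge0 // divr_ge0 // ltW.
  rewrite /disc_weight -/a -/r -/q; case: ifP => [zD|_]; last by rewrite mulr_ge0 // mulr_ge0 ?ler0n.
  have re := le_trans (ler_Re _) zD; have im := le_trans (ler_Im _) zD.
  rewrite /I; move: re im; case: (a) => a1 a2 /= -> ->.
  by rewrite !mulr1.
under eq_bigr => k _ do rewrite -mulr_sumr -mulr_sumr.
rewrite -mulr_sumr -mulr_suml.
apply: (@le_trans _ _ (h / r * q * (9 * r / h * (9 * r / h)))).
  rewrite ler_wpM2l ?mulr_ge0 ?invr_ge0 ?(ltW h0) ?(ltW r0) //.
  by rewrite ler_pM ?sumr_ge0 // => *; exact: ler0n.
by rewrite le_eqVlt; apply/orP; left; apply/eqP; field; rewrite !gt_eqF.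
Qed.

Variables (h : R) (N : nat).
Hypotheses (N0 : (0 < N)%N) (hN : h * (4 * N)%:R = 1).

Local Notation m := (2 * N).+1.
Local Notation n := (4 * N).+2.
Local Notation pt k l := (lattice_point h m k l).

Let h0 : 0 < h.
Proof. by rewrite -(@pmulr_lgt0 _ (4 * N)%:R) ?hN ?ltr0n //; lia. Qed.

Let h4 : h <= 1 / 4.
Proof.
have : h * 4%:R <= h * (4 * N)%:R.
  by rewrite ler_pM2l // ler_nat; lia.
by rewrite hN; lra.
Qed.

Let nh : n%:R * h <= 3 / 2.
Proof.
rewrite mulrC (_ : n = 4 * N + 2)%N; last lia.
by rewrite natrD mulrDr hN; have := h4; lra.
Qed.

Lemma lattice_stepx k l : pt k.+1 l = pt k l + h%:C.
Proof.
by apply/eqP; rewrite eq_complex /= -natr1; apply/andP; split; apply/eqP; ring.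
Qed.

Lemma lattice_stepy k l : pt k l.+1 = pt k l + 'i%C * h%:C.
Proof.
by apply/eqP; rewrite eq_complex /= -natr1; apply/andP; split; apply/eqP; ring.
Qed.

Lemma lattice_stepx_norm k l : normc (pt k.+1 l - pt k l) <= h.
Proof. by rewrite lattice_stepx addrAC subrr add0r normc_real gtr0_norm. Qed.

Lemma lattice_stepy_norm k l : normc (pt k l.+1 - pt k l) <= h.
Proof.
by rewrite lattice_stepy addrAC subrr add0r normcM normc_i mul1r normc_real gtr0_norm.
Qed.

Definition contour (phi : R[i] -> R) (F : R[i] -> R[i]) : R[i] :=
  h%:C * \sum_(k < n) \sum_(l < n)
    (F (pt k.+1 l) * (phi (pt k.+1 l) - phi (pt k l))%:C +
     'i%C * F (pt k l.+1) * (phi (pt k l.+1) - phi (pt k l))%:C).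

Lemma contourD phi F G :
  contour phi (fun z => F z + G z) = contour phi F + contour phi G.
Proof.
rewrite /contour -mulrDr -big_split; congr (_ * _); apply: eq_bigr => k _.
by rewrite -big_split; apply: eq_bigr => l _ /=; ring.
Qed.

Lemma contourZ phi c F : contour phi (fun z => c * F z) = c * contour phi F.
Proof.
rewrite /contour [RHS]mulrCA; congr (_ * _); rewrite mulr_sumr; apply: eq_bigr => k _.
by rewrite mulr_sumr; apply: eq_bigr => l _ /=; ring.
Qed.

Lemma contour_sum phi (r : nat) (F : nat -> R[i] -> R[i]) :
  contour phi (fun z => \sum_(i < r) F i z) = \sum_(i < r) contour phi (F i).
Proof.
elim: r => [|r IH].
  rewrite big_ord0 /contour big1 ?mulr0 // => k _; rewrite big1 // => l _.
  by rewrite !big_ord0 mulr0 !mul0r addr0.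
by under eq_fun do rewrite big_ord_recr /=; rewrite contourD IH big_ord_recr.
Qed.

Lemma contour_cutB phi psi F :
  contour (fun z => phi z - psi z) F = contour phi F - contour psi F.
Proof.
rewrite /contour -mulrBr -sumrB; congr (_ * _); apply: eq_bigr => k _.
by rewrite -sumrB; apply: eq_bigr => l _ /=; rewrite !rmorphB /=; ring.
Qed.

Lemma contour_ext phi F G :
  (forall z w, normc (z - w) <= h -> phi z != phi w -> F z = G z) ->
  contour phi F = contour phi G.
Proof.
move=> FG; rewrite /contour; congr (_ * _); apply: eq_bigr => k _.
apply: eq_bigr => l _; congr (_ + _).
  have [->|ne] := eqVneq (phi (pt k.+1 l)) (phi (pt k l)).
    by rewrite subrr !mulr0.
  by rewrite (FG _ _ (lattice_stepx_norm k l) ne).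
have [->|ne] := eqVneq (phi (pt k l.+1)) (phi (pt k l)).
  by rewrite subrr !mulr0.
by rewrite (FG _ _ (lattice_stepy_norm k l) ne).
Qed.

Lemma contour_bound phi F s j (B c0 c1 : R) : 0 <= B -> 0 <= c0 -> 0 <= c1 ->
  (forall D, D \in s -> h <= Defs.radius D) ->
  (forall z w, normc (z - w) <= h -> phi z != phi w ->
    normc (F z) <= B * (normc z)^-1 ^+ j) ->
  (forall z w, normc (z - w) <= h -> `|phi z - phi w| * (normc z)^-1 ^+ j <=
    c0 * h * 8 ^+ j + c1 * \sum_(D <- s) disc_weight h j D z) ->
  normc (contour phi F) <= B * (c0 * (9 / 2) * 8 ^+ j +
    c1 * 162 * \sum_(D <- s) (Defs.radius D * (2 / normc (Defs.center D : R[i])) ^+ j)).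
Proof.
move=> B0 c00 c10 hs FB phiB.
pose W z : R := c0 * h * 8 ^+ j + c1 * \sum_(D <- s) disc_weight h j D z.
have W0 z : 0 <= W z.
  rewrite addr_ge0 ?mulr_ge0 ?exprn_ge0 ?(ltW h0) // sumr_ge0 // => D _.
  exact/disc_weight_ge0/ltW.
have step z w : normc (z - w) <= h ->
    normc (F z) * `|phi z - phi w| <= B * W z.
  move=> zw; have [->|ne] := eqVneq (phi z) (phi w).
    by rewrite subrr normr0 mulr0 mulr_ge0.
  apply: (@le_trans _ _ (B * (normc z)^-1 ^+ j * `|phi z - phi w|)).
    by rewrite ler_wpM2r // (FB _ _ zw ne).
  by rewrite -mulrA ler_wpM2l // mulrC phiB.
have sumW u v : \sum_(k < n) \sum_(l < n) W (pt (k + u) (l + v)) <=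
    (c0 * (9 / 4) * 8 ^+ j + c1 * 81 * \sum_(D <- s) (Defs.radius D *
      (2 / normc (Defs.center D : R[i])) ^+ j)) / h.
  rewrite /W; under eq_bigr => k _ do rewrite big_split.
  rewrite big_split /= mulrDl lerD //.
    rewrite !sumr_const !card_ord -mulrnA -[_ *+ _]mulr_natr natrM ler_pdivlMr //.
    have -> : c0 * h * 8 ^+ j * (n%:R * n%:R) * h =
      c0 * 8 ^+ j * ((n%:R * h) * (n%:R * h)) by ring.
    have -> : c0 * (9 / 4) * 8 ^+ j = c0 * 8 ^+ j * (3 / 2 * (3 / 2)) by field.
    rewrite ler_wpM2l ?mulr_ge0 ?exprn_ge0 //.
    have nh0 : 0 <= n%:R * h by rewrite mulr_ge0 // ltW.
    by rewrite ler_pM.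
  under eq_bigr => k _ do rewrite -mulr_sumr exchange_big /=.
  rewrite -mulr_sumr exchange_big /= -!mulrA ler_wpM2l //.
  rewrite mulr_suml mulr_sumr !big_seq; apply: ler_sum => D Ds.
  rewrite mulrA; exact: sum_disc_weight (hs _ Ds).
rewrite normcM normc_real (gtr0_norm h0).
apply: (@le_trans _ _ (h * \sum_(k < n) \sum_(l < n)
    (B * W (pt (k + 1) (l + 0)) + B * W (pt (k + 0) (l + 1))))).
  rewrite ler_pM2l //; apply: (le_trans (ler_normc_sum _ _ _)).
  apply: ler_sum => k _; apply: (le_trans (ler_normc_sum _ _ _)).
  apply: ler_sum => l _; apply: (le_trans (ler_normcD _ _)).
  rewrite addn1 addn0 [(k + 0)%N]addn0 addn1 !normcM normc_i mul1r !normc_real.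
  by rewrite lerD // step // ?lattice_stepx_norm ?lattice_stepy_norm.
under eq_bigr => k _ do rewrite big_split -!mulr_sumr.
rewrite big_split -!mulr_sumr /=.
have := sumW 1%N 0%N; have := sumW 0%N 1%N.
move: (\sum_(k < n) _) (\sum_(k < n) _) => x y.
set q := \sum_(D <- s) _ => /(ler_wpM2l B0) yq /(ler_wpM2l B0) xq.
rewrite mulrDr; apply: (@le_trans _ _ (h * (B * ((c0 * (9 / 4) * 8 ^+ j + c1 * 81 * q) / h)) +
  h * (B * ((c0 * (9 / 4) * 8 ^+ j + c1 * 81 * q) / h)))).
  by rewrite lerD // ler_pM2l.
by rewrite le_eqVlt; apply/orP; left; apply/eqP; field; rewrite gt_eqF.
Qed.

End DiscreteContour.

Section ContourEstimates.
Variable R : realType.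
Implicit Types (z w : R[i]) (D : open_disc R) (s : seq (open_disc R)).

Lemma abel_sum (phi f : nat -> R[i]) n : phi 0%N = 0 -> phi n = 0 ->
  \sum_(k < n) phi k * (f k.+1 - f k) = - \sum_(k < n) f k.+1 * (phi k.+1 - phi k).
Proof.
move=> phi0 phin; apply/eqP; rewrite -addr_eq0 -big_split /=.
suff -> : \sum_(k < n) (phi k * (f k.+1 - f k) + f k.+1 * (phi k.+1 - phi k)) =
    phi n * f n - phi 0%N * f 0%N by rewrite phi0 phin !mul0r subrr.
elim: n {phin} => [|n IH]; first by rewrite big_ord0 subrr.
by rewrite big_ord_recr IH /=; ring.
Qed.

Variables (h : R) (N : nat).
Hypotheses (N0 : (0 < N)%N) (hN : h * (4 * N)%:R = 1).

Local Notation m := (2 * N).+1.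
Local Notation n := (4 * N).+2.
Local Notation pt k l := (lattice_point h m k l).

Let h0 : 0 < h.
Proof. by rewrite -(@pmulr_lgt0 _ (4 * N)%:R) ?hN ?ltr0n //; lia. Qed.

Let h4 : h <= 1 / 4.
Proof.
have : h * 4%:R <= h * (4 * N)%:R.
  by rewrite ler_pM2l // ler_nat; lia.
by rewrite hN; lra.
Qed.

Let nh : n%:R * h <= 3 / 2.
Proof.
rewrite mulrC (_ : n = 4 * N + 2)%N; last lia.
by rewrite natrD mulrDr hN; have := h4; lra.
Qed.

Let hN4 : h * N%:R = 1 / 4.
Proof. by move: hN; rewrite natrM; lra. Qed.

Lemma contour_holomorphic (phi : R[i] -> R) (F : R[i] -> R[i]) (M : R) :
  0 <= M -> (forall z, 1 / 2 <= coord_max z -> phi z = 0) ->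
  (forall z, 0 <= phi z <= 1) ->
  (forall z, phi z != 0 -> normc (F (z + h%:C) - F z +
    'i%C * (F (z + 'i%C * h%:C) - F z)) <= M * h ^+ 2) ->
  normc (contour h N phi F) <= M * (9 / 4) * h.
Proof.
move=> M0 phi0 phi01 FM; rewrite /contour.
have mh : h * m%:R = 1 / 2 + h by rewrite -natr1 natrM mulrDr mulr1; have := hN4; lra.
have nm : n%:R - m%:R = m%:R :> R by rewrite -natrB; [congr _%:R; lia|lia].
have re0 l : phi (pt 0%N l) = 0.
  apply: phi0; rewrite /coord_max le_max /= sub0r mulrN normrN mh.
  by rewrite ger0_norm; [apply/orP; left|]; have := h0; lra.
have re1 l : phi (pt n l) = 0.
  apply: phi0; rewrite /coord_max le_max /= nm mh.
  by rewrite ger0_norm; [apply/orP; left|]; have := h0; lra.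
have im0 k : phi (pt k 0%N) = 0.
  apply: phi0; rewrite /coord_max le_max /= sub0r mulrN normrN mh.
  by rewrite [`|1 / 2 + h|]ger0_norm; [apply/orP; right|]; have := h0; lra.
have im1 k : phi (pt k n) = 0.
  apply: phi0; rewrite /coord_max le_max /= nm mh.
  by rewrite [`|1 / 2 + h|]ger0_norm; [apply/orP; right|]; have := h0; lra.
have -> : \sum_(k < n) \sum_(l < n) (F (pt k.+1 l) * (phi (pt k.+1 l) - phi (pt k l))%:C +
      'i%C * F (pt k l.+1) * (phi (pt k l.+1) - phi (pt k l))%:C) =
    - \sum_(k < n) \sum_(l < n) (phi (pt k l))%:C *
      (F (pt k.+1 l) - F (pt k l) + 'i%C * (F (pt k l.+1) - F (pt k l))).
  under eq_bigr => k _ do rewrite big_split.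
  rewrite big_split /=.
  under [X in _ = - X]eq_bigr => k _ do
    (under eq_bigr => l _ do rewrite mulrDr; rewrite big_split).
  rewrite big_split /= opprD; congr (_ + _).
    rewrite exchange_big [in RHS]exchange_big -sumrN; apply: eq_bigr => l _ /=.
    have := @abel_sum (fun k => (phi (pt k l))%:C) (fun k => F (pt k l)) n _ _.
    rewrite re0 re1 => /(_ erefl erefl) ->; rewrite opprK.
    by apply: eq_bigr => k _; rewrite rmorphB.
  rewrite -sumrN; apply: eq_bigr => k _ /=.
  have := @abel_sum (fun l => (phi (pt k l))%:C) (fun l => 'i%C * F (pt k l)) n _ _.
  rewrite im0 im1 => /(_ erefl erefl) e.
  under [in RHS]eq_bigr => l _ do rewrite mulrBr.
  rewrite e opprK.
  by apply: eq_bigr => l _; rewrite rmorphB.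
rewrite mulrN normc_opp normcM normc_real (gtr0_norm h0).
apply: (@le_trans _ _ (h * \sum_(k < n) \sum_(l < n) M * h ^+ 2)).
  rewrite ler_pM2l //; apply: (le_trans (ler_normc_sum _ _ _)).
  apply: ler_sum => k _; apply: (le_trans (ler_normc_sum _ _ _)).
  apply: ler_sum => l _; rewrite normcM normc_real.
  have [->|ne] := eqVneq (phi (pt k l)) 0.
    by rewrite normr0 mul0r mulr_ge0 ?exprn_ge0 // ltW.
  have /andP[p0 p1] := phi01 (pt k l); rewrite (ger0_norm p0).
  rewrite lattice_stepx lattice_stepy.
  by apply: le_trans (FM _ ne); rewrite ler_piMl ?normc_ge0.
rewrite !sumr_const !card_ord -mulrnA -[_ *+ _]mulr_natr natrM.
have -> : h * (M * h ^+ 2 * (n%:R * n%:R)) = M * ((n%:R * h) * (n%:R * h)) * h by ring.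
rewrite ler_wpM2r ?(ltW h0) // ler_wpM2l //.
have nh0 : 0 <= n%:R * h by rewrite mulr_ge0 // ltW.
by have := nh; nra.
Qed.

Lemma contour_box_inv :
  1 / 2 <= normc (contour h N (@box R) (fun z => z^-1)).
Proof.
have invE z : z^-1 = (complex.Re z / normc z ^+ 2 -i* (complex.Im z / normc z ^+ 2))%C.
  by rewrite normc_sqr; case: z => a b.
pose X k l : R := complex.Re (pt k.+1 l) / normc (pt k.+1 l) ^+ 2 *
  (box (pt k l) - box (pt k.+1 l)).
pose Y k l : R := complex.Im (pt k l.+1) / normc (pt k l.+1) ^+ 2 *
  (box (pt k l) - box (pt k l.+1)).
have ReE : complex.Re (- contour h N (@box R) (fun z => z^-1)) =
    h * \sum_(k < n) \sum_(l < n) (X k l + Y k l).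
  have ReC (a : R) (u : R[i]) : complex.Re (a%:C * u) = a * complex.Re u.
    by case: u => u1 u2 /=; ring.
  have Resum (F : 'I_n -> R[i]) : complex.Re (\sum_k F k) = \sum_k complex.Re (F k).
    by apply: (big_morph (fun u : R[i] => complex.Re u)) => // -[? ?] [].
  rewrite /contour -mulrN ReC -sumrN Resum; congr (_ * _); apply: eq_bigr => k _.
  rewrite -sumrN Resum; apply: eq_bigr => l _; rewrite !invE /X /Y /=; ring.
have box_mono z w : coord_max w <= coord_max z -> 0 <= box w - box z.
  by move=> wz; rewrite subr_ge0 clamp_mono //; lra.
have absk (k : nat) : (k.+1%:R - m%:R <= 0 :> R -> `|k.+1%:R - m%:R| <= `|k%:R - m%:R| :> R) *
    (0 <= k.+1%:R - m%:R - 1 :> R -> `|k%:R - m%:R| <= `|k.+1%:R - m%:R| :> R).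
  by split; rewrite -[k.+1%:R]natr1 => ?; [rewrite !ler0_norm|rewrite !ger0_norm]; lra.
have ksign (k : nat) : k.+1%:R - m%:R <= 0 :> R \/ 0 <= k.+1%:R - m%:R - 1 :> R.
  case: (leqP k.+1 m) => km; [left; rewrite subr_le0 ler_nat|right] => //.
  by rewrite -addrA -opprD natr1 subr_ge0 ler_nat.
have cmx (i j l : nat) : `|i%:R - m%:R| <= `|j%:R - m%:R| :> R ->
    coord_max (pt i l) <= coord_max (pt j l).
  move=> ij; rewrite /coord_max /= ge_max !le_max lexx orbT andbT.
  by rewrite !normrM ler_wpM2l ?normr_ge0.
have cmy (i j k : nat) : `|i%:R - m%:R| <= `|j%:R - m%:R| :> R ->
    coord_max (pt k i) <= coord_max (pt k j).
  move=> ij; rewrite /coord_max /= ge_max !le_max lexx /=; apply/orP; right.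
  by rewrite !normrM ler_wpM2l ?normr_ge0.
have n2 (z : R[i]) : 0 <= (normc z ^+ 2)^-1 by rewrite invr_ge0 exprn_ge0 ?normc_ge0.
have X0 k l : 0 <= X k l.
  rewrite /X; case: (ksign k) => kle.
    have box_le := box_mono _ _ (cmx _ _ l ((absk k).1 kle)).
    apply: mulr_le0; last by rewrite -oppr_ge0 opprB.
    by rewrite mulr_le0_ge0 //= mulr_ge0_le0 // ltW.
  apply: mulr_ge0; last exact/box_mono/cmx/(absk k).2.
  by rewrite mulr_ge0 //= mulr_ge0 ?(ltW h0) //; lra.
have Y0 k l : 0 <= Y k l.
  rewrite /Y; case: (ksign l) => kle.
    have box_le := box_mono _ _ (cmy _ _ k ((absk l).1 kle)).
    apply: mulr_le0; last by rewrite -oppr_ge0 opprB.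
    by rewrite mulr_le0_ge0 //= mulr_ge0_le0 // ltW.
  apply: mulr_ge0; last exact/box_mono/cmy/(absk l).2.
  by rewrite mulr_ge0 //= mulr_ge0 ?(ltW h0) //; lra.
have Xin (u v : nat) : (u < N)%N -> (v < (2 * N).+1)%N ->
    4 * h <= X (3 * N + 1 + u)%N (N + 1 + v)%N.
  move=> uN vN; rewrite /X normc_sqr.
  have e1 : h * ((3 * N + 1 + u).+1%:R - m%:R) = 1 / 4 + h * u.+1%:R.
    rewrite -hN4 -mulrDr -natrD -natrB; last lia.
    by congr (_ * _%:R); lia.
  have e0 : h * ((3 * N + 1 + u)%N%:R - m%:R) = 1 / 4 + h * u%:R.
    rewrite -hN4 -mulrDr -natrD -natrB; last lia.
    by congr (_ * _%:R); lia.
  have e2 : `|h * ((N + 1 + v)%N%:R - m%:R)| <= 1 / 4.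
    have -> : (N + 1 + v)%N%:R - m%:R = v%:R - N%:R :> R.
      have -> : m%:R = 2 * N%:R + 1 :> R by rewrite -natr1 natrM.
      by rewrite !natrD; ring.
    rewrite mulrBr hN4.
    have : h * v%:R <= h * (2 * N)%:R by rewrite ler_pM2l // ler_nat -ltnS.
    rewrite natrM mulrCA hN4 => hv; have hv0 : 0 <= h * v%:R by rewrite mulr_ge0 // ltW.
    by rewrite ler_norml; apply/andP; split; lra.
  have hu : h * u.+1%:R <= 1 / 4 by rewrite -hN4 ler_pM2l // ler_nat.
  have hu0 : 0 <= h * u%:R by rewrite mulr_ge0 // ltW.
  have huS : h * u.+1%:R = h * u%:R + h by rewrite -natr1 mulrDr mulr1.
  have boxE (x y : R) : 1 / 4 <= x <= 1 / 2 -> `|y| <= 1 / 4 ->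
      box (x +i* y)%C = 2 - 4 * x.
    move=> /andP[x4 x2] y4; rewrite /box /coord_max /= max_l; last first.
      by rewrite [`|x|]ger0_norm; lra.
    by rewrite ger0_norm; [rewrite clamp_id; lra|lra].
  rewrite /lattice_point /= e0 e1 !boxE; last first.
  - exact: e2.
  - by have := h0; move=> ?; apply/andP; split; lra.
  - exact: e2.
  - by have := h0; move=> ?; apply/andP; split; lra.
  move: e2 hu hu0 huS.
  move: (h * (_ - _)) (h * u.+1%:R) (h * u%:R) => y xS x y4 xS4 x0 xSE.
  have y2 : y ^+ 2 <= 1 / 16.
    by move: y4; rewrite ler_norml => /andP[y41 y42]; nra.
  have -> : 2 - 4 * (1 / 4 + x) - (2 - 4 * (1 / 4 + xS)) = 4 * h by rewrite xSE; ring.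
  rewrite ler_peMl ?mulr_ge0 ?(ltW h0) //.
  have d0 : 0 < (1 / 4 + xS) ^+ 2 + y ^+ 2.
    by rewrite ltr_pwDl ?sqr_ge0 // exprn_gt0 //; have := h0; lra.
  rewrite ler_pdivlMr // mul1r.
  by have := h0; nra.
apply: le_trans (_ : complex.Re (- contour h N (@box R) (fun z => z^-1)) <= _).
  rewrite ReE.
  pose f k : R := \sum_(l < n) (X k l + Y k l).
  have f0 k : 0 <= f k by rewrite sumr_ge0 // => l _; rewrite addr_ge0.
  have kN : (3 * N + 1 + N <= n)%N by lia.
  apply: le_trans (ler_wpM2l (ltW h0) (sum_ord_shift f0 kN)).
  apply: (@le_trans _ _ (h * \sum_(u < N) \sum_(v < (2 * N).+1) 4 * h)).
    rewrite !sumr_const !card_ord -mulrnA -[X in h * X]mulr_natr natrM.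
    have -> : m%:R = 2 * N%:R + 1 :> R by rewrite -natr1 natrM.
    have := hN4; have := h0; set x := N%:R => hh hx.
    have -> : h * (4 * h * ((2 * x + 1) * x)) =
      8 * (h * x) * (h * x) + 4 * h * (h * x) by ring.
    by rewrite hx; lra.
  rewrite ler_pM2l //; apply: ler_sum => u _; rewrite /f.
  have XY0 l : 0 <= X (3 * N + 1 + u)%N l + Y (3 * N + 1 + u)%N l by rewrite addr_ge0.
  have lN : (N + 1 + (2 * N).+1 <= n)%N by lia.
  apply: le_trans (sum_ord_shift XY0 lN); apply: ler_sum => v _.
  by rewrite (le_trans (Xin _ _ (ltn_ord u) (ltn_ord v))) // lerDl.
by rewrite -normc_opp (le_trans (ler_norm _)) // ler_Re.
Qed.

End ContourEstimates.

Section Smooth.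
Variable R : realType.
Implicit Types (z w : R[i]) (f g : R[i] -> R[i]) (E : set R[i]).

Definition smooth_on E f := exists f' : R[i] -> R[i], exists2 M : R, 0 <= M &
  forall z w, E z -> E w -> [/\ normc (f z) <= M, normc (f' z) <= M &
    normc (f w - f z - f' z * (w - z)) <= M * normc (w - z) ^+ 2].

Lemma smooth_cst E c : smooth_on E (fun=> c).
Proof.
exists (fun=> 0), (normc c) => [|z w _ _]; first exact: normc_ge0.
by rewrite subrr mul0r subr0 normc0 mulr_ge0 ?exprn_ge0 ?normc_ge0.
Qed.

Lemma smooth_id E : (forall z, E z -> normc z <= 1) -> smooth_on E id.
Proof.
move=> E1; exists (fun=> 1), 1 => // z w Ez _; split; rewrite ?normc1 ?E1 //.
by rewrite mul1r subrr normc0 mul1r exprn_ge0 ?normc_ge0.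
Qed.

Lemma smoothD E f g : smooth_on E f -> smooth_on E g ->
  smooth_on E (fun z => f z + g z).
Proof.
move=> [f' [M M0 fM]] [g' [M' M'0 gM]].
exists (fun z => f' z + g' z), (M + M') => [|z w Ez Ew]; first exact: addr_ge0.
have [f1 f2 f3] := fM z w Ez Ew; have [g1 g2 g3] := gM z w Ez Ew.
split; [exact: le_trans (ler_normcD _ _) (lerD f1 g1)|
        exact: le_trans (ler_normcD _ _) (lerD f2 g2)|].
have -> : f w + g w - (f z + g z) - (f' z + g' z) * (w - z) =
  (f w - f z - f' z * (w - z)) + (g w - g z - g' z * (w - z)) by ring.
by rewrite mulrDl (le_trans (ler_normcD _ _)) // lerD.
Qed.

Lemma smooth_lip E f : (forall z, E z -> normc z <= 1) -> smooth_on E f ->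
  exists2 M : R, 0 <= M & forall z w, E z -> E w ->
    normc (f w - f z) <= M * normc (w - z).
Proof.
move=> E1 [f' [M M0 fM]]; exists (3 * M) => [|z w Ez Ew]; first by rewrite mulr_ge0.
have [_ f2 f3] := fM z w Ez Ew.
have d2 : normc (w - z) <= 2 by have := ler_normcB w z; have := E1 _ Ez; have := E1 _ Ew; lra.
have -> : f w - f z = (f w - f z - f' z * (w - z)) + f' z * (w - z) by ring.
apply: (le_trans (ler_normcD _ _)); rewrite normcM.
have : normc (f' z) * normc (w - z) <= M * normc (w - z).
  by rewrite ler_wpM2r ?normc_ge0.
have : M * normc (w - z) ^+ 2 <= 2 * (M * normc (w - z)).
  by rewrite expr2 mulrCA ler_wpM2r ?mulr_ge0 ?normc_ge0.
lra.
Qed.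

Lemma smoothM E f g : (forall z, E z -> normc z <= 1) ->
  smooth_on E f -> smooth_on E g -> smooth_on E (fun z => f z * g z).
Proof.
move=> E1 fE gE; have [L L0 gL] := smooth_lip E1 gE.
case: fE gE => [f' [M M0 fM]] [g' [M' M'0 gM]].
exists (fun z => f' z * g z + f z * g' z), (2 * M * M' + M * L) => [|z w Ez Ew].
  by rewrite addr_ge0 ?mulr_ge0.
have [f1 f2 f3] := fM z w Ez Ew; have [g1 g2 g3] := gM z w Ez Ew.
have [gw _ _] := gM w z Ew Ez; have gl := gL z w Ez Ew.
have ML : 0 <= M * L by rewrite mulr_ge0.
have MM : 0 <= M * M' by rewrite mulr_ge0.
have le2 (a b : R[i]) (u v : R) : normc a <= u -> normc b <= v -> normc (a * b) <= u * v.
  by move=> au bv; rewrite normcM ler_pM ?normc_ge0.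
split.
- by apply: (le_trans (le2 _ _ _ _ f1 g1)); lra.
- by apply: (le_trans (ler_normcD _ _)); have := le2 _ _ _ _ f2 g1;
    have := le2 _ _ _ _ f1 g2; lra.
have -> : f w * g w - f z * g z - (f' z * g z + f z * g' z) * (w - z) =
  (f w - f z - f' z * (w - z)) * g w + f z * (g w - g z - g' z * (w - z)) +
  f' z * ((g w - g z) * (w - z)) by ring.
apply: (le_trans (ler_normcD _ _)); apply: (le_trans (lerD (ler_normcD _ _) (lexx _))).
have h1 := le2 _ _ _ _ f3 gw; have h2 := le2 _ _ _ _ f1 g3.
have h3 := le2 _ _ _ _ f2 (le2 _ _ _ _ gl (lexx (normc (w - z)))).
have -> : (2 * M * M' + M * L) * normc (w - z) ^+ 2 =
  M * normc (w - z) ^+ 2 * M' + M * (M' * normc (w - z) ^+ 2) +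
  M * (L * normc (w - z) * normc (w - z)) by ring.
by rewrite !lerD.
Qed.

Lemma smoothV E f (k : R) : (forall z, E z -> normc z <= 1) -> 0 < k ->
  (forall z, E z -> k <= normc (f z)) ->
  smooth_on E f -> smooth_on E (fun z => (f z)^-1).
Proof.
move=> E1 k0 kf fE; have [L L0 fL] := smooth_lip E1 fE.
case: fE => [f' [M M0 fM]].
have kV z : E z -> normc (f z)^-1 <= k^-1.
  by move=> Ez; rewrite normcV lef_pV2 ?posrE ?kf // (lt_le_trans k0) ?kf.
have k0' : 0 <= k^-1 by rewrite invr_ge0 ltW.
have le2 (a b : R[i]) (u v : R) : normc a <= u -> normc b <= v -> normc (a * b) <= u * v.
  by move=> au bv; rewrite normcM ler_pM ?normc_ge0.
exists (fun z => - f' z * ((f z)^-1 * (f z)^-1)),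
  (k^-1 + M * (k^-1 * k^-1) + M * (k^-1 * k^-1) + M * L * (k^-1 * k^-1 * k^-1)) => [|z w Ez Ew].
  by rewrite !addr_ge0 ?mulr_ge0.
have [f1 f2 f3] := fM z w Ez Ew; have fl := fL z w Ez Ew.
have zV := kV z Ez; have wV := kV w Ew.
have p1 : 0 <= M * (k^-1 * k^-1) by rewrite !mulr_ge0.
have p2 : 0 <= M * L * (k^-1 * k^-1 * k^-1) by rewrite !mulr_ge0.
split; first by lra.
  by have := le2 _ _ _ _ f2 (le2 _ _ _ _ zV zV); rewrite mulNr normc_opp; lra.
have fz0 : f z != 0 by rewrite -normc_gt0 (lt_le_trans k0) ?kf.
have fw0 : f w != 0 by rewrite -normc_gt0 (lt_le_trans k0) ?kf.
have -> : (f w)^-1 - (f z)^-1 - - f' z * ((f z)^-1 * (f z)^-1) * (w - z) =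
  - (f w - f z - f' z * (w - z)) * ((f z)^-1 * (f w)^-1) +
  f' z * ((f w - f z) * (w - z)) * ((f z)^-1 * (f z)^-1 * (f w)^-1).
  by field; rewrite fz0 fw0.
apply: (le_trans (ler_normcD _ _)); rewrite mulNr normc_opp.
have h1 := le2 _ _ _ _ f3 (le2 _ _ _ _ zV wV).
have h2 := le2 _ _ _ _ (le2 _ _ _ _ f2 (le2 _ _ _ _ fl (lexx (normc (w - z)))))
  (le2 _ _ _ _ (le2 _ _ _ _ zV zV) wV).
apply: (le_trans (lerD h1 h2)).
have -> : M * normc (w - z) ^+ 2 * (k^-1 * k^-1) +
    M * (L * normc (w - z) * normc (w - z)) * (k^-1 * k^-1 * k^-1) =
  (M * (k^-1 * k^-1) + M * L * (k^-1 * k^-1 * k^-1)) * normc (w - z) ^+ 2 by ring.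
by rewrite ler_wpM2r ?exprn_ge0 ?normc_ge0 //; lra.
Qed.

Lemma smooth_poly E (p : {poly R[i]}) : (forall z, E z -> normc z <= 1) ->
  smooth_on E (horner p).
Proof.
move=> E1; elim/poly_ind: p => [|p c IH].
  rewrite (_ : horner 0 = fun=> 0); first exact: smooth_cst.
  by apply/funext => z; rewrite horner0.
rewrite (_ : horner _ = fun z => p.[z] * z + c); last first.
  by apply/funext => z; rewrite hornerMXaddC.
by apply: smoothD (smooth_cst _ _); apply: smoothM E1 IH (smooth_id E1).
Qed.

Lemma smooth_cauchy_riemann E f : smooth_on E f ->
  exists2 M : R, 0 <= M & forall z (h : R), 0 <= h -> E z -> E (z + h%:C) ->
    E (z + 'i%C * h%:C) ->
    normc (f (z + h%:C) - f z + 'i%C * (f (z + 'i%C * h%:C) - f z)) <= M * h ^+ 2.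
Proof.
move=> [f' [M M0 fM]]; exists (2 * M) => [|z h h0 Ez Ex Ey]; first by rewrite mulr_ge0.
have [_ _ fx] := fM _ _ Ez Ex; have [_ _ fy] := fM _ _ Ez Ey.
have cancel (u : R[i]) : z + u - z = u by ring.
rewrite cancel normc_real (ger0_norm h0) in fx.
rewrite cancel normcM normc_i mul1r normc_real (ger0_norm h0) in fy.
have -> : f (z + h%:C) - f z + 'i%C * (f (z + 'i%C * h%:C) - f z) =
  (f (z + h%:C) - f z - f' z * h%:C) +
  'i%C * (f (z + 'i%C * h%:C) - f z - f' z * ('i%C * h%:C)) +
  ('i%C ^+ 2 + 1) * f' z * h%:C by ring.
rewrite sqr_i addNr !mul0r addr0 (le_trans (ler_normcD _ _)) // normcM normc_i mul1r.
by rewrite -mulrA mulr_natl mulr2n lerD.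
Qed.

End Smooth.

Section TaylorCoefficients.
Variable R : realType.
Implicit Types (p q : {poly R[i]}) (z : R[i]).

(* Iterating the backward shift f |-> (f - f 0) / z on the quotient p / q. *)
Fixpoint taylor_num p q n : {poly R[i]} :=
  if n is k.+1 then
    (taylor_num p q k - ((taylor_num p q k).[0] / q.[0])%:P * q) %/ ('X - 0%:P)
  else p.

Definition taylor_coef p q n : R[i] := (taylor_num p q n).[0] / q.[0].

Lemma taylor_numS p q n z : q.[0] != 0 ->
  z * (taylor_num p q n.+1).[z] = (taylor_num p q n).[z] - taylor_coef p q n * q.[z].
Proof.
move=> q0; rewrite /= /taylor_coef; set r := _ - _.
have /divpK e : ('X - 0%:P) %| r.
  by rewrite dvdp_XsubCl /root /r !hornerE divfK // subrr.
have ez : (r %/ ('X - 0%:P)).[z] * z = r.[z].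
  by rewrite -[in RHS]e hornerM hornerXsubC; congr (_ * _); rewrite subr0.
by rewrite mulrC ez /r !hornerE.
Qed.

Lemma taylor_expansion p q n z : q.[0] != 0 -> q.[z] != 0 ->
  p.[z] / q.[z] = \sum_(i < n) taylor_coef p q i * z ^+ i +
    z ^+ n * ((taylor_num p q n).[z] / q.[z]).
Proof.
move=> q0 qz; elim: n => [|n IH]; first by rewrite big_ord0 add0r mul1r.
rewrite big_ord_recr {}IH -addrA; congr (_ + _).
rewrite exprSr -mulrA (mulrA z) (taylor_numS p n z q0).
move: (taylor_num p q n).[z] (taylor_coef p q n) => u c /=.
by field.
Qed.

End TaylorCoefficients.

Section TaylorBound.
Variable R : realType.
Implicit Types (p q : {poly R[i]}) (z w : R[i]) (s : seq (open_disc R)).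

Definition perforated_disc s z := normc z <= 1 /\ off_discs [set D | D \in s] z.

Definition contour_const (B : nat -> R) (j : nat) : R := 18 * 8 ^+ j + 162 * (2 ^+ j * B j).

Lemma cutoff_support s (h : R) z w : 0 < h -> h <= 1 / 8 ->
  (forall D, D \in s -> h <= Defs.radius D) ->
  normc (z - w) <= h -> box w * discs_cut s w != 0 -> perforated_disc s z.
Proof.
move=> h0 h8 hs zw; rewrite mulf_eq0 negb_or => /andP[bw cw].
have cm : coord_max w <= 1 / 2.
  by rewrite leNgt; apply: contra bw => cm; rewrite /box clamp_le0 //; lra.
have w34 : normc w <= 3 / 4.
  rewrite -[leRHS]ger0_norm // -(@ler_pXn2r _ 2) ?nnegrE ?normc_ge0 // normc_sqr.
  move: cm; rewrite /coord_max ge_max !ler_norml => /andP[/andP[? ?] /andP[? ?]].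
  by rewrite ger0_norm //; nra.
split; first by have := ler_normc_dist w z 0; rewrite !subr0; lra.
move=> D Ds; rewrite leNgt; apply: contra cw => zD.
rewrite /discs_cut (big_rem D) //= disc_cut0 ?mul0r //.
by have := ler_normc_dist z w (Defs.center D : R[i]); rewrite (normcB w z); have := hs D Ds; lra.
Qed.

Lemma cutoff_near0 s (h : R) z w : 0 < h -> h <= 1 / 8 ->
  (forall D, D \in s -> h <= Defs.radius D /\ far_disc D) ->
  normc (z - w) <= h -> box z * discs_cut s z != box w * discs_cut s w -> z != 0.
Proof.
move=> h0 h8 hs zw; apply: contraNneq => z0; apply/eqP.
have wh : normc w <= h by rewrite -(normc_opp w) -sub0r -z0.
have box1 (u : R[i]) : normc u <= h -> box u = 1.
  by move=> uh; rewrite /box clamp_ge1 //; have := coord_max_le u; lra.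
have cut1 (u : R[i]) : normc u <= h -> discs_cut s u = 1.
  move=> uh; rewrite /discs_cut big1_seq // => D /andP[_ Ds]; apply: disc_cut1.
  have [hr] := hs D Ds; rewrite /far_disc => Dfar.
  by have := lerB_normc (Defs.center D : R[i]) u; rewrite (normcB _ u); lra.
by rewrite !box1 ?cut1 // z0 normc0 ltW.
Qed.

Lemma taylor_bound_step s p q m (S k : R) (B C : nat -> R) :
  (forall D, D \in s -> Defs.radius D <= 1 / 4 /\ far_disc D) ->
  (forall j, \sum_(D <- s) Defs.radius D / normc (Defs.center D : R[i]) ^+ j <= B j) ->
  B 1%N <= 1 / 2592 -> 0 < k -> 0 <= S -> q.[0] != 0 ->
  (forall z, perforated_disc s z -> k <= normc q.[z] /\ normc (p.[z] / q.[z]) <= S) ->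
  (forall i, (i < m)%N -> normc (taylor_coef p q i) <= C i * S) ->
  normc (taylor_coef p q m) <= 4 * (contour_const B m.+1 +
    \sum_(i < m) C i * contour_const B (m.+1 - i)) * S.
Proof.
move=> sP sB B1 k0 S0 q0 qS cC.
set K := contour_const B.
have E1 z : perforated_disc s z -> normc z <= 1 by case.
have q0E z : perforated_disc s z -> q.[z] != 0.
  by move=> /qS[kq _]; rewrite -normc_gt0 (lt_le_trans k0).
pose F z := (taylor_num p q m.+1).[z] * (q.[z])^-1.
have [M M0 FM] : exists2 M : R, 0 <= M & forall z (h : R), 0 <= h ->
    perforated_disc s z -> perforated_disc s (z + h%:C) ->
    perforated_disc s (z + 'i%C * h%:C) ->
    normc (F (z + h%:C) - F z + 'i%C * (F (z + 'i%C * h%:C) - F z)) <= M * h ^+ 2.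
  apply: (@smooth_cauchy_riemann _ (perforated_disc s)).
  apply: smoothM => //; first exact: smooth_poly.
  by apply: (smoothV E1 k0) => [z /qS[]|]; last exact: smooth_poly.
have sB2 j : \sum_(D <- s) (Defs.radius D * (2 / normc (Defs.center D : R[i])) ^+ j)
    <= 2 ^+ j * B j.
  apply: le_trans (ler_wpM2l _ (sB j)); last by rewrite exprn_ge0.
  rewrite mulr_sumr; apply: ler_sum => D _; rewrite expr_div_n.
  by rewrite mulrCA mulrA.
have main (N : nat) (h : R) : (0 < N)%N -> h * (4 * N)%:R = 1 -> h <= 1 / 8 ->
    (forall D, D \in s -> h <= Defs.radius D) ->
    normc (taylor_coef p q m) / 4 <=
      S * K m.+1 + \sum_(i < m) C i * S * K (m.+1 - i)%N + M * (9 / 4) * h.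
  move=> N0 hN h8 hs.
  have h0 : 0 < h by rewrite -(@pmulr_lgt0 _ (4 * N)%:R) ?hN ?ltr0n //; lia.
  have hsf D : D \in s -> h <= Defs.radius D /\ far_disc D.
    by move=> Ds; split; [exact: hs|case: (sP D Ds)].
  pose phi z := box z * discs_cut s z.
  have suppz z w : normc (z - w) <= h -> phi z != phi w -> perforated_disc s z.
    move=> zw ne; have [w0|w0] := eqVneq (phi w) 0.
      by apply: (@cutoff_support s h z z) => //; [rewrite subrr normc0 ltW|rewrite -w0].
    exact: (@cutoff_support s h z w).
  have phi_diff := fun j => fun z w zw => @cutoff_diff R h j s z w h0 h8 hsf zw.
  have bound (G : R[i] -> R[i]) j (b : R) : 0 <= b ->
      (forall z, perforated_disc s z -> normc (G z) <= b * (normc z)^-1 ^+ j) ->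
      normc (contour h N phi G) <= b * K j.
    move=> b0 Gb; apply: le_trans (@contour_bound R h N N0 hN phi G s j b 4 1 b0 _ _ _ _ _) _ => //.
    - by move=> z w zw /(suppz _ _ zw); exact: Gb.
    - by move=> z w zw; rewrite mul1r; exact: phi_diff.
    rewrite ler_wpM2l // /K /contour_const mul1r (_ : 4 * (9 / 2) = 18); last by field.
    by rewrite lerD2l ler_wpM2l.
  pose P z := p.[z] / q.[z] * z^-1 ^+ m.+1.
  have PE : contour h N phi P = contour h N phi (fun z =>
      \sum_(i < m.+1) taylor_coef p q i * z^-1 ^+ (m.+1 - i) + F z).
    apply: (contour_ext N0 hN) => z w zw ne.
    have qz := q0E z (suppz _ _ zw ne).
    have z0 : z != 0 by exact: cutoff_near0 hsf zw ne.
    rewrite /P (taylor_expansion p m.+1 q0 qz) mulrDl mulr_suml; congr (_ + _).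
      apply: eq_bigr => i _; rewrite -mulrA; congr (_ * _).
      by rewrite !exprVn expfB // invf_div.
    by rewrite exprVn mulrC mulKf // expf_neq0.
  have Fc : normc (contour h N phi F) <= M * (9 / 4) * h.
    apply: (contour_holomorphic N0 hN M0).
    - by move=> z z2; rewrite /phi /box clamp_le0 ?mul0r //; lra.
    - move=> z; have /andP[b0 b1] := box01 z; have /andP[c0 c1] := discs_cut01 s z.
      by rewrite mulr_ge0 //= mulr_ile1.
    move=> z ne; have supp w : normc (w - z) <= h -> perforated_disc s w.
      by move=> wz; apply: cutoff_support wz ne.
    apply: FM; [exact: ltW|apply: supp..].
    - by rewrite subrr normc0 ltW.
    - by rewrite addrAC subrr add0r normc_real gtr0_norm.
    - by rewrite addrAC subrr add0r normcM normc_i mul1r normc_real gtr0_norm.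
  have inv1 : 1 / 4 <= normc (contour h N phi (fun z => z^-1)).
    have box_c := contour_box_inv N0 hN.
    pose psi z := box z * (1 - discs_cut s z).
    have -> : phi = fun z => box z - psi z.
      by apply/funext => z; rewrite /phi /psi; ring.
    rewrite contour_cutB.
    have psi_c : normc (contour h N psi (fun z => z^-1)) <= 1 / 4.
      apply: le_trans (@contour_bound R h N N0 hN psi (fun z => z^-1) s 1 1 0 2
        ler01 (lexx 0) (ler0n R 2) hs _ _) _.
      - by move=> z w _ _; rewrite mul1r expr1 normcV.
      - move=> z w zw; rewrite !mul0r add0r.
        apply: cutoff_compl_diff => // D Ds.
        by have [? ?] := sP D Ds; split=> //; exact: hs.
      rewrite !mul0r add0r mul1r; have := sB2 1%N; rewrite expr1.
      by move: (\sum_(D <- s) _) => x; lra.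
    have := lerB_normc (contour h N (@box R) (fun z => z^-1)) (contour h N psi (fun z => z^-1)).
    lra.
  have Pc : normc (contour h N phi P) <= S * K m.+1.
    apply: bound => // z Ez; rewrite /P normcM normcX normcV.
    by rewrite ler_wpM2r ?exprn_ge0 ?invr_ge0 ?normc_ge0 //; case: (qS z Ez).
  have cbound j : normc (contour h N phi (fun z => z^-1 ^+ j)) <= K j.
    rewrite -[K j]mul1r; apply: bound => // z _.
    by rewrite mul1r normcX normcV.
  move: PE; rewrite contourD (@contour_sum R h N phi m.+1
    (fun i z => taylor_coef p q i * z^-1 ^+ (m.+1 - i))) big_ord_recr /=.
  have contour_c i : contour h N phi (fun z => taylor_coef p q i * z^-1 ^+ (m.+1 - i)) =
      taylor_coef p q i * contour h N phi (fun z => z^-1 ^+ (m.+1 - i)).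
    exact: contourZ.
  under eq_bigr => i _ do rewrite contour_c.
  rewrite contour_c subSnn.
  rewrite (_ : (fun z : R[i] => z^-1 ^+ 1) = fun z => z^-1); last first.
    by apply/funext => z; rewrite expr1.
  set I1 := contour _ _ _ (fun z => z^-1) in inv1 *.
  set sm := \sum_(i < m) _ => PE.
  have smb : normc sm <= \sum_(i < m) C i * S * K (m.+1 - i)%N.
    apply: (le_trans (ler_normc_sum _ _ _)); apply: ler_sum => i _.
    by rewrite normcM ler_pM ?normc_ge0 ?cC.
  have cI : taylor_coef p q m * I1 = contour h N phi P - sm - contour h N phi F.
    by rewrite PE; ring.
  apply: (@le_trans _ _ (normc (taylor_coef p q m * I1))).
    rewrite [normc (_ * I1)]normcM; apply: ler_wpM2l; first exact: normc_ge0.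
    by move: inv1; rewrite mul1r.
  rewrite cI; apply: (le_trans (ler_normcB _ _)).
  by rewrite lerD // (le_trans (ler_normcB _ _)) // lerD.
have lim : normc (taylor_coef p q m) / 4 <=
    S * K m.+1 + \sum_(i < m) C i * S * K (m.+1 - i)%N.
  apply/ler_addgt0Pr => e e0.
  have [t t0 tP] : exists2 t : R, 0 < t & forall h, h <= t ->
      [/\ h <= 1 / 8, forall D, D \in s -> h <= Defs.radius D & M * (9 / 4) * h <= e].
    have [t t0 ts] : exists2 t : R, 0 < t & forall D, D \in s -> t <= Defs.radius D.
      elim: (s) => [|D s' [t t0 IH]]; first by exists 1.
      exists (Num.min t (Defs.radius D)); first by rewrite lt_min t0 radius_gt0.
      move=> D'; rewrite inE => /orP[/eqP ->|/IH tD']; rewrite ge_min ?lexx ?orbT //.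
      by rewrite tD'.
    have M94 : 0 < M * (9 / 4) + 1 by rewrite ltr_wpDl // mulr_ge0.
    exists (Num.min (1 / 8) (Num.min t (e / (M * (9 / 4) + 1)))).
      by rewrite !lt_min t0 (divr_gt0 e0 M94) !andbT; lra.
    move=> h; rewrite !le_min => /and3P[h8 ht he]; split => //.
      by move=> D /ts; exact: le_trans.
    rewrite ler_pdivlMr // in he; rewrite mulrC; case: (leP 0 h) => h0.
      by apply: le_trans he; rewrite ler_wpM2l // lerDl.
    by rewrite (le_trans _ (ltW e0)) // mulr_le0_ge0 ?(ltW h0) // mulr_ge0.
  pose N := (Num.Def.archi_bound t^-1).+1.
  pose h : R := (4 * N)%:R^-1.
  have N4 : 0 < (4 * N)%:R :> R by rewrite ltr0n.
  have ht : h <= t.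
    rewrite invf_ple ?posrE //; apply: ltW.
    apply: (lt_le_trans (archi_boundP _)); first by rewrite invr_ge0 ltW.
    by rewrite ler_nat /N; move: (Num.Def.archi_bound _) => b; clear; lia.
  have [h8 hs he] := tP h ht.
  have hN : h * (4 * N)%:R = 1 by rewrite mulVf // gt_eqF.
  by apply: (le_trans (main N h (ltn0Sn _) hN h8 hs)); rewrite lerD2l.
move: lim; rewrite ler_pdivrMr // => /le_trans; apply.
rewrite le_eqVlt; apply/orP; left; apply/eqP.
have -> : \sum_(i < m) C i * S * K (m.+1 - i)%N =
    (\sum_(i < m) C i * K (m.+1 - i)%N) * S.
  by rewrite mulr_suml; apply: eq_bigr => i _; ring.
by ring.
Qed.

End TaylorBound.

(** * The plane, compactness and uniform closures *)

Section PlaneTopology.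
Variable R : realType.
Local Notation C := R[i]^o.
Implicit Types (z w : C).

Lemma nbhs_normcP z (A : set C) :
  nbhs z A <-> exists2 e : R, 0 < e & forall w, normc (w - z) < e -> A w.
Proof.
rewrite -nbhs_ballE; split => [[e /= e0 eA]|[e e0 eA]].
  have [e' eE] : exists e', e = e'%:C by apply/complex_realP; exact: gtr0_real.
  rewrite eE ltcR in e0; exists e' => // w wz; apply: eA.
  by rewrite -ball_normE /= eE normcE ltcR normcB.
exists e%:C; rewrite /= ?ltcR // => w.
by rewrite -ball_normE /= normcE ltcR normcB => /eA.
Qed.

Lemma open_disc_open (D : open_disc R) : open (disc_set D).
Proof.
rewrite openE => z; rewrite disc_setE => zD; apply/nbhs_normcP.
exists (Defs.radius D - normc (z - (Defs.center D : R[i]))); first by rewrite subr_gt0.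
move=> w wz; rewrite disc_setE.
by have := ler_normc_dist z w (Defs.center D : R[i]); lra.
Qed.

Lemma compact_unit_disc : compact [set z : C | normc z <= 1].
Proof.
pose f (xy : R * R) : C := (xy.1 +i* xy.2)%C.
have cf : continuous f.
  move=> [x y] A /nbhs_normcP[e e0 eA].
  have e2 : 0 < e / 2 by rewrite divr_gt0.
  exists (ball x (e / 2), ball y (e / 2)) => /=.
    by split; exact: nbhsx_ballx.
  move=> [x' y'] /= [xx' yy']; apply: eA.
  apply: (le_lt_trans (ler_normc_ReIm _)) => /=.
  move: xx' yy'; rewrite /ball /= distrC (distrC y); lra.
have cI : compact (f @` (`[-1, 1]%classic `*` `[-1, 1]%classic)).
  apply: continuous_compact; first exact: continuous_subspaceT.
  by apply: compact_setX; exact: segment_compact.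
apply: (subclosed_compact _ cI).
  rewrite -openC openE => z /= z1; apply/nbhs_normcP.
  move/negP: z1; rewrite -ltNge => z1.
  exists (normc z - 1); first by rewrite subr_gt0.
  move=> w wz /= w1; have := lerB_normc z w; rewrite normcB in wz; lra.
move=> z /= z1; exists (complex.Re z, complex.Im z); last by case: (z).
have := ler_Re z; have := ler_Im z; rewrite /= !in_itv /= !ler_norml.
by move=> /andP[? ?] /andP[? ?]; split; apply/andP; split; lra.
Qed.

Section Subset.
Variable K : set C.
Implicit Types (x y : set_type K) (f g : set_type K -> C) (A : set (set_type K -> C)).

Lemma nbhs_set_typeP x (P : set (set_type K)) :
  nbhs x P <-> exists2 e : R, 0 < e &
    forall y, normc ((set_val y : R[i]) - set_val x) < e -> P y.
Proof.
split=> [[U [[V oV VU] Ux UP]]|[e e0 eP]].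
  rewrite -VU in Ux UP.
  have /nbhs_normcP[e e0 eV] : nbhs (set_val x : C) V by exact: open_nbhs_nbhs.
  by exists e => // y yx; apply: UP; exact: eV.
exists (set_val @^-1` (interior [set w : C | normc (w - set_val x) < e])); split.
- by exists (interior [set w : C | normc (w - set_val x) < e]) => //; exact: open_interior.
- by apply/nbhs_normcP; exists e.
- by move=> y /interior_subset; exact: eP.
Qed.

Lemma continuous_set_typeP f : continuous f <-> forall x (e : R), 0 < e ->
  exists2 d : R, 0 < d & forall y, normc ((set_val y : R[i]) - set_val x) < d ->
    normc ((f y : R[i]) - f x) < e.
Proof.
split=> [cf x e e0|cf x A /nbhs_normcP[e e0 eA]].
  have /cf /nbhs_set_typeP[d d0 dP] : nbhs (f x) [set w : C | normc (w - f x) < e].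
    by apply/nbhs_normcP; exists e.
  by exists d.
have [d d0 dP] := cf x e e0; apply/nbhs_set_typeP.
by exists d => // y /dP; exact: eA.
Qed.

Lemma uniform_closureP A f : uniform_closure A f <->
  forall e : R, 0 < e -> exists2 g, A g & forall x, normc ((f x : R[i]) - g x) <= e.
Proof.
split=> [fA e e0|fA U /uniform_nbhs[E [entE EU]]].
  have [|g [Ag fg]] := fA [set g : {uniform (set_type K) -> C} |
      forall x, normc ((f x : R[i]) - g x) < e].
    apply/uniform_nbhs; exists [set xy : C * C | ball xy.1 e%:C xy.2]; split.
      by rewrite -entourage_ballE; exists e%:C => //=; rewrite ltcR.
    move=> g fg x; have := fg x I; rewrite -ball_normE /= normcE ltcR.
    by [].
  by exists g => // x; exact/ltW.
move: entE; rewrite -entourage_ballE => -[e /= e0 eE].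
have [e' eC] : exists e', e = e'%:C by apply/complex_realP; exact: gtr0_real.
rewrite eC ltcR in e0.
have [|g Ag fg] := fA (e' / 2); first by rewrite divr_gt0.
exists g; split => //; apply: EU => x _; apply: eE => /=.
rewrite -ball_normE /= normcE eC ltcR; apply: le_lt_trans (fg x) _; lra.
Qed.

End Subset.
End PlaneTopology.

(** * The algebra R(K) *)

Section RationalAlgebra.
Variable R : realType.
Local Notation C := R[i]^o.

Lemma compact_finite_balls (K : set C) (r : C -> R) : compact K ->
  (forall z, K z -> 0 < r z) -> exists s : seq C,
    (forall z, z \in s -> K z) /\
    forall w, K w -> exists2 z, z \in s & normc ((w : R[i]) - z) < r z.
Proof.
rewrite compact_cover => cK r0.
have [|z Kz|D DK KD] := cK _ K (fun z => [set w : C | normc ((w : R[i]) - z) < r z]).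
- move=> z _; rewrite openE => w /= wz; apply/nbhs_normcP.
  exists (r z - normc ((w : R[i]) - z)); first by rewrite subr_gt0.
  by move=> v vw /=; have := @ler_normc_dist R w v z; lra.
- by exists z; rewrite /= ?subrr ?normc0 ?r0.
exists (finmap.enum_fset D); split=> [z zD|w /KD[z zD wz]]; last by exists z.
by have := DK z zD; rewrite inE.
Qed.

Variable K : set C.
Hypothesis cK : compact K.
Local Notation X := (set_type K).
Local Notation A := (rational_algebra K).
Local Notation val x := (set_val x : R[i]).
Implicit Types (x y : X) (f g : X -> C).

Lemma set_val_mem x : K (set_val x).
Proof. by have := set_valP x. Qed.

Lemma continuous_bounded f : continuous f ->
  exists2 B : R, 0 <= B & forall x, normc (f x : R[i]) <= B.
Proof.
move=> /continuous_set_typeP cf.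
have loc z : exists rB : R * R, K z -> 0 < rB.1 /\
    forall y, normc (val y - z) < rB.1 -> normc (f y : R[i]) <= rB.2.
  have [Kz|] := pselect (K z); last by exists (0, 0).
  have [d d0 dP] := cf (exist _ z (mem_set Kz)) 1 ltr01.
  exists (d, normc (f (exist _ z (mem_set Kz)) : R[i]) + 1) => _; split => // y yz.
  have := dP y yz.
  by have := @lerB_normc R (f y) (f (exist _ z (mem_set Kz))); rewrite /=; lra.
have [rB rBP] := choice loc.
have [|s [sK Ks]] := @compact_finite_balls K (fun z => (rB z).1) cK.
  by move=> z /rBP[].
exists (\sum_(z <- s) `|(rB z).2|) => [|x]; first by rewrite sumr_ge0.
have [z zs xz] := Ks _ (set_val_mem x).
have [_ /(_ x xz) fx] := rBP z (sK z zs).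
rewrite (big_rem z) //=; apply: (le_trans fx); apply: (le_trans (ler_norm _)).
by rewrite lerDl sumr_ge0.
Qed.

Lemma continuous_horner_on (p : {poly R[i]}) x (e : R) : 0 < e ->
  exists2 d : R, 0 < d & forall y, normc (val y - val x) < d ->
    normc (p.[val y] - p.[val x]) < e.
Proof.
elim/poly_ind: p e => [|p c IH] e e0.
  by exists 1 => // y _; rewrite !horner0 subrr normc0.
pose P := normc p.[val x]; pose z := normc (val x).
have P0 : 0 <= P by exact: normc_ge0.
have z0 : 0 <= z by exact: normc_ge0.
have t0 : 0 < e / (2 * (z + 1)) by rewrite divr_gt0 ?mulr_gt0 //; lra.
have [d d0 dP] := IH _ t0.
have u0 : 0 < e / (2 * (P + e / (2 * (z + 1)))).
  by rewrite divr_gt0 ?mulr_gt0 //; lra.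
exists (Num.min d (Num.min 1 (e / (2 * (P + e / (2 * (z + 1))))))).
  by rewrite !lt_min d0 u0 ltr01.
move=> y; rewrite !lt_min => /and3P[yd y1 yu].
rewrite !hornerMXaddC.
have -> : p.[val y] * val y + c - (p.[val x] * val x + c) =
  (p.[val y] - p.[val x]) * val x + p.[val y] * (val y - val x) by ring.
apply: (le_lt_trans (ler_normcD _ _)); rewrite !normcM -/z.
have py := dP y yd.
have pyP : normc p.[val y] <= P + e / (2 * (z + 1)).
  by have := lerB_normc p.[val y] p.[val x]; rewrite -/P; lra.
have h1 : normc (p.[val y] - p.[val x]) * z <= e / 2.
  apply: (@le_trans _ _ (e / (2 * (z + 1)) * z)); first by rewrite ler_wpM2r // ltW.
  have : e / (2 * (z + 1)) * z + e / (2 * (z + 1)) = e / 2.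
    by field; rewrite gt_eqF //; lra.
  lra.
set Q := P + _ in pyP yu u0.
have Q0 : 0 < Q by rewrite ltr_wpDl.
have h2 : normc p.[val y] * normc (val y - val x) < e / 2.
  apply: (@le_lt_trans _ _ (Q * normc (val y - val x))).
    by rewrite ler_wpM2r ?normc_ge0.
  rewrite mulrC -ltr_pdivlMr // (_ : e / 2 / Q = e / (2 * Q)) //.
  by field; rewrite gt_eqF.
lra.
Qed.

Lemma rational_continuous f : rational_functions f -> continuous f.
Proof.
move=> [p [q fpq]]; apply/continuous_set_typeP => x e e0.
have [qx fx] := fpq x; pose Q := normc q.[val x]; pose P := normc p.[val x].
have Q0 : 0 < Q by rewrite normc_gt0.
have P0 : 0 <= P by exact: normc_ge0.
have t0 : 0 < e * Q * Q / (2 * (P + Q)) by rewrite divr_gt0 ?mulr_gt0 //; lra.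
have [d d0 dP] := continuous_horner_on p x t0.
pose u := Num.min (e * Q * Q / (2 * (P + Q))) (Q / 2).
have [|d' d'0 d'P] := @continuous_horner_on q x u.
  by rewrite lt_min t0 divr_gt0.
exists (Num.min d d'); first by rewrite lt_min d0.
move=> y; rewrite lt_min => /andP[yd yd'].
have [qy fy] := fpq y; have py := dP y yd; have := d'P y yd'.
rewrite lt_min => /andP[qy1 qy2].
have qQ : Q / 2 < normc q.[val y].
  by have := lerB_normc q.[val x] q.[val y]; rewrite [normc (_ - q.[val y])]normcB -/Q; lra.
have -> : (f y : R[i]) - f x = ((p.[val y] - p.[val x]) * q.[val x] -
    p.[val x] * (q.[val y] - q.[val x])) / (q.[val y] * q.[val x]).
  by rewrite fy fx; field; rewrite qx qy.
rewrite normc_div normcM -/Q ltr_pdivrMr; last by rewrite mulr_gt0 //; lra.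
apply: (le_lt_trans (ler_normcB _ _)); rewrite !normcM -/P -/Q.
set T := e * Q * Q / (2 * (P + Q)) in t0 py qy1 *.
apply: (@lt_le_trans _ _ (T * Q + P * T)).
  by rewrite ltr_leD ?ltr_pM2r // ler_wpM2l // ltW.
have -> : T * Q + P * T = e * (Q / 2) * Q.
  by rewrite /T; field; rewrite gt_eqF //; lra.
by rewrite -mulrA ler_pM2l // ler_pM2r // ltW.
Qed.

Lemma alg_lim f : (forall e : R, 0 < e -> exists2 g, A g &
  forall x, normc ((f x : R[i]) - g x) <= e) -> A f.
Proof.
move=> fA; apply/uniform_closureP => e e0.
have e2 : 0 < e / 2 by rewrite divr_gt0.
have [g /uniform_closureP/(_ _ e2)[r rr gr] fg] := fA _ e2.
exists r => // x; apply: (le_trans (@ler_normc_dist R (g x) _ _)).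
by have := fg x; have := gr x; lra.
Qed.

Lemma alg_rational f : rational_functions f -> A f.
Proof.
by move=> fr; apply/uniform_closureP => e e0; exists f => // x; rewrite subrr normc0 ltW.
Qed.

Lemma alg_continuous f : A f -> continuous f.
Proof.
move=> /uniform_closureP fA; apply/continuous_set_typeP => x e e0.
have [|g /rational_continuous/continuous_set_typeP cg fg] := fA (e / 4).
  by rewrite divr_gt0.
have [|d d0 dP] := cg x (e / 4); first by rewrite divr_gt0.
exists d => // y /dP yx.
have := @ler_normc_dist R (g y) (f y) (f x).
have := @ler_normc_dist R (g x) (g y) (f x).
by have := fg x; have := fg y; rewrite [normc (g x - f x)]normcB; lra.
Qed.

Lemma alg_bounded f : A f -> exists2 B : R, 0 <= B & forall x, normc (f x : R[i]) <= B.
Proof. by move=> /alg_continuous; exact: continuous_bounded. Qed.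

Lemma rational_functionsD f g : rational_functions f -> rational_functions g ->
  rational_functions (fun x => f x + g x).
Proof.
move=> [p [q fpq]] [p' [q' gpq]]; exists (p * q' + p' * q), (q * q') => x.
have [q0 ->] := fpq x; have [q'0 ->] := gpq x.
rewrite hornerD !hornerM mulf_neq0 //; split => //.
by field; rewrite q0 q'0.
Qed.

Lemma rational_functionsM f g : rational_functions f -> rational_functions g ->
  rational_functions (fun x => f x * g x).
Proof.
move=> [p [q fpq]] [p' [q' gpq]]; exists (p * p'), (q * q') => x.
have [q0 ->] := fpq x; have [q'0 ->] := gpq x.
rewrite !hornerM mulf_neq0 //; split => //.
by field; rewrite q0 q'0.
Qed.

Lemma rational_functions_poly (p : {poly R[i]}) :
  rational_functions (fun x => p.[val x] : C).
Proof. by exists p, 1 => x; rewrite hornerC oner_neq0 divr1. Qed.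

Lemma alg_poly (p : {poly R[i]}) : A (fun x => p.[val x] : C).
Proof. exact/alg_rational/rational_functions_poly. Qed.

Lemma alg_cst (c : C) : A (fun=> c).
Proof.
rewrite (_ : (fun=> c) = fun x => (c%:P).[val x] : C); first exact: alg_poly.
by apply/funext => x; rewrite hornerC.
Qed.

Lemma alg_id : A (fun x => set_val x).
Proof.
rewrite (_ : (fun x => set_val x) = fun x => ('X).[val x] : C); first exact: alg_poly.
by apply/funext => x; rewrite hornerX.
Qed.

Lemma algD f g : A f -> A g -> A (fun x => f x + g x).
Proof.
move=> /uniform_closureP fA /uniform_closureP gA; apply/uniform_closureP => e e0.
have e2 : 0 < e / 2 by rewrite divr_gt0.
have [r rr fr] := fA _ e2; have [r' rr' gr] := gA _ e2.
exists (fun x => r x + r' x); first exact: rational_functionsD.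
move=> x; have -> : (f x + g x : R[i]) - (r x + r' x) = (f x - r x) + (g x - r' x) by ring.
by apply: (le_trans (ler_normcD _ _)); have := fr x; have := gr x; lra.
Qed.

Lemma algM f g : A f -> A g -> A (fun x => f x * g x).
Proof.
move=> fA gA; have [B B0 fB] := alg_bounded fA; have [B' B'0 gB] := alg_bounded gA.
move: fA gA => /uniform_closureP fA /uniform_closureP gA.
apply/uniform_closureP => e e0.
have BB : 0 < B + B' + 1 by lra.
pose t := Num.min 1 (e / (B + B' + 1)).
have t0 : 0 < t by rewrite lt_min ltr01 divr_gt0.
have t1 : t <= 1 by rewrite ge_min lexx.
have te : t * (B + B' + 1) <= e by rewrite -ler_pdivlMr // ge_min lexx orbT.
have [r rr fr] := fA _ t0; have [r' rr' gr] := gA _ t0.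
exists (fun x => r x * r' x); first exact: rational_functionsM.
move=> x; have -> : (f x * g x : R[i]) - r x * r' x =
  f x * (g x - r' x) + g x * (f x - r x) - (f x - r x) * (g x - r' x) by ring.
have h1 := ler_pM (normc_ge0 _) (normc_ge0 _) (fB x) (gr x).
have h2 := ler_pM (normc_ge0 _) (normc_ge0 _) (gB x) (fr x).
have h3 := ler_pM (normc_ge0 _) (normc_ge0 _) (fr x) (gr x).
rewrite -!normcM in h1 h2 h3.
apply: (le_trans (ler_normcB _ _)); apply: (le_trans (lerD (ler_normcD _ _) (lexx _))).
have tt : t * t <= t by rewrite ler_piMl // ltW.
lra.
Qed.

Lemma algZ (c : C) f : A f -> A (fun x => c * f x).
Proof. by move=> fA; apply: algM => //; exact: alg_cst. Qed.

Lemma algN f : A f -> A (fun x => - f x).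
Proof.
move=> fA; rewrite (_ : (fun x => - f x) = fun x => -1 * f x); first exact: algZ.
by apply/funext => x; rewrite mulN1r.
Qed.

Lemma algB f g : A f -> A g -> A (fun x => f x - g x).
Proof. by move=> fA gA; apply: algD => //; exact: algN. Qed.

Lemma algX f n : A f -> A (fun x => f x ^+ n).
Proof.
move=> fA; elim: n => [|n IH]; first exact: alg_cst.
rewrite (_ : (fun x => f x ^+ n.+1) = fun x => f x * f x ^+ n); first exact: algM.
by apply/funext => x; rewrite exprS.
Qed.

Lemma alg_prod (I : Type) (s : seq I) (F : I -> X -> C) :
  (forall i, A (F i)) -> A (fun x => \prod_(i <- s) F i x).
Proof.
move=> FA; elim: s => [|i s IH].
  rewrite (_ : (fun x => _) = fun=> 1); first exact: alg_cst.
  by apply/funext => x; rewrite big_nil.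
rewrite (_ : (fun x => _) = fun x => F i x * \prod_(j <- s) F j x); first exact: algM.
by apply/funext => x; rewrite big_cons.
Qed.

Lemma alg_inv_sub (a : R[i]) : ~ K a -> A (fun x => (val x - a)^-1 : C).
Proof.
move=> nKa; apply: alg_rational; exists 1, ('X - a%:P) => x.
rewrite hornerXsubC hornerC mul1r; split => //; rewrite subr_eq0.
by apply: contra_not_neq nKa => <-; exact: set_val_mem.
Qed.

(* Neumann series. *)
Lemma alg_inv1B f (r : R) : 0 <= r < 1 -> A f -> (forall x, normc (f x : R[i]) <= r) ->
  A (fun x => (1 - f x)^-1).
Proof.
move=> /andP[r0 r1] fA fr; have q0 : 0 < 1 - r by rewrite subr_gt0.
have f1 x : 1 - r <= normc (1 - (f x : R[i])).
  by have := lerB_normc 1 (f x : R[i]); rewrite normc1; have := fr x; lra.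
have f10 x : 1 - (f x : R[i]) != 0 by rewrite -normc_gt0 (lt_le_trans q0).
have sumA n : A (fun x => \sum_(i < n) f x ^+ i).
  elim: n => [|n IH].
    rewrite (_ : (fun x => _) = fun=> 0); first exact: alg_cst.
    by apply/funext => x; rewrite big_ord0.
  rewrite (_ : (fun x => _) = fun x => \sum_(i < n) f x ^+ i + f x ^+ n).
    by apply: algD => //; exact: algX.
  by apply/funext => x; rewrite big_ord_recr.
apply: alg_lim => e e0.
have [n nP] : exists n, r ^+ n <= e * (1 - r).
  have /cvg_expr/cvgrPdist_le/(_ (e * (1 - r))) : `|r| < 1 by rewrite ger0_norm.
  rewrite mulr_gt0 // => /(_ isT)[n _ /(_ n (leqnn n))] /=.
  by rewrite sub0r normrN ger0_norm ?exprn_ge0 //; exists n.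
exists (fun x => \sum_(i < n) f x ^+ i) => // x.
have -> : (1 - (f x : R[i]))^-1 - \sum_(i < n) f x ^+ i = f x ^+ n / (1 - f x).
  apply: (mulIf (f10 x)); rewrite mulrBl mulVf // divfK //.
  by rewrite -[RHS](subrK 1) subrX1; ring.
rewrite normc_div normcX ler_pdivrMr ?(lt_le_trans q0) //.
apply: (@le_trans _ _ (r ^+ n)); first by rewrite lerXn2r ?nnegrE ?normc_ge0.
by apply: (le_trans nP); rewrite ler_pM2l.
Qed.

End RationalAlgebra.

Section Structure.
Variable R : realType.
Local Notation C := R[i]^o.
Variable K : set C.
Hypothesis cK : compact K.
Local Notation X := (set_type K).
Local Notation A := (rational_algebra K).
Local Notation val x := (set_val x : R[i]).
Implicit Types (x y : X) (f g : X -> C).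

Lemma set_val_inj x y : set_val x = set_val y -> x = y.
Proof. by rewrite !set_valE => /val_inj. Qed.

Lemma evaluation_hom x : complex_homomorphism A (evaluation x).
Proof.
split=> //; exists (fun=> 1); first exact: alg_cst.
exact/eqP/oner_neq0.
Qed.

Lemma hom_of_point phi : complex_homomorphism A phi ->
  exists! x, forall f, A f -> phi f = evaluation x f.
Proof.
move=> [lin mult [f0 f0A /eqP f00]].
have phi1 : phi (fun=> 1) = 1.
  have := mult f0 (fun=> 1) f0A (@alg_cst R K 1).
  rewrite (_ : (fun x => f0 x * 1) = f0); last by apply/funext => x; rewrite mulr1.
  by move=> e; apply: (mulfI f00); rewrite mulr1.
have phiD f g : A f -> A g -> phi (fun x => f x + g x) = phi f + phi g.
  move=> fA gA; have := lin 1 f g fA gA; rewrite mul1r => <-; congr phi.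
  by apply/funext => x; rewrite mul1r.
have phi0 : phi (fun=> 0) = 0.
  have := phiD _ _ (@alg_cst R K 0) (@alg_cst R K 0).
  rewrite (_ : (fun x : X => 0 + 0) = fun=> 0); last by apply/funext => x; rewrite addr0.
  by move/eqP; rewrite -subr_eq subrr eq_sym => /eqP.
have phiZ (c : C) f : A f -> phi (fun x => c * f x) = c * phi f.
  move=> fA; have := lin c f (fun=> 0) fA (@alg_cst R K 0); rewrite phi0 addr0 => <-.
  by congr phi; apply/funext => x; rewrite addr0.
have phic c : phi (fun=> c) = c.
  have := phiZ c _ (@alg_cst R K 1); rewrite phi1 mulr1 => e; rewrite -[RHS]e.
  by congr phi; apply/funext => x; rewrite mulr1.
have phiB f g : A f -> A g -> phi (fun x => f x - g x) = phi f - phi g.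
  move=> fA gA; rewrite phiD //; last exact: (algN cK).
  congr (_ + _); rewrite -mulN1r -phiZ //; congr phi.
  by apply/funext => x; rewrite mulN1r.
pose a : R[i] := phi (fun x => set_val x).
have [x xa] : exists x, val x = a.
  have [Ka|nKa] := pselect (K a); first by exists (exist _ a (mem_set Ka)).
  have subA : A (fun x => val x - a : C) by apply: (algB cK); [exact: alg_id|exact: alg_cst].
  have := mult _ _ subA (alg_inv_sub nKa).
  rewrite (phiB _ _ (@alg_id R K) (@alg_cst R K a)) phic -/a subrr mul0r.
  rewrite (_ : (fun x => _) = fun=> 1); first by rewrite phi1 => /eqP; rewrite oner_eq0.
  apply/funext => x /=; rewrite divff // subr_eq0.
  by apply: contra_not_neq nKa => <-; exact: set_val_mem.
have phi_poly (p : {poly R[i]}) : phi (fun y => p.[val y] : C) = p.[a].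
  elim/poly_ind: p => [|p c IH].
    by rewrite horner0 -[RHS]phi0; congr phi; apply/funext => y; rewrite horner0.
  rewrite (_ : (fun y => _) = fun y => p.[val y] * set_val y + c); last first.
    by apply/funext => y; rewrite hornerMXaddC.
  have pA := @alg_poly R K p; have iA := @alg_id R K.
  by rewrite (phiD _ _ (algM cK pA iA) (@alg_cst R K c)) (mult _ _ pA iA) IH phic hornerMXaddC.
have phi_rat f : rational_functions f -> phi f = f x.
  move=> fr; have fA := alg_rational fr.
  have [p [q fpq]] := fr; have [qx ->] := fpq x.
  have := mult _ _ fA (@alg_poly R K q); rewrite phi_poly -xa.
  rewrite (_ : (fun y => _) = fun y => p.[val y]); last first.
    by apply/funext => y; have [qy ->] := fpq y; rewrite divfK.
  by rewrite phi_poly -xa => ->; rewrite mulfK.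
have phi_bound f (B : R) : 0 <= B -> A f -> (forall y, normc (f y : R[i]) <= B) ->
    normc (phi f : R[i]) <= B.
  move=> B0 fA fB; rewrite leNgt; apply/negP => Bphi.
  have l0 : 0 < normc (phi f : R[i]) by apply: le_lt_trans Bphi.
  have l0' : (phi f : R[i]) != 0 by rewrite -normc_gt0.
  have gA := @algZ R K cK (phi f)^-1 f fA.
  have invA : A (fun y => (1 - (phi f)^-1 * f y)^-1).
    apply: (@alg_inv1B _ K cK _ (B / normc (phi f : R[i]))) => // [|y].
      by rewrite divr_ge0 ?normc_ge0 //= ltr_pdivrMr // mul1r.
    by rewrite normcM normcV mulrC ler_pM2r ?invr_gt0.
  have subA : A (fun y => 1 - (phi f)^-1 * f y) by apply: (algB cK) => //; exact: alg_cst.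
  have := mult _ _ subA invA.
  rewrite (phiB _ _ (@alg_cst R K 1) gA) phi1 phiZ // mulVf // subrr mul0r.
  rewrite (_ : (fun y => _) = fun=> 1); first by rewrite phi1 => /eqP; rewrite oner_eq0.
  apply/funext => y; rewrite divff // subr_eq0.
  apply: contraTneq Bphi => e1; rewrite -leNgt.
  have -> : (phi f : R[i]) = f y by rewrite -[phi f]mulr1 e1 mulVKf.
  exact: fB.
exists x; split=> [f fA|x' x'P].
  apply/eqP; rewrite /evaluation -subr_eq0 -normc_eq0 eq_le normc_ge0 andbT.
  apply/ler_addgt0Pr => e e0; rewrite add0r.
  have e2 : 0 <= e / 2 by rewrite divr_ge0 // ltW.
  have [|r rr fr] := (uniform_closureP _ f).1 fA (e / 2); first by rewrite divr_gt0.
  have rA := alg_rational rr.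
  have := phi_bound _ _ e2 (algB cK fA rA) fr; rewrite phiB // (phi_rat _ rr) => h1.
  have := @ler_normc_dist R (r x) (phi f) (f x); have := fr x.
  by rewrite [normc (f x - r x)]normcB; lra.
apply: set_val_inj; have := x'P _ (@alg_id R K); rewrite /evaluation => <-.
by rewrite -/a -xa.
Qed.

Lemma rational_algebra_natural : natural A.
Proof. by split; [exact: evaluation_hom|exact: hom_of_point]. Qed.

Lemma rational_algebra_normal :
  (forall x (e : R), val x != 0 -> 0 < e -> exists2 chi, A chi &
    (exists2 d : R, 0 < d & forall y, normc (val y - val x) < d -> chi y = 1) /\
    (forall y, e <= normc (val y - val x) -> chi y = 0)) ->
  normal_algebra A.
Proof.
move=> cutoffs; split; first exact: rational_algebra_natural.
have sep (K0 K1 : set X) : closed K0 -> closed K1 -> K0 `&` K1 = set0 ->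
    (forall x, K1 x -> val x != 0) ->
    exists2 f, A f & (forall x, K1 x -> f x = 1) /\ (forall x, K0 x -> f x = 0).
  move=> cK0 cK1 K01 K1n0.
  have away (L : set X) x : closed L -> ~ L x ->
      exists2 d : R, 0 < d & forall y, L y -> d <= normc (val y - val x).
    move=> cL nLx; have := cL; rewrite -openC openE => /(_ x nLx) /nbhs_set_typeP[d d0 dP].
    exists d => // y Ly; rewrite leNgt; apply/negP => yd.
    exact: (dP y yd Ly).
  have loc (z : C) : exists dc : R * (X -> C), K z -> [/\ 0 < dc.1, A dc.2,
      forall y, K1 y -> normc (val y - z) < dc.1 -> dc.2 y = 1 &
      forall y, K0 y -> dc.2 y = 0].
    have [Kz|] := pselect (K z); last by exists (0, fun=> 0).
    pose x : X := exist _ z (mem_set Kz).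
    have [K1x|nK1x] := pselect (K1 x); last first.
      have [d d0 dP] := away K1 x cK1 nK1x.
      exists (d, fun=> 0) => _; split=> // [|y K1y]; first exact: alg_cst.
      by have := dP y K1y; rewrite /= leNgt => /negbTE ->.
    have nK0x : ~ K0 x by move=> K0x; have : (K0 `&` K1) x by []; rewrite K01.
    have [d d0 dP] := away K0 x cK0 nK0x.
    have [chi chiA [[d' d'0 d'P] chi0]] := cutoffs x d (K1n0 x K1x) d0.
    exists (d', chi) => _; split=> // [y _ /d'P//|y /dP /chi0//].
  have [dc dcP] := choice loc.
  have [|s [sK Ks]] := @compact_finite_balls R K (fun z => (dc z).1) cK.
    by move=> z /dcP[].
  pose F (z : C) : X -> C := if `[< K z >] then fun y => 1 - (dc z).2 y else fun=> 1.
  have FA z : A (F z).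
    rewrite /F; case: asboolP => [/dcP[_ dA _ _]|_]; last exact: alg_cst.
    by apply: (algB cK) => //; exact: alg_cst.
  exists (fun y => 1 - \prod_(z <- s) F z y).
    by apply: (algB cK); [exact: alg_cst|exact: (alg_prod cK)].
  split=> y Ky.
    have [z zs yz] := Ks _ (set_val_mem y).
    rewrite (big_rem z) //= /F; case: asboolP => [/dcP[_ _ d1 _]|]; last by case; exact: sK.
    by rewrite (d1 y Ky yz) subrr mul0r subr0.
  rewrite big1 ?subrr // => z _; rewrite /F; case: asboolP => // /dcP[_ _ _ d0].
  by rewrite d0 ?subr0.
move=> K0 K1 cK0 cK1 K01.
have [K1n0|] := pselect (forall x, K1 x -> val x != 0); first exact: sep.
move/existsNP => [u /not_implyP[K1u /negP]]; rewrite negbK => /eqP u0.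
have [|x K0x|f fA [f0 f1]] := sep K1 K0 cK1 cK0; first by rewrite setIC.
  apply/negP => /eqP x0; have : x = u by apply: set_val_inj; rewrite x0 u0.
  move=> xu; have : (K0 `&` K1) x by split=> //; rewrite xu.
  by rewrite K01.
exists (fun x => 1 - f x); first by apply: (algB cK) => //; exact: alg_cst.
by split=> x Kx; [rewrite f1 ?subr0|rewrite f0 ?subrr].
Qed.

Lemma J_ideal x f g : A g -> J_ A x f -> J_ A x (fun y => g y * f y).
Proof.
move=> gA [fA fx]; split; first exact: (algM cK).
by apply: filterS fx => y /= ->; rewrite mulr0.
Qed.

Lemma closureJ_ideal x f g : A g -> uniform_closure (J_ A x) f ->
  uniform_closure (J_ A x) (fun y => g y * f y).
Proof.
move=> gA /uniform_closureP fJ; apply/uniform_closureP => e e0.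
have [B B0 gB] := alg_bounded cK gA.
have [|u uJ fu] := fJ (e / (B + 1)); first by rewrite divr_gt0 //; lra.
exists (fun y => g y * u y); first exact: J_ideal.
move=> y; rewrite -mulrBr normcM.
apply: (@le_trans _ _ (B * (e / (B + 1)))); first by rewrite ler_pM ?normc_ge0.
rewrite mulrCA ler_piMr ?(ltW e0) // ler_pdivrMr; lra.
Qed.

Lemma closureJ_lim x f : (forall e : R, 0 < e -> exists2 g,
    uniform_closure (J_ A x) g & forall y, normc ((f y : R[i]) - g y) <= e) ->
  uniform_closure (J_ A x) f.
Proof.
move=> fJ; apply/uniform_closureP => e e0.
have e2 : 0 < e / 2 by rewrite divr_gt0.
have [g /uniform_closureP/(_ _ e2)[u uJ gu] fg] := fJ _ e2.
exists u => // y; apply: (le_trans (@ler_normc_dist R (g y) _ _)).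
by have := fg y; have := gu y; lra.
Qed.

(* The cutoffs put (z - x)^4 in the closure of J_x.  If (z - x)^(k+1) lies there, so does
   (z - x)^k up to an element of norm O(eps), namely a multiple of
   z - x + (z - x)^2 G. *)
Lemma rational_algebra_strongly_regular x :
  (forall z, K z -> normc (z : R[i]) <= 1) ->
  (forall e : R, 0 < e -> exists2 chi, A chi &
    (exists2 d : R, 0 < d & forall y, normc (val y - val x) < d -> chi y = 1) /\
    (forall y, normc (chi y : R[i]) * normc (val y - val x) ^+ 4 <= e)) ->
  (forall e : R, 0 < e -> exists2 G, A G & forall y,
    normc (val y - val x + (val y - val x) ^+ 2 * G y) <= e) ->
  strongly_regular_at A x.
Proof.
move=> K1 cutoffs deriv; pose I := uniform_closure (J_ A x).
pose T (y : X) : C := val y - val x.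
have TA : A T by apply: (algB cK); [exact: alg_id|exact: alg_cst].
have T2 y : normc (T y : R[i]) <= 2.
  apply: (le_trans (ler_normcB _ _)).
  by have := K1 _ (set_val_mem y); have := K1 _ (set_val_mem x); lra.
have T4I : I (fun y => T y ^+ 4).
  apply/uniform_closureP => e /cutoffs[chi chiA [[d d0 chi1] chie]].
  have oA : A (fun y => 1 - chi y) by apply: (algB cK) => //; exact: alg_cst.
  exists (fun y => (1 - chi y) * T y ^+ 4).
    split; first by apply: (algM cK) => //; exact: (algX cK).
    apply/nbhs_set_typeP; exists d => // y /chi1 /= ->.
    by rewrite subrr mul0r.
  move=> y; have -> : (T y ^+ 4 : R[i]) - (1 - chi y) * T y ^+ 4 = chi y * T y ^+ 4 by ring.
  by rewrite normcM normcX.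
have down k : I (fun y => T y ^+ k.+2) -> I (fun y => T y ^+ k.+1).
  move=> kI; apply: closureJ_lim => e e0.
  have [|G GA GP] := deriv (e / 2 ^+ k); first by rewrite divr_gt0 // exprn_gt0.
  exists (fun y => - G y * T y ^+ k.+2); first by apply: closureJ_ideal => //; exact: (algN cK).
  move=> y; have -> : (T y ^+ k.+1 : R[i]) - - G y * T y ^+ k.+2 =
    T y ^+ k * (T y + T y ^+ 2 * G y) by rewrite !exprS; ring.
  rewrite normcM normcX.
  apply: (@le_trans _ _ (2 ^+ k * (e / 2 ^+ k))); last by rewrite mulrC divfK // expf_neq0.
  apply: ler_pM; [by rewrite exprn_ge0 ?normc_ge0|exact: normc_ge0| |exact: GP].
  by rewrite lerXn2r ?nnegrE ?normc_ge0.
have TI : I T by exact: down 0%N (down 1%N (down 2%N T4I)).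
apply/seteqP; split => f /=.
  move=> fI; split.
    apply: alg_lim => e e0; have [g [gA _] fg] := (uniform_closureP _ f).1 fI e e0.
    by exists g.
  apply/eqP; rewrite -normc_eq0 eq_le normc_ge0 andbT.
  apply/ler_addgt0Pr => e e0; rewrite add0r.
  have [g [gA gx] fg] := (uniform_closureP _ f).1 fI e e0.
  have := fg x; have /= -> := nbhs_singleton gx.
  by rewrite subr0.
move=> [fA fx]; apply: closureJ_lim => e e0.
have [|r rr fr] := (uniform_closureP _ f).1 fA (e / 2); first by rewrite divr_gt0.
exists (fun y => r y - r x); last first.
  move=> y; have -> : (f y : R[i]) - (r y - r x) = (f y - r y) - (f x - r x).
    by rewrite fx; ring.
  by apply: (le_trans (ler_normcB _ _)); have := fr x; have := fr y; lra.
have [p [q rpq]] := rr.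
have [qx rx] := rpq x.
pose s : {poly R[i]} := p - (r x)%:P * q.
have /divpK sE : ('X - (val x)%:P) %| s.
  by rewrite dvdp_XsubCl /root /s !hornerE rx divfK // subrr.
have uA : A (fun y => (s %/ ('X - (val x)%:P)).[val y] / q.[val y]).
  apply: alg_rational; exists (s %/ ('X - (val x)%:P)), q => y.
  by have [qy _] := rpq y.
rewrite (_ : (fun y => r y - r x) = fun y =>
  (s %/ ('X - (val x)%:P)).[val y] / q.[val y] * T y); first exact: closureJ_ideal.
apply/funext => y; have [qy ->] := rpq y.
have sy : (s %/ ('X - (val x)%:P)).[val y] * T y = s.[val y].
  by rewrite -[in RHS]sE hornerM hornerXsubC.
by rewrite mulrAC sy /s !hornerE mulrBl mulfK.
Qed.

End Structure.

(** * The point derivation *)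

Section TaylorAlgebra.
Variable R : realType.
Implicit Types (p q u : {poly R[i]}).

Lemma taylor_numX p q n : q.[0] != 0 ->
  taylor_num p q n.+1 * 'X = taylor_num p q n - (taylor_coef p q n)%:P * q.
Proof.
move=> q0; rewrite /= /taylor_coef; set r := _ - _.
have /divpK : ('X - 0%:P) %| r by rewrite dvdp_XsubCl /root /r !hornerE divfK // subrr.
by rewrite [X in _ * X = _](_ : _ = 'X) // polyC0 subr0.
Qed.

Lemma taylor_num_add p p' q n : q.[0] != 0 ->
  taylor_num (p + p') q n = taylor_num p q n + taylor_num p' q n.
Proof.
move=> q0; elim: n => // n IH; apply: (mulIf (negbT (polyX_eq0 _))).
rewrite mulrDl !taylor_numX // IH /taylor_coef IH hornerD mulrDl polyCD; ring.
Qed.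

Lemma taylor_num_scale c p q n : q.[0] != 0 ->
  taylor_num (c%:P * p) q n = c%:P * taylor_num p q n.
Proof.
move=> q0; elim: n => // n IH; apply: (mulIf (negbT (polyX_eq0 _))).
rewrite -mulrA !taylor_numX // IH /taylor_coef IH hornerM hornerC -mulrA polyCM; ring.
Qed.

Lemma taylor_num_cancel p q u n : q.[0] != 0 -> u.[0] != 0 ->
  taylor_num (p * u) (q * u) n = taylor_num p q n * u.
Proof.
move=> q0 u0; elim: n => // n IH; apply: (mulIf (negbT (polyX_eq0 _))).
have qu0 : (q * u).[0] != 0 by rewrite hornerM mulf_neq0.
rewrite mulrAC !taylor_numX // IH /taylor_coef IH !hornerM.
have -> : (taylor_num p q n).[0] * u.[0] / (q.[0] * u.[0]) = (taylor_num p q n).[0] / q.[0].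
  by field; rewrite q0 u0.
ring.
Qed.

Lemma taylor_num_shift p q n : taylor_num p q n.+1 = taylor_num (taylor_num p q 1) q n.
Proof. by elim: n => // n IH; rewrite [LHS]/= -/(taylor_num p q n.+1) IH. Qed.

Lemma taylor_coefD p p' q n : q.[0] != 0 ->
  taylor_coef (p + p') q n = taylor_coef p q n + taylor_coef p' q n.
Proof. by move=> q0; rewrite /taylor_coef taylor_num_add // hornerD mulrDl. Qed.

Lemma taylor_coefZ c p q n : q.[0] != 0 ->
  taylor_coef (c%:P * p) q n = c * taylor_coef p q n.
Proof. by move=> q0; rewrite /taylor_coef taylor_num_scale // hornerM hornerC mulrA. Qed.

Lemma taylor_coef_cancel p q u n : q.[0] != 0 -> u.[0] != 0 ->
  taylor_coef (p * u) (q * u) n = taylor_coef p q n.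
Proof.
move=> q0 u0; rewrite /taylor_coef taylor_num_cancel // !hornerM.
by field; rewrite q0 u0.
Qed.

Lemma taylor_coef_lin c p q p' q' n : q.[0] != 0 -> q'.[0] != 0 ->
  taylor_coef (c%:P * p * q' + p' * q) (q * q') n =
  c * taylor_coef p q n + taylor_coef p' q' n.
Proof.
move=> q0 q'0; have qq0 : (q * q').[0] != 0 by rewrite hornerM mulf_neq0.
rewrite taylor_coefD // -mulrA taylor_coefZ // taylor_coef_cancel //.
by rewrite [q * q']mulrC taylor_coef_cancel.
Qed.

(* Backward shift of a product: S (f g) = S f * g + f 0 * S g. *)
Lemma taylor_coefM p q p' q' n : q.[0] != 0 -> q'.[0] != 0 ->
  taylor_coef (p * p') (q * q') n =
  \sum_(0 <= j < n.+1) taylor_coef p q j * taylor_coef p' q' (n - j).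
Proof.
move=> q0 q'0; have qq0 : (q * q').[0] != 0 by rewrite hornerM mulf_neq0.
elim: n p => [|n IH] p.
  rewrite big_nat1 /taylor_coef /= !hornerM; field; by rewrite q0 q'0.
have -> : taylor_coef (p * p') (q * q') n.+1 =
    taylor_coef (taylor_num (p * p') (q * q') 1) (q * q') n.
  by rewrite /taylor_coef taylor_num_shift.
have -> : taylor_num (p * p') (q * q') 1 = taylor_num p q 1 * p' +
    (taylor_coef p q 0)%:P * (taylor_num p' q' 1 * q).
  apply: (mulIf (negbT (polyX_eq0 _))); rewrite taylor_numX //.
  rewrite mulrDl mulrAC taylor_numX // -!mulrA [q * 'X]mulrC [taylor_num p' q' 1 * _]mulrA.
  rewrite taylor_numX // /taylor_coef /= !hornerM.
  have -> : p.[0] * p'.[0] / (q.[0] * q'.[0]) = p.[0] / q.[0] * (p'.[0] / q'.[0]).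
    by field; rewrite q0 q'0.
  rewrite polyCM; ring.
rewrite taylor_coefD // taylor_coefZ // IH.
rewrite [q * q']mulrC taylor_coef_cancel // addrC.
have sh (r s : {poly R[i]}) k : taylor_coef (taylor_num r s 1) s k = taylor_coef r s k.+1.
  by rewrite /taylor_coef -taylor_num_shift.
rewrite sh [RHS]big_nat_recl // subn0; congr (_ + _).
by apply: eq_bigr => j _; rewrite sh subSS.
Qed.

End TaylorAlgebra.

Section Derivation.
Variable R : realType.
Local Notation C := R[i]^o.
Variables (K : set C) (o : set_type K) (B : nat -> R).
Local Notation X := (set_type K).
Local Notation A := (rational_algebra K).
Local Notation val x := (set_val x : R[i]).
Implicit Types (x y : X) (f g : X -> C) (p q : {poly R[i]}).

Definition quotient_on p q f := forall x, q.[val x] != 0 /\ f x = p.[val x] / q.[val x].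

Hypotheses (cK : compact K) (o0 : set_val o = 0).
Hypothesis taylor_bound : forall m p q f (S : R), quotient_on p q f ->
  (forall x, normc (f x : R[i]) <= S) -> normc (taylor_coef p q m) <= B m * S.

Lemma quotient_on_den p q f : quotient_on p q f -> q.[0] != 0.
Proof. by move=> /(_ o)[]; rewrite o0. Qed.

Lemma quotient_on_lin (c : R[i]) p q f p' q' g : quotient_on p q f -> quotient_on p' q' g ->
  quotient_on (c%:P * p * q' + p' * q) (q * q') (fun x => c * f x + g x).
Proof.
move=> fpq gpq x; have [q0 ->] := fpq x; have [q'0 ->] := gpq x.
rewrite hornerD !hornerM hornerC mulf_neq0 //; split => //.
by field; rewrite q0 q'0.
Qed.

Lemma quotient_onM p q f p' q' g : quotient_on p q f -> quotient_on p' q' g ->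
  quotient_on (p * p') (q * q') (fun x => f x * g x).
Proof.
move=> fpq gpq x; have [q0 ->] := fpq x; have [q'0 ->] := gpq x.
rewrite !hornerM mulf_neq0 //; split => //.
by field; rewrite q0 q'0.
Qed.

Definition derivation_value m f (c : R[i]) := forall p q g (e : R), quotient_on p q g ->
  (forall x, normc ((f x : R[i]) - g x) <= e) -> normc (c - taylor_coef p q m) <= B m * e.

Lemma taylor_coef_dist m p q f p' q' g (e : R) : quotient_on p q f -> quotient_on p' q' g ->
  (forall x, normc ((f x : R[i]) - g x) <= e) ->
  normc (taylor_coef p q m - taylor_coef p' q' m) <= B m * e.
Proof.
move=> fpq gpq fg; have q0 := quotient_on_den fpq; have q'0 := quotient_on_den gpq.
have -> : taylor_coef p q m - taylor_coef p' q' m =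
    taylor_coef ((-1)%:P * p' * q + p * q') (q' * q) m.
  by rewrite taylor_coef_lin //; ring.
apply: (taylor_bound m (quotient_on_lin (-1) gpq fpq)) => x.
by rewrite (_ : -1 * _ + _ = (f x : R[i]) - g x) //; ring.
Qed.

Lemma derivation_value_ex m f : A f -> exists c, derivation_value m f c.
Proof.
move=> /uniform_closureP fA.
have /choice[r rP] : forall n, exists pq : {poly R[i]} * {poly R[i]}, exists2 g,
    quotient_on pq.1 pq.2 g & forall x, normc ((f x : R[i]) - g x) <= 2^-1 ^+ n.
  move=> n; have [g [p [q gpq]] fg] := fA _ (exprV2_gt0 R n).
  by exists (p, q), g.
pose t n := taylor_coef (r n).1 (r n).2 m.
have [|c cP] := @complex_nested_limit R t (fun n => B m * 2^-1 ^+ n).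
  move=> k n; have [g gr fg] := rP k; have [g' g'r fg'] := rP n.
  rewrite -mulrDr; apply: (taylor_coef_dist m gr g'r) => x.
  by have := @ler_normc_dist R (f x) (g x) (g' x); have := fg x; have := fg' x;
    rewrite [normc (g x - f x)]normcB; lra.
exists c => p q g e gpq fg.
rewrite -subr_le0; apply: (@le0_exprV2 _ _ (3 * B m)) => n.
have [g' g'r fg'] := rP n; have tb := taylor_coef_dist m g'r gpq.
have := tb (2^-1 ^+ n + e); rewrite -/(t n) => h.
have {}h : normc (t n - taylor_coef p q m) <= B m * (2^-1 ^+ n + e).
  apply: h => x; have := @ler_normc_dist R (f x) (g' x) (g x); have := fg x; have := fg' x.
  by rewrite [normc (g' x - f x)]normcB; lra.
have := ler_normc_dist (t n) c (taylor_coef p q m); have := cP n; move: h.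
by rewrite mulrDr; lra.
Qed.

Definition derivation m f : C := xget 0 (derivation_value m f).

Lemma derivationP m f : A f -> derivation_value m f (derivation m f).
Proof. by move=> /(derivation_value_ex m)[c cP]; apply: xgetPex; exists c. Qed.

Lemma derivation_quotient m p q f : A f -> quotient_on p q f ->
  derivation m f = taylor_coef p q m.
Proof.
move=> fA fpq; apply/eqP; rewrite -subr_eq0 -normc_eq0 eq_le normc_ge0 andbT.
have := @derivationP m f fA p q f 0 fpq; rewrite mulr0; apply => x.
by rewrite subrr normc0.
Qed.

Lemma derivation_approx m f (e : R) p q g : A f -> quotient_on p q g ->
  (forall x, normc ((f x : R[i]) - g x) <= e) ->
  normc ((derivation m f : R[i]) - taylor_coef p q m) <= B m * e.
Proof. by move=> fA; exact: derivationP. Qed.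

Lemma eq_of_small (u v : R[i]) (c : R) :
  (forall e : R, 0 < e -> e <= 1 -> normc (u - v) <= c * e) -> u = v.
Proof.
move=> uv; apply/eqP; rewrite -subr_eq0 -normc_eq0 eq_le normc_ge0 andbT.
apply: (@le0_exprV2 _ _ c) => n; apply: uv; first exact: exprV2_gt0.
by rewrite exprn_ile1 //; lra.
Qed.

Lemma derivation_linear m : linear_functional A (derivation m).
Proof.
move=> a f g fA gA; have sA : A (fun x => a * f x + g x) by apply: algD => //; exact: (algZ cK).
have [N N0 NE] : exists2 N : R, 0 <= N & N = normc (a : R[i]).
  by exists (normc (a : R[i])) => //; exact: normc_ge0.
apply: (@eq_of_small _ _ (2 * (N + 1) * B m)) => e e0 _.
have [u [p [q upq]] fu] := (uniform_closureP _ f).1 fA e e0.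
have [v [p' [q' vpq]] gv] := (uniform_closureP _ g).1 gA e e0.
have ds := derivation_approx m sA (quotient_on_lin a upq vpq) (e := (N + 1) * e).
have df := derivation_approx m fA upq fu; have dg := derivation_approx m gA vpq gv.
rewrite taylor_coef_lin ?(quotient_on_den upq) ?(quotient_on_den vpq) // in ds.
set tp := taylor_coef p q m in ds df; set tp' := taylor_coef p' q' m in ds dg.
have {}ds : normc ((derivation m (fun x => a * f x + g x) : R[i]) - (a * tp + tp')) <=
    B m * ((N + 1) * e).
  apply: ds => x.
  have -> : (a * f x + g x : R[i]) - (a * u x + v x) = a * (f x - u x) + (g x - v x) by ring.
  apply: (le_trans (ler_normcD _ _)); rewrite normcM -NE mulrDl mul1r lerD //.
  by rewrite ler_wpM2l.
have -> : (derivation m (fun x => a * f x + g x) : R[i]) - (a * derivation m f + derivation m g) =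
  (derivation m (fun x => a * f x + g x) - (a * tp + tp')) -
  (a * (derivation m f - tp) + (derivation m g - tp')) by ring.
apply: (le_trans (ler_normcB _ _)); apply: (le_trans (lerD (lexx _) (ler_normcD _ _))).
rewrite normcM -NE; have := ler_wpM2l N0 df.
have -> : 2 * (N + 1) * B m * e = B m * ((N + 1) * e) + (N * (B m * e) + B m * e) by ring.
by move=> h; rewrite lerD // lerD.
Qed.

Lemma derivation_bound m f (S : R) : A f -> (forall x, normc (f x : R[i]) <= S) ->
  normc (derivation m f : R[i]) <= B m * S.
Proof.
move=> fA fS; rewrite -subr_le0; apply: (@le0_exprV2 _ _ (2 * B m)) => n.
have e0 := exprV2_gt0 R n.
have [u [p [q upq]] fu] := (uniform_closureP _ f).1 fA _ e0.
have := derivation_approx m fA upq fu.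
have : normc (taylor_coef p q m) <= B m * (S + 2^-1 ^+ n).
  apply: taylor_bound upq _ => x.
  have := @lerB_normc R (u x) (f x); rewrite normcB.
  by have := fS x; have := fu x; lra.
rewrite mulrDr; have := lerB_normc (derivation m f : R[i]) (taylor_coef p q m); lra.
Qed.

Lemma derivation_mul k f g : A f -> A g ->
  derivation k (fun x => f x * g x) =
  \sum_(0 <= j < k.+1) derivation j f * derivation (k - j)%N g.
Proof.
move=> fA gA; have sA : A (fun x => f x * g x) by exact: (algM cK).
have [F F0 fF] := alg_bounded cK fA; have [G G0 gG] := alg_bounded cK gA.
pose c := B k * (F + G + 1) +
  \sum_(0 <= j < k.+1) (B j * F * B (k - j)%N + B j * (B (k - j)%N * (G + 1))).
apply: (@eq_of_small _ _ c) => e e0 e1.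
have [u [p [q upq]] fu] := (uniform_closureP _ f).1 fA e e0.
have [v [p' [q' vpq]] gv] := (uniform_closureP _ g).1 gA e e0.
have vG x : normc (v x : R[i]) <= G + 1.
  by have := @lerB_normc R (v x) (g x); rewrite normcB; have := gG x; have := gv x; lra.
have ds : normc ((derivation k (fun x => f x * g x) : R[i]) -
    taylor_coef (p * p') (q * q') k) <= B k * ((F + G + 1) * e).
  apply: (derivation_approx k sA (quotient_onM upq vpq)) => x.
  have -> : (f x * g x : R[i]) - u x * v x = f x * (g x - v x) + (f x - u x) * v x by ring.
  apply: (le_trans (ler_normcD _ _)); rewrite !normcM.
  have := ler_pM (normc_ge0 _) (normc_ge0 _) (fF x) (gv x).
  have := ler_pM (normc_ge0 _) (normc_ge0 _) (fu x) (vG x).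
  rewrite (_ : (F + G + 1) * e = F * e + e * (G + 1)); last ring.
  by move=> ? ?; rewrite lerD.
rewrite taylor_coefM ?(quotient_on_den upq) ?(quotient_on_den vpq) // in ds.
set sT := \sum_(0 <= j < k.+1) taylor_coef p q j * _ in ds.
set sD := \sum_(0 <= j < k.+1) derivation j f * _.
apply: (le_trans (ler_normc_dist sT _ _)); rewrite /c mulrDl -(mulrA (B k)) lerD //.
rewrite /sT /sD -sumrB; apply: (le_trans (ler_normc_sum _ _ _)).
rewrite mulr_suml; apply: ler_sum => j _.
have := derivation_bound j fA fF; have := derivation_approx j fA upq fu.
have := derivation_approx (k - j) gA vpq gv; have := @taylor_bound (k - j)%N _ _ _ _ vpq vG.
move: (taylor_coef p q j) (taylor_coef p' q' (k - j)) (derivation j f) (derivation (k - j) g).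
move=> tp tp' df dg tp'G gtp' ftp fF'.
have -> : tp * tp' - (df : R[i]) * dg = - (df * (dg - tp') + (df - tp) * tp') by ring.
rewrite normc_opp [leRHS]mulrDl; apply: (le_trans (ler_normcD _ _)); rewrite 2!normcM lerD //.
  by rewrite -[B j * F * _ * e]mulrA ler_pM ?normc_ge0.
by rewrite -[leRHS]mulrA [_ * e]mulrC mulrA ler_pM ?normc_ge0.
Qed.

Lemma derivation0 f : A f -> derivation 0 f = f o.
Proof.
move=> fA; apply: (@eq_of_small _ _ (B 0 + 1)) => e e0 _.
have [u [p [q upq]] fu] := (uniform_closureP _ f).1 fA e e0.
have := derivation_approx 0 fA upq fu.
have -> : taylor_coef p q 0 = u o by have [_ ->] := upq o; rewrite o0.
have := @ler_normc_dist R (u o) (derivation 0 f) (f o); have := fu o.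
by rewrite [normc (f o - u o)]normcB mulrDl mul1r; lra.
Qed.

Lemma derivation1_id : derivation 1 (fun x => set_val x) = 1.
Proof.
have idq : quotient_on 'X 1 (fun x => set_val x).
  by move=> x; rewrite hornerX hornerC oner_neq0 divr1.
rewrite (derivation_quotient 1 (@alg_id R K) idq).
have := @taylor_numX R 'X 1 0; rewrite hornerC oner_neq0 => /(_ isT).
rewrite /taylor_coef [taylor_num _ _ 0]/= hornerX mul0r polyC0 mul0r subr0 => e.
have -> : taylor_num ('X : {poly R[i]}) 1 1 = 1.
  by apply: (mulIf (negbT (polyX_eq0 R[i]))); rewrite e mul1r.
by rewrite hornerC divr1.
Qed.

Lemma derivation_point : point_derivation_infinite_order A (evaluation o) derivation.
Proof.
split; [exact: derivation_linear|exact: derivation0|].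
by move=> f g fA gA k _; exact: derivation_mul.
Qed.

Lemma sup_norm_ge f x : A f -> normc (f x : R[i]) <= sup_norm f.
Proof.
move=> fA; have [F F0 fF] := alg_bounded cK fA.
rewrite /sup_norm; apply: ub_le_sup; last by exists x.
by exists F => _ [y _ <-].
Qed.

Lemma derivation_bounded : bounded_derivation A derivation.
Proof.
move=> m; exists (B m) => f fA; apply: derivation_bound => // x.
exact: sup_norm_ge.
Qed.

Lemma derivation_nondegenerate : nondegenerate_derivation A derivation.
Proof.
exists (fun x => set_val x); first exact: alg_id.
by rewrite derivation1_id; exact/eqP/oner_neq0.
Qed.

(* Otherwise z times a cutoff vanishing at the origin would be arbitrarily
   close to z and killed by the derivation. *)
Lemma rational_algebra_neq_continuous : A <> @continuous_functions R X.
Proof.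
move=> AC; pose h (n : nat) x : C := ((2 ^+ n * normc (val x)) / (1 + 2 ^+ n * normc (val x)))%:C.
have den n x : 0 < 1 + 2 ^+ n * normc (val x).
  by rewrite ltr_pwDl // mulr_ge0 ?normc_ge0 ?exprn_ge0.
have hA n : A (h n).
  rewrite AC; apply/continuous_set_typeP => x e e0.
  have p0 : 0 < 2 ^+ n :> R by rewrite exprn_gt0.
  exists (e / 2 ^+ n); first by rewrite divr_gt0.
  move=> y yx; have nB (s t : R) : normc (s%:C - t%:C) = `|s - t|.
    by rewrite -(rmorphB (real_complex R)) normc_real.
  rewrite /h nB.
  have := den n x; have := den n y; set a := normc (val y); set b := normc (val x) => d1 d2.
  have ab : `|a - b| < e / 2 ^+ n.
    apply: le_lt_trans yx; rewrite ler_norml; apply/andP; split.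
      by have := lerB_normc (val x) (val y); rewrite normcB -/a -/b; lra.
    by have := lerB_normc (val y) (val x); rewrite -/a -/b; lra.
  have -> : 2 ^+ n * a / (1 + 2 ^+ n * a) - 2 ^+ n * b / (1 + 2 ^+ n * b) =
    2 ^+ n * (a - b) / ((1 + 2 ^+ n * a) * (1 + 2 ^+ n * b)).
    by field; rewrite !gt_eqF.
  have d12 : 1 <= (1 + 2 ^+ n * a) * (1 + 2 ^+ n * b).
    have a0 : 0 <= 2 ^+ n * a by rewrite mulr_ge0 ?normc_ge0 ?ltW.
    have b0 : 0 <= 2 ^+ n * b by rewrite mulr_ge0 ?normc_ge0 ?ltW.
    by have := mulr_ge0 a0 b0; move: (2 ^+ n * a) (2 ^+ n * b) a0 b0 => s t; nra.
  rewrite !normrM normfV (gtr0_norm p0) [`|_ * (1 + 2 ^+ n * b)|]gtr0_norm ?mulr_gt0 //.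
  rewrite ltr_pdivrMr ?mulr_gt0 //.
  apply: (@lt_le_trans _ _ e); last by rewrite ler_peMr // ltW.
  by rewrite mulrC -ltr_pdivlMr.
have dz n : derivation 1 (fun x => set_val x * h n x) = 0.
  have -> := derivation_mul 1 (@alg_id R K) (hA n).
  rewrite big_nat_recr // big_nat1 /= (derivation0 (@alg_id R K)) o0 mul0r add0r.
  rewrite subnn (derivation0 (hA n)) /h o0 normc0 mulr0 mul0r mulr0 //.
have close n : normc (1 : R[i]) <= B 1 * 2^-1 ^+ n.
  have idA := @alg_id R K; have zhA := algM cK idA (hA n).
  have -> : (1 : R[i]) = derivation 1 (fun x => -1 * (set_val x * h n x) + set_val x).
    by rewrite (derivation_linear 1 (-1) zhA idA) dz mulr0 add0r derivation1_id.
  apply: derivation_bound; first by apply: algD => //; exact: (@algZ R K cK (-1) _ zhA).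
  move=> x; have -> : -1 * (set_val x * h n x) + set_val x =
      (val x) * ((1 + 2 ^+ n * normc (val x))^-1)%:C.
    have -> : (1 + 2 ^+ n * normc (val x))^-1 =
        1 - 2 ^+ n * normc (val x) / (1 + 2 ^+ n * normc (val x)).
      by field; rewrite gt_eqF.
    by rewrite /h rmorphB /=; ring.
  rewrite normcM normc_real gtr0_norm ?invr_gt0 // ler_pdivrMr //.
  have p0 : 2^-1 ^+ n * 2 ^+ n = 1 :> R by rewrite -exprMn mulVf // expr1n.
  rewrite mulrDr mulr1 mulrA p0 mul1r lerDr ltW // exprV2_gt0 //.
have := le0_exprV2 close; rewrite normc1; lra.
Qed.

End Derivation.

Section TaylorBound.
Variable R : realType.
Local Notation C := R[i]^o.
Implicit Types (p q : {poly R[i]}) (z w : R[i]).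

Lemma continuous_horner p z (e : R) : 0 < e ->
  exists2 d : R, 0 < d & forall w, normc (w - z) < d -> normc (p.[w] - p.[z]) < e.
Proof.
pose in_plane w : set_type [set: C] := SigSub (mem_set (I : [set: C] w)).
move=> /(@continuous_horner_on _ _ p (in_plane z))[d d0 dP].
by exists d => // w; exact: (dP (in_plane w)).
Qed.

Lemma quotient_near p q z (S e : R) : 0 < e -> q.[z] != 0 -> normc (p.[z] / q.[z]) <= S ->
  exists r k : R, [/\ 0 < r, 0 < k & forall w, normc (w - z) < r ->
    k <= normc q.[w] /\ normc (p.[w] / q.[w]) <= S + e].
Proof.
move=> e0 q0 pqS; have S0 : 0 <= S by exact: le_trans (normc_ge0 _) pqS.
pose Q := normc q.[z]; have Q0 : 0 < Q by rewrite normc_gt0.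
have pS : normc p.[z] <= S * Q by rewrite -ler_pdivrMr // -normc_div.
pose t := e * Q / (2 * (1 + S + e)).
have den : 0 < 2 * (1 + S + e) by lra.
have t0 : 0 < t by rewrite /t divr_gt0 // mulr_gt0.
have tE : t * (2 * (1 + S + e)) = e * Q by rewrite /t divfK // gt_eqF.
have tQ : t <= Q / 2.
  rewrite -(ler_pM2r den) tE; have := mulr_ge0 (ltW Q0) S0.
  by have := mulr_gt0 e0 Q0; lra.
have [d d0 dP] := @continuous_horner p z t t0; have [d' d'0 d'P] := @continuous_horner q z t t0.
exists (Num.min d d'), (Q / 2); split; [by rewrite lt_min d0|lra|].
move=> w; rewrite lt_min => /andP[/dP pw /d'P qw].
have qQ : Q - t <= normc q.[w].
  by have := lerB_normc q.[z] q.[w]; rewrite [normc (_ - q.[w])]normcB -/Q; lra.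
have pQ : normc p.[w] <= S * Q + t.
  by have := lerB_normc p.[w] p.[z]; lra.
have q'0 : 0 < normc q.[w] by lra.
split; first lra.
rewrite normc_div ler_pdivrMr //; apply: (le_trans pQ).
apply: (@le_trans _ _ ((S + e) * (Q - t))); last by rewrite ler_wpM2l //; lra.
by have := tE; have := mulr_gt0 e0 Q0; lra.
Qed.

Variable S : set (open_disc R).
Definition punctured_disc : set C := [set z | normc z <= 1 /\ off_discs S z].

Lemma seq_lower_bound (T : eqType) (t : seq T) (k : T -> R) : (forall x, x \in t -> 0 < k x) ->
  exists2 k0 : R, 0 < k0 & forall x, x \in t -> k0 <= k x.
Proof.
elim: t => [|x t IH] k0; first by exists 1.
have [|k1 k10 k1P] := IH; first by move=> y yt; apply: k0; rewrite inE yt orbT.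
exists (Num.min k1 (k x)); first by rewrite lt_min k10 k0 // inE eqxx.
move=> y; rewrite inE => /orP[/eqP ->|/k1P]; rewrite ge_min ?lexx ?orbT //.
by move=> ->.
Qed.

Lemma quotient_off_finite p q (M e : R) : 0 < e ->
  (forall z, punctured_disc z -> q.[z] != 0 /\ normc (p.[z] / q.[z]) <= M) ->
  exists (s : seq (open_disc R)) (k : R), [/\ uniq s, forall D, D \in s -> S D, 0 < k &
    forall z, perforated_disc s z -> k <= normc q.[z] /\ normc (p.[z] / q.[z]) <= M + e].
Proof.
move=> e0 pqM.
have loc (z : C) : exists rkl : R * R * seq (open_disc R), normc (z : R[i]) <= 1 ->
    [/\ 0 < rkl.1.1, 0 < rkl.1.2, forall D, D \in rkl.2 -> S D &
     forall w : R[i], normc (w - z) < rkl.1.1 -> off_discs [set D | D \in rkl.2] w ->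
       rkl.1.2 <= normc q.[w] /\ normc (p.[w] / q.[w]) <= M + e].
  have [zS|zS] := pselect (off_discs S z).
    have [z1|z1] := pselect (normc (z : R[i]) <= 1); last by exists (0, 0, [::]).
    have [q0 pqz] := pqM z (conj z1 zS).
    have [r [k [r0 k0 rk]]] := quotient_near e0 q0 pqz.
    by exists (r, k, [::]) => _; split => // w wz _; exact: rk.
  have [D SD Dz] : exists2 D, S D & normc ((z : R[i]) - Defs.center D) < Defs.radius D.
    apply: contrapT => nD; apply: zS => D SD; rewrite leNgt; apply/negP => Dz.
    by apply: nD; exists D.
  exists (Defs.radius D - normc ((z : R[i]) - Defs.center D), 1, [:: D]) => _; split => //=.
  - by rewrite subr_gt0.
  - by move=> D'; rewrite inE => /eqP ->.
  - move=> w wz /(_ D); rewrite /= inE eqxx => /(_ isT).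
    by have := ler_normc_dist z w (Defs.center D : R[i]); lra.
have {loc}[f fP] := choice loc.
have [|t [t1 tP]] := compact_finite_balls (r := fun z => (f z).1.1) (@compact_unit_disc R).
  by move=> z /fP[].
have [|k k0 kP] := @seq_lower_bound _ t (fun z => (f z).1.2).
  by move=> z /t1 /fP[].
exists (undup (flatten [seq (f z).2 | z <- t])), k; split; rewrite ?undup_uniq //.
  move=> D; rewrite mem_undup => /flattenP[l /mapP[z zt ->]].
  by have [_ _ + _] := fP z (t1 z zt); apply.
move=> z [z1 zs]; have [y yt yz] := tP z z1; have [_ _ _ yP] := fP y (t1 y yt).
have [|qz pqz] := yP z yz.
  move=> D /= Dy; apply: zs; rewrite /= mem_undup; apply/flattenP.
  by exists (f y).2 => //; apply/mapP; exists y.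
by split => //; exact: le_trans (kP y yt) qz.
Qed.

Variable B : nat -> R.
Hypothesis S_far : forall D, S D -> Defs.radius D <= 1 / 4 /\ far_disc D.
Hypothesis S_sum : forall j,
  sum_bounded (fun D => Defs.radius D / normc (Defs.center D : R[i]) ^+ j) S (B j).
Hypothesis B1 : B 1 <= 1 / 2592.

Lemma taylor_bound_ex m : exists C0 : nat -> R, forall i, (i < m)%N ->
  forall p q (M : R),
  (forall z, punctured_disc z -> q.[z] != 0 /\ normc (p.[z] / q.[z]) <= M) ->
  normc (taylor_coef p q i) <= C0 i * M.
Proof.
have zP : punctured_disc 0.
  split; first by rewrite normc0 ler01.
  move=> D /S_far[_]; rewrite /far_disc sub0r normc_opp.
  by have := radius_gt0 D; lra.
elim: m => [|m [C0 C0P]]; first by exists (fun=> 0).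
pose c := 4 * (contour_const B m.+1 + \sum_(i < m) C0 i * contour_const B (m.+1 - i)).
exists (fun i => if (i < m)%N then C0 i else c) => i; rewrite ltnS leq_eqVlt.
case: (boolP (i < m)%N) => [im _|_]; first exact: C0P.
rewrite orbF => /eqP -> p q M pqM; rewrite -subr_le0; apply: (@le0_exprV2 _ _ c) => n.
have M0 : 0 <= M by have [_] := pqM 0 zP; apply: le_trans; exact: normc_ge0.
have [s [k [us sS k0 ks]]] := quotient_off_finite (exprV2_gt0 R n) pqM.
have := @taylor_bound_step R s p q m (M + 2^-1 ^+ n) k B C0; rewrite -/c mulrDr.
move=> h; rewrite lerBlDl; apply: h => //.
- by move=> D /sS; exact: S_far.
- by move=> j; exact: S_sum.
- by rewrite addr_ge0 // ltW // exprV2_gt0.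
- by have [] := pqM 0 zP.
move=> j jm; apply: C0P => // z [z1 zS].
have [] := ks z; first by split => // D /= /sS; exact: zS.
move=> kq pqz; split => //; rewrite -normc_eq0 gt_eqF //; exact: lt_le_trans kq.
Qed.

Lemma punctured_taylor_bound : exists B' : nat -> R,
  forall m p q (f : set_type punctured_disc -> C) (M : R), quotient_on p q f ->
  (forall x, normc (f x : R[i]) <= M) -> normc (taylor_coef p q m) <= B' m * M.
Proof.
have /choice[B' B'P] m := taylor_bound_ex m.+1.
exists (fun m => B' m m) => m p q f M fpq fM; apply: B'P => // z zK.
have [q0 fz] := fpq (SigSub (mem_set zK)); split; first exact: q0.
by rewrite -[_ / _]fz; exact: fM.
Qed.

End TaylorBound.

Section BrowderSums.
Variable R : realType.
Local Notation C := R[i]^o.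
Local Notation disc_center D := (Defs.center D : R[i]).
Implicit Types (D : open_disc R) (S : set (open_disc R)) (z : R[i]).

Lemma closure_disc D :
  closure (disc_set D) = [set z | normc ((z : R[i]) - disc_center D) <= Defs.radius D].
Proof.
have r0 := radius_gt0 D; apply/seteqP; split => z /=.
  move=> zc; rewrite leNgt; apply/negP => z1.
  have [|w []] := zc [set w | normc ((w : R[i]) - z) <
      normc ((z : R[i]) - disc_center D) - Defs.radius D].
    by apply/nbhs_normcP; exists (normc ((z : R[i]) - disc_center D) - Defs.radius D);
      rewrite ?subr_gt0.
  rewrite disc_setE /= => wD wz.
  by have := @ler_normc_dist R w z (disc_center D); rewrite [normc (z - w)]normcB; lra.
move=> zD A /nbhs_normcP[e e0 eA]; set r := Defs.radius D in r0 zD.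
set a := disc_center D in zD.
pose t := Num.min 1 (e / (2 * r)).
have t0 : 0 < t by rewrite lt_min ltr01 divr_gt0 // mulr_gt0.
have t1 : t <= 1 by rewrite ge_min lexx.
have te : t * r <= e / 2.
  rewrite -ler_pdivlMr // (_ : e / 2 / r = e / (2 * r)); first by rewrite ge_min lexx orbT.
  by field; rewrite gt_eqF.
exists (a + (1 - t)%:C * ((z : R[i]) - a)); split.
  rewrite disc_setE -/a -/r (addrC a) addrK normcM normc_real ger0_norm ?subr_ge0 //.
  by have := normc_ge0 ((z : R[i]) - a); nra.
apply: eA; have -> : (a + (1 - t)%:C * ((z : R[i]) - a)) - z = - t%:C * (z - a).
  by rewrite rmorphB /=; ring.
rewrite normcM normc_opp normc_real gtr0_norm //.
by have := normc_ge0 ((z : R[i]) - a); nra.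
Qed.

Lemma closure_unit_disc :
  closure (disc_set (unit_disc R)) = [set z | normc (z : R[i]) <= 1].
Proof.
by rewrite closure_disc; apply/seteqP; split => z;
  rewrite /= /Defs.center /Defs.radius /= subr0.
Qed.

Lemma boundary_disc D : boundary (disc_set D) =
  [set z | normc ((z : R[i]) - disc_center D) = Defs.radius D].
Proof.
rewrite /boundary closure_disc (interior_id (disc_set D)).1; last exact: open_disc_open.
apply/seteqP; split=> z /=; rewrite disc_setE.
  by move=> [zD /negP]; rewrite -leNgt => Dz; apply/eqP; rewrite eq_le zD Dz.
by move=> ->; rewrite ltxx; split.
Qed.

Lemma boundary_distance D : normc (disc_center D) - Defs.radius D <= s_ 0 D.
Proof.
rewrite /s_ boundary_disc; apply: lb_le_inf => [|_ [z /= zD <-]].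
  eexists; exists (disc_center D + (Defs.radius D)%:C); last by [].
  by rewrite /= (addrC (disc_center D)) addrK normc_real gtr0_norm // radius_gt0.
by rewrite subr0; have := lerB_normc (disc_center D) z; rewrite normcB; lra.
Qed.

Lemma esum_sum_bounded S (w : open_disc R -> R) (B : R) (f : open_disc R -> \bar R) :
  (forall D, S D -> f D = (w D)%:E) -> sum_bounded w S B -> (\esum_(D in S) f D <= B%:E)%E.
Proof.
move=> fw SB; apply: ge_ereal_sup => _ [A [finA AS] <-].
rewrite fsbig_finite //=.
rewrite (eq_big_seq (fun D => (w D)%:E)); last first.
  by move=> D; rewrite in_fset_set // inE => /AS /fw.
rewrite sumEFin lee_fin; apply: SB; first exact: finmap.fset_uniq.
by move=> D; rewrite in_fset_set // inE => /AS.
Qed.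

Lemma sum_bounded_mem (w : open_disc R -> R) S B D : sum_bounded w S B -> S D -> w D <= B.
Proof.
move=> SB SD; have := SB [:: D] isT; rewrite big_seq1; apply => D'.
by rewrite inE => /eqP ->.
Qed.

End BrowderSums.

Section Stages.
Variable R : realType.
Implicit Types (D : open_disc R) (S : set (open_disc R)) (z x : R[i]).
Local Notation disc_center D := (Defs.center D : R[i]).

Definition stage_gap n : R := 2^-1 ^+ n.+1.
Definition stage_size n : R := 2^-1 ^+ (n.+1 * (n + 20)).

Definition separating S (e : R) x :=
  [/\ exists chi : R[i] -> R[i],
      [/\ limit_rational_off S chi,
          exists2 d : R, 0 < d & forall z, off_discs S z -> normc (z - x) <= d -> chi z = 1,
          forall z, off_discs S z -> e <= normc (z - x) -> chi z = 0 &
          forall z, off_discs S z -> normc (chi z) * normc (z - x) ^+ 4 <= e],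
      exists2 D, S D & normc (disc_center D - x) <= e &
      off_discs S x -> exists2 G : R[i] -> R[i], rational_off S G &
        forall z, normc z <= 1 -> off_discs S z ->
          normc (z - x + (z - x) ^+ 2 * G z) <= e].

Lemma separating_sub S S' (e e' : R) x : S `<=` S' -> e <= e' ->
  separating S e x -> separating S' e' x.
Proof.
move=> SS' ee' [[chi [lchi [d d0 chi1] chi0 chi4]] [D SD Dx] G]; split.
- exists chi; split; first exact: limit_rational_off_sub lchi.
  + by exists d => // z /(off_discs_sub SS'); exact: chi1.
  + by move=> z /(off_discs_sub SS') zS ez; apply: chi0 => //; exact: le_trans ez.
  + by move=> z /(off_discs_sub SS') zS; apply: le_trans ee'; exact: chi4.
- by exists D; [exact: SS'|exact: le_trans ee'].
- move=> /(off_discs_sub SS') /G[g rg gP]; exists g; first exact: rational_off_sub rg.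
  by move=> z z1 /(off_discs_sub SS') zS; apply: le_trans ee'; exact: gP.
Qed.

Lemma stage n : exists S, [/\ sum_bounded (@Defs.radius R) S (stage_size n),
  forall D, S D -> 2 * stage_gap n <= normc (disc_center D) &
  forall x, normc x <= 1 -> 4 * stage_gap n <= normc x -> separating S (2^-1 ^+ n) x].
Proof.
have c0 : 0 < stage_size n / 2 by rewrite divr_gt0 // exprV2_gt0.
have [S [Sc Sg chiP]] := cutoff_stage c0 (exprV2_gt0 R n.+1) (exprV2_gt0 R n).
have [S' [S'c S'g dS' GP]] := lattice_stage c0 (exprV2_gt0 R n.+1) (exprV2_gt0 R n).
exists (S `|` S'); split.
- by have := sum_boundedU Sc S'c; rewrite -splitr.
- by move=> D [/Sg|/S'g].
move=> x x1 nx; have SU : S `<=` S `|` S' by move=> D; left.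
have S'U : S' `<=` S `|` S' by move=> D; right.
split.
- have [chi [lchi [d d0 chi1] chi0 chi4]] := chiP x x1 nx.
  exists chi; split; first exact: limit_rational_off_sub lchi.
  + by exists d => // z /(off_discs_sub SU); exact: chi1.
  + by move=> z /(off_discs_sub SU); exact: chi0.
  + by move=> z /(off_discs_sub SU); exact: chi4.
- by have [D S'D Dx] := dS' x x1 nx; exists D => //; right.
- move=> /(off_discs_sub S'U) /(GP x x1 nx)[g rg gP]; exists g.
    exact: rational_off_sub rg.
  by move=> z z1 /(off_discs_sub S'U); exact: gP.
Qed.

Lemma sum_exprV2 a n : \sum_(i < n) 2^-1 ^+ (i + a.+1) <= 2^-1 ^+ a :> R.
Proof.
rewrite -subr_ge0; apply: le_trans (ltW (exprV2_gt0 R (n + a))) _.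
elim: n => [|n IH]; first by rewrite big_ord0 subr0.
by rewrite big_ord_recr /= !addSn addnS exprS; move: IH; lra.
Qed.

(* The exponent comes from [n * j <= n ^ 2 + j ^ 2]. *)
Lemma stage_weight n j :
  (2 ^+ n) ^+ j * stage_size n <= 2 ^+ (j * j) * 2^-1 ^+ (n + 20).
Proof.
rewrite /stage_size -exprM.
have -> : (n.+1 * (n + 20) = n * n + (21 * n + 20))%N by lia.
apply: (@le_trans _ _ (2 ^+ (j * j) * (2 ^+ (n * n) * 2^-1 ^+ (n * n + (21 * n + 20))))).
  rewrite mulrA -exprD ler_wpM2r ?(ltW (exprV2_gt0 _ _)) //.
  by rewrite ler_weXn2l ?ler1n //; nia.
rewrite exprV2_cancel ler_wpM2l ?exprn_ge0 //.
by apply: exprV2_le; lia.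
Qed.

Lemma separating_discs : exists S (B : nat -> R),
  [/\ forall D, S D -> Defs.radius D <= 1 / 4 /\ far_disc D,
      forall j, sum_bounded (fun D => Defs.radius D / normc (disc_center D) ^+ j) S (B j),
      B 1 <= 1 / 2592 &
      forall x e, x != 0 -> normc x <= 1 -> 0 < e -> separating S e x].
Proof.
have /choice[T TP] := stage.
exists (\bigcup_n T n), (fun j => 2 ^+ (j * j) * 2^-1 ^+ 19); split.
- move=> D [n _ TD]; have [Tc Tg _] := TP n.
  have := sum_bounded_mem Tc TD; rewrite /stage_size.
  have := Tg D TD; rewrite /far_disc /stage_gap exprS mulrA divff ?mul1r // => Dn Dr.
  have : 2^-1 ^+ (n.+1 * (n + 20)) <= 2^-1 ^+ 3 * 2^-1 ^+ n :> R.
    by rewrite -exprD; apply: exprV2_le; nia.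
  have := @exprV2_le R 0 n (leq0n n); rewrite expr0 => n1.
  have -> : 2^-1 ^+ 3 = 8^-1 :> R by field.
  by move=> h; split; lra.
- move=> j; apply: (sum_bounded_bigcup (b := fun n => 2 ^+ (j * j) * 2^-1 ^+ (n + 20))).
    move=> n; have [Tc Tg _] := TP n; apply: sum_bounded_le (stage_weight n j) _.
    apply: sum_bounded_scale Tc; first by rewrite !exprn_ge0.
    move=> D /Tg; rewrite /stage_gap exprS mulrA divff ?mul1r // => Dn.
    have n0 := exprV2_gt0 R n; have D0 := lt_le_trans n0 Dn.
    rewrite ler_pdivrMr ?exprn_gt0 // mulrAC -exprMn ler_peMl ?(ltW (radius_gt0 D)) //.
    rewrite exprn_ege1 // -(ler_pM2l n0).
    by rewrite mulr1 mulrA -exprMn mulVf // expr1n mul1r.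
  by move=> n; rewrite -mulr_sumr ler_wpM2l ?exprn_ge0 // sum_exprV2.
- by rewrite muln1 expr1 !exprS expr0; lra.
move=> x e x0 x1 e0; have nx : 0 < normc x by rewrite normc_gt0.
have [|n] := @exprV2_small R (Num.min (normc x / 2) e); first by rewrite lt_min divr_gt0.
rewrite lt_min => /andP[nx2 ne]; have [_ _ sT] := TP n.
apply: (@separating_sub (T n) _ (2^-1 ^+ n)); [by move=> D TD; exists n|exact: ltW|].
apply: sT => //; rewrite /stage_gap exprS; lra.
Qed.

End Stages.

Section PuncturedDisc.
Variable R : realType.
Local Notation C := R[i]^o.
Local Notation disc_center D := (Defs.center D : R[i]).
Implicit Types (D : open_disc R) (S : set (open_disc R)).

Definition meeting_discs S : set (open_disc R) :=
  [set D | S D /\ disc_set D `&` disc_set (unit_disc R) !=set0].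

Lemma off_discsP S (z : R[i]) : off_discs S z <-> ~ (\bigcup_(D in S) disc_set D) z.
Proof.
split=> [zS [D SD]|zS D SD]; first by rewrite disc_setE ltNge zS.
by rewrite leNgt; apply/negP => zD; apply: zS; exists D => //; rewrite disc_setE.
Qed.

Lemma punctured_disc_complement S : punctured_disc S = disc_complement (meeting_discs S).
Proof.
rewrite /disc_complement closure_unit_disc; apply/seteqP; split=> z /=.
  move=> [z1 zS]; split=> //; apply/off_discsP; apply: off_discs_sub zS.
  by move=> D [].
move=> [z1 zS]; split=> //; apply/off_discsP => -[D SD Dz]; apply: zS; exists D => //.
split=> //; rewrite setIC.
have : closure (disc_set (unit_disc R)) z by rewrite closure_unit_disc.
by apply; apply: open_nbhs_nbhs; split => //; exact: open_disc_open.
Qed.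

Lemma compact_punctured_disc S : compact (punctured_disc S).
Proof.
apply: (subclosed_compact _ (@compact_unit_disc R)); last by move=> z [].
rewrite punctured_disc_complement; apply: closedI; first exact: closed_closure.
by apply: open_closedC; apply: bigcup_open => D _; exact: open_disc_open.
Qed.

Lemma rational_off_algebra S (f : R[i] -> R[i]) : rational_off S f ->
  rational_algebra (punctured_disc S) (fun x => f (set_val x)).
Proof.
move=> [p [q fpq]]; apply: alg_rational; exists p, q => x; apply: fpq.
by have [] := set_val_mem x.
Qed.

Lemma limit_rational_off_algebra S (f : R[i] -> R[i]) : limit_rational_off S f ->
  rational_algebra (punctured_disc S) (fun x => f (set_val x)).
Proof.
move=> lf; apply: alg_lim => e /lf[g /rational_off_algebra rg fg].
exists (fun x => g (set_val x)) => // x; apply: fg.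
by have [] := set_val_mem x.
Qed.

Lemma interior_punctured_disc S :
  (forall (x : R[i]) (e : R), x != 0 -> normc x <= 1 -> 0 < e ->
     exists2 D, S D & normc (disc_center D - x) <= e) ->
  interior (punctured_disc S) = set0.
Proof.
move=> dS; apply/seteqP; split=> // z /nbhs_normcP[e e0 eK].
have [w [w0 wz]] : exists w : R[i], w != 0 /\ normc (w - z) < e / 2.
  have [z0|z0] := eqVneq (z : R[i]) 0; last by exists z; rewrite subrr normc0 divr_gt0.
  exists (e / 4)%:C; rewrite -normc_gt0 z0 subr0 normc_real gtr0_norm ?divr_gt0 //; lra.
have [w1 _] := eK w (lt_trans wz (ltac:(lra) : e / 2 < e)).
have [D SD Dw] := dS w (e / 2) w0 w1 (divr_gt0 e0 (ltr0Sn _ _)).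
have [|_ /(_ D SD)] := eK (Defs.center D).
  by have := @ler_normc_dist R w (Defs.center D) z; lra.
by rewrite subrr normc0 leNgt radius_gt0.
Qed.

Lemma sum_bounded1 (w : open_disc R -> R) D : 0 <= w D -> sum_bounded w [set D] (w D).
Proof.
move=> w0 [_ _|D1 [|D2 s] us sD]; first by rewrite big_nil.
  by rewrite big_seq1 (_ : D1 = D) //; apply: sD; rewrite inE.
have D1D : D1 = D by apply: sD; rewrite inE eqxx.
have D2D : D2 = D by apply: sD; rewrite !inE eqxx orbT.
by move: us; rewrite D1D D2D /= inE eqxx.
Qed.

Lemma browder_meeting_discs S (B : R) m :
  (forall D, S D -> far_disc D) -> punctured_disc S 0 ->
  sum_bounded (fun D => Defs.radius D / normc (disc_center D) ^+ m.+1) S B ->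
  browder_condition (meeting_discs S) m 0.
Proof.
move=> farS zS SB; split; first by rewrite -punctured_disc_complement.
have sD D : S D -> 0 < normc (disc_center D) / 2 <= s_ 0 D.
  move=> /farS; rewrite /far_disc => Dfar; have := radius_gt0 D.
  by have := boundary_distance D => h r0; apply/andP; split; lra.
have su : 0 < s_ 0 (unit_disc R).
  rewrite (@lt_le_trans _ _ 1) //; apply: lb_le_inf => [|_ [z zD <-]].
    exists (normc (1 - 0 : R[i])); exists 1 => //.
    by rewrite boundary_disc; change (normc ((1 : R[i]) - 0) = 1); rewrite subr0 normc1.
  by move: zD; rewrite boundary_disc => zD; have -> : normc ((z : R[i]) - 0) = 1 by [].
pose w D := Defs.radius D / s_ 0 D ^+ m.+1.
have wS : sum_bounded w (meeting_discs S) (2 ^+ m.+1 * B).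
  apply: (sum_bounded_sub (S' := S)); first by move=> D [].
  apply: sum_bounded_scale SB => [|D /sD /andP[c0 cs]]; first by rewrite exprn_ge0.
  rewrite mulrCA ler_wpM2l ?(ltW (radius_gt0 D)) //.
  have -> : 2 ^+ m.+1 / normc (disc_center D) ^+ m.+1 = ((normc (disc_center D) / 2) ^+ m.+1)^-1.
    by rewrite expr_div_n invf_div.
  move: (normc _ / 2) (s_ 0 D) c0 cs => c t c0 ct; have t0 := lt_le_trans c0 ct.
  by rewrite lef_pV2 ?posrE ?exprn_gt0 // lerXn2r // nnegrE ltW.
have wu : sum_bounded w [set unit_disc R] (w (unit_disc R)).
  apply: sum_bounded1; rewrite divr_ge0 ?(ltW (radius_gt0 _)) //.
  by rewrite exprn_ge0 // ltW.
apply: (@le_lt_trans _ _ (2 ^+ m.+1 * B + w (unit_disc R))%:E); last exact: ltry.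
apply: esum_sum_bounded (sum_boundedU wS wu) => D DS.
have s0 : 0 < s_ 0 D.
  move: DS => [[SD _]|->]; last exact: su.
  by have /andP[c0 cs] := sD D SD; exact: (lt_le_trans c0 cs).
by rewrite inver gt_eqF // exprn_gt0.
Qed.

End PuncturedDisc.

Theorem theorem1p5 (R : realType) :
  exists (K : set R[i]^o) (o : set_type K),
    [/\ compact_plane_set K /\ set_val o = 0,
        normal_algebra (rational_algebra K),
        forall x : set_type K, set_val x <> 0 ->
          strongly_regular_at (rational_algebra K) x,
        exists d : nat -> (set_type K -> R[i]^o) -> R[i]^o,
          [/\ point_derivation_infinite_order (rational_algebra K) (evaluation o) d,
              bounded_derivation (rational_algebra K) d &
              nondegenerate_derivation (rational_algebra K) d] &
        swiss_cheese K /\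
        exists DD : set (open_disc R),
          [/\ forall D, DD D -> disc_set D `&` disc_set (unit_disc R) !=set0,
              K = disc_complement DD &
              forall m : nat, (1 <= m)%N -> browder_condition DD m 0]].
Proof.
have [S [B [Sfar SB B1 sepS]]] := separating_discs R.
have cK := @compact_punctured_disc R S.
have zS : punctured_disc S 0.
  split=> [|D /Sfar[_]]; first by rewrite normc0 ler01.
  rewrite /far_disc sub0r normc_opp.
  by have := radius_gt0 D; lra.
have [B' B'P] := punctured_taylor_bound Sfar SB B1.
pose o := SigSub (mem_set zS) : set_type (punctured_disc S).
have o0 : set_val o = 0 by [].
have mK (x : set_type (punctured_disc S)) : punctured_disc S (set_val x) by exact: set_val_mem.
exists (punctured_disc S), o; split.
- by split=> //; split=> //; exists 0.
- apply: rational_algebra_normal => // x e x0 e0.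
  have [x1 xS] := mK x; have [[chi [lchi [d d0 chi1] chi0 _]] _ _] := sepS _ _ x0 x1 e0.
  exists (fun y => chi (set_val y)); first exact: limit_rational_off_algebra.
  split; first by exists d => // y /ltW; apply: chi1; have [] := mK y.
  by move=> y; apply: chi0; have [] := mK y.
- move=> x /eqP x0; have [x1 xS] := mK x.
  apply: rational_algebra_strongly_regular => // [z []//|e e0|e e0].
    have [[chi [lchi [d d0 chi1] _ chi4]] _ _] := sepS _ _ x0 x1 e0.
    exists (fun y => chi (set_val y)); first exact: limit_rational_off_algebra.
    split; first by exists d => // y /ltW; apply: chi1; have [] := mK y.
    by move=> y; apply: chi4; have [] := mK y.
  have [_ _ /(_ xS)[G rG GP]] := sepS _ _ x0 x1 e0.
  exists (fun y => G (set_val y)); first exact: rational_off_algebra.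
  by move=> y; have [y1 yS] := mK y; exact: GP.
- exists (derivation B'); split.
  + exact: (derivation_point cK o0 B'P).
  + exact: (derivation_bounded cK o0 B'P).
  + exact: (derivation_nondegenerate o0 B'P).
split.
  split=> //.
  + by rewrite closure_unit_disc => z [].
  + by apply: interior_punctured_disc => x e x0 x1 e0; have [_] := sepS x e x0 x1 e0.
  + exact: (rational_algebra_neq_continuous cK o0 B'P).
exists (meeting_discs S); split=> [D []//||m _]; first exact: punctured_disc_complement.
by apply: (browder_meeting_discs _ zS (SB m.+1)) => D /Sfar[].
Qed.
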